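(* Let $T$ be an irreducible triangulation with $n$ vertices endowed with a transversal pair of bipolar orientations. Then \textsc{CompactTransversalDraw}($T$) outputs a straight-line drawing of $T$ whose grid has half-perimeter at most $n-1$. The embedded edges satisfy: red edges are oriented from bottom to top and weakly oriented from left to right; blue edges are oriented from left to right and weakly oriented from top to bottom. The algorithm can be implemented to run in linear time.
   Context: An irreducible triangulation is a plane graph with quadrangular outer face (outer vertices $N,E,S,W$ in clockwise order), triangular inner faces, and no separating triangle. A transversal pair of bipolar orientations assigns to each inner edge a direction and a color red or blue so that: around each inner vertex, the incident edges form in clockwise order nonempty intervals of outgoing red, outgoing blue, ingoing red, ingoing blue edges; all inner edges at $N,E,S,W$ are respectively ingoing red, ingoing blue, outgoing red, outgoing blue. The red-map $T_r$ is $T$ minus blue edges, with outer edges oriented $S\to W\to N$, $S\to E\to N$; the blue-map $T_b$ is $T$ minus red edges, with outer edges oriented $W\to N\to E$, $W\to S\to E$. The separating red path $\mathcal{P}_r(v)$ of a vertex $v$ is the concatenation of the path from $v$ always following the leftmost outgoing edge of $T_r$ (to $N$) and the path from $v$ always following backward the rightmost ingoing edge of $T_r$ (to $S$); $\mathcal{P}_b(v)$ is defined likewise in $T_b$. \textsc{TransversalDraw} places $v$ at abscissa = number of inner faces of $T_r$ left of $\mathcal{P}_r(v)$ and ordinate = number of inner faces of $T_b$ right of $\mathcal{P}_b(v)$, and draws edges as segments. \textsc{CompactTransversalDraw} runs \textsc{TransversalDraw} and then deletes the vertical and horizontal grid lines that carry no vertex (unused abscissas and ordinates), shifting coordinates accordingly.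 *)

(* Defs.v *)
From mathcomp Require Import all_boot all_order all_algebra.
Set Implicit Arguments.
Unset Strict Implicit.
Unset Printing Implicit Defensive.
Import Order.TTheory GRing.Theory Num.Theory.

(** * Plane graphs

A simple connected plane graph is given by a combinatorial map.  A dart is an
edge with a chosen direction, [edge] reverses it, and [turn x] is the dart that
follows [x] clockwise around its origin.  The dart [turn (edge x)] then follows
[x] along the face lying on the left of [x], so that the orbit of [x] under
[face] is the face on its left.  Planarity is Euler's relation. *)

Record plane_graph := PlaneGraph {
  vertex : finType;
  dart : finType;
  org : dart -> vertex;
  edge : dart -> dart;
  turn : dart -> dart;
  outer : dart; (* a dart with the outer face on its left *)
  edgeK : involutive edge;
  turn_inj : injective turn;
  org_turn : forall x y, (org x == org y) = fconnect turn x y;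
  org_surj : forall v, exists x, org x = v;
  loopless : forall x, org (edge x) != org x;
  no_multi : forall x y,
    org x = org y -> org (edge x) = org (edge y) -> x = y;
  connected : forall u v,
    connect [rel a b | [exists x, (org x == a) && (org (edge x) == b)]] u v;
  euler : #|vertex| + fcard (turn \o edge) dart = fcard edge dart + 2
}.

Section PlaneGraph.
Variable T : plane_graph.
Implicit Types (x y : dart T) (u v : vertex T).

Definition face x := turn (edge x).
Definition outer_face : {set dart T} := [set x in orbit face (outer T)].
Definition inner_edge x := (x \notin outer_face) && (edge x \notin outer_face).

(* Starting from a dart, move along the faces cut out by [f], crossing an edge
only if it does not belong to [wall]. *)
Definition dual_step (f : dart T -> dart T) (wall : pred (dart T)) :=
  [rel x y | (y == f x) || [&& y == edge x, ~~ wall x & ~~ wall y]].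

Definition triangle x y z :=
  [/\ org (edge x) = org y, org (edge y) = org z & org (edge z) = org x].

(* A triangle is separating if some vertex lies strictly on each side. *)
Definition separating x y z :=
  exists a b,
    [/\ org a \notin [:: org x; org y; org z],
        org b \notin [:: org x; org y; org z] &
        ~~ connect (dual_step face [in [:: x; y; z]]) a b].

(* Since the outer face is on the left of [outer], iterating [face] from
[outer] goes clockwise around the graph. *)
Definition dartN := outer T.
Definition dartE := face dartN.
Definition dartS := face dartE.
Definition dartW := face dartS.
Definition vN := org dartN.
Definition vE := org dartE.
Definition vS := org dartS.
Definition vW := org dartW.

Definition inner_vertex v := v \notin [:: vN; vE; vS; vW].

Definition irreducible_triangulation :=
  [/\ order face (outer T) = 4,
      uniq [:: vN; vE; vS; vW],
      forall x, x \notin outer_face -> order face x = 3 &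
      forall x y z, triangle x y z -> ~ separating x y z].

(* [out x] means that the edge of [x] is directed away from [org x].  The
values of [red] and [out] on outer edges are irrelevant. *)
Record transversal_pair := TransversalPair {
  red : pred (dart T);
  out : pred (dart T);
  red_edge : forall x, inner_edge x -> red (edge x) = red x;
  out_edge : forall x, inner_edge x -> out (edge x) = ~~ out x;
  inner_rule : forall v, inner_vertex v ->
    exists x a b c d, org x = v /\
      [seq (out y, red y) | y <- orbit (@turn T) x]
      = nseq a.+1 (true, true) ++ nseq b.+1 (true, false)
        ++ nseq c.+1 (false, true) ++ nseq d.+1 (false, false);
  rule_N : forall x, inner_edge x -> org x = vN -> ~~ out x && red x;
  rule_E : forall x, inner_edge x -> org x = vE -> ~~ out x && ~~ red x;
  rule_S : forall x, inner_edge x -> org x = vS -> out x && red x;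
  rule_W : forall x, inner_edge x -> org x = vW -> out x && ~~ red x
}.

(** * Separating paths

[K] selects the darts of a submap containing the outer edges, and [O] those
directed away from their origin. *)

Section Submap.
Variables K O : pred (dart T).

Definition turnK x := next [seq y <- orbit (@turn T) x | K y] x.
Definition prevK x := prev [seq y <- orbit (@turn T) x | K y] x.
Definition faceK x := turnK (edge x).

(* The first dart, clockwise, of the outgoing or of the ingoing interval around
its origin; an interval may start after the previous one or after the outer
corner.  An outgoing dart is first iff it is the leftmost outgoing edge, and an
ingoing one iff it is the rightmost ingoing edge, left and right being those of
a traveller following the orientation. *)
Definition first x := K x && ((x \in outer_face) || (O (prevK x) != O x)).

Definition up_step := [rel u v | [exists x,
  [&& first x, O x, org x == u & org (edge x) == v]]].
Definition down_step := [rel u v | [exists x,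
  [&& first x, ~~ O x, org x == u & org (edge x) == v]]].

(* The edges of the separating path of [v], as darts directed from the source
to the sink of the submap. *)
Definition sep_path v : pred (dart T) := [pred x |
  [&& first x, O x & connect up_step v (org x)]
  || [&& first (edge x), ~~ O (edge x) & connect down_step v (org (edge x))]].

Definition path_wall v : pred (dart T) := [pred x |
  sep_path v x || (x \in outer_face)].

Definition left_of v : {set dart T} := [set y | [exists x,
  [&& x \notin outer_face, sep_path v x
    & connect (dual_step faceK (path_wall v)) x y]]].
Definition right_of v : {set dart T} := [set y | [exists x,
  [&& x \notin outer_face, sep_path v (edge x)
    & connect (dual_step faceK (path_wall v)) x y]]].

Definition faces_left v := fcard faceK (mem (left_of v)).
Definition faces_right v := fcard faceK (mem (right_of v)).

End Submap.

(** * The algorithms *)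

Section Algorithm.
Variable P : transversal_pair.

Definition in_red x := inner_edge x ==> red P x.
Definition out_red x :=
  if inner_edge x then out P x
  else x \in [:: dartS; dartW; edge dartE; edge dartN].

Definition in_blue x := inner_edge x ==> ~~ red P x.
Definition out_blue x :=
  if inner_edge x then out P x
  else x \in [:: dartW; dartN; edge dartS; edge dartE].

Definition transversal_x := faces_left in_red out_red.
Definition transversal_y := faces_right in_blue out_blue.

(* The new index of the grid line of [v] once all the lines carrying no vertex
are deleted. *)
Definition compress (z : vertex T -> nat) v :=
  count [in codom z] (iota 0 (z v)).

Definition compact_x := compress transversal_x.
Definition compact_y := compress transversal_y.

End Algorithm.

(** * Straight-line drawings *)

Section Drawing.
Local Open Scope ring_scope.
Variable R : realFieldType.
Variable pos : vertex T -> R * R.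

Definition on_segment (p q r : R * R) :=
  exists2 t : R, 0 <= t <= 1 &
    r = ((1 - t) * p.1 + t * q.1, (1 - t) * p.2 + t * q.2).

Definition det (p q : R * R) : R := p.1 * q.2 - p.2 * q.1.

(* [c] is strictly inside the sector swept clockwise from direction [a] to
direction [b]. *)
Definition in_sector (a b c : R * R) :=
  if det a b < 0 then (det a c < 0) && (det c b < 0)
  else (det a c < 0) || (det c b < 0).

Definition direction x : R * R := pos (org (edge x)) - pos (org x).

(* Planarity, agreement of the clockwise order around each vertex, and
unboundedness of the outer face: its boundary, traversed with the face on the
left, has negative signed area. *)
Definition straight_line_drawing :=
  [/\ injective pos,
      forall x y p, y <> x -> y <> edge x ->
        on_segment (pos (org x)) (pos (org (edge x))) p ->
        on_segment (pos (org y)) (pos (org (edge y))) p ->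
        exists v, [/\ v \in [:: org x; org (edge x)],
                      v \in [:: org y; org (edge y)] & p = pos v],
      forall x y, org y = org x -> y <> x -> y <> turn x ->
        ~~ in_sector (direction x) (direction (turn x)) (direction y) &
      \sum_(x in outer_face) det (pos (org x)) (pos (org (edge x))) < 0].

Definition grid_position (x y : vertex T -> nat) v : R * R :=
  ((x v)%:R, (y v)%:R).

End Drawing.

(* The grid is [0, max x] x [0, max y]. *)
Definition half_perimeter (x y : vertex T -> nat) :=
  \max_v x v + \max_v y v.

End PlaneGraph.

(** * Unit-cost word machine

The memory is a family of arrays of naturals; a run may only store numbers
bounded by the word bound [w]. *)

Definition memory := nat -> nat -> nat.

Inductive exp :=
  | Cst of nat
  | Get of nat & exp
  | Add of exp & exp
  | Sub of exp & exp.

Inductive cmd :=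
  | Skip
  | Put of nat & exp & exp
  | Seq of cmd & cmd
  | If of exp & cmd & cmd
  | While of exp & cmd.

Fixpoint eval (m : memory) e :=
  match e with
  | Cst k => k
  | Get a i => m a (eval m i)
  | Add e1 e2 => eval m e1 + eval m e2
  | Sub e1 e2 => eval m e1 - eval m e2
  end.

Fixpoint cost e :=
  match e with
  | Cst _ => 1
  | Get _ i => (cost i).+1
  | Add e1 e2 | Sub e1 e2 => (cost e1 + cost e2).+1
  end.

Definition update (m : memory) a i k : memory :=
  fun b j => if (b == a) && (j == i) then k else m b j.

(* [exec w p m t m'] : started in [m], the program [p] stops after [t] steps in
[m'].  Tests succeed on nonzero values. *)
Inductive exec (w : nat) : cmd -> memory -> nat -> memory -> Prop :=
  | exec_skip m : exec w Skip m 1 m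
  | exec_put m a i e : eval m e <= w ->
      exec w (Put a i e) m (cost i + cost e).+1
        (update m a (eval m i) (eval m e))
  | exec_seq p q m1 m2 m3 t1 t2 :
      exec w p m1 t1 m2 -> exec w q m2 t2 m3 ->
      exec w (Seq p q) m1 (t1 + t2).+1 m3
  | exec_if e p q m m' t :
      exec w (if eval m e != 0 then p else q) m t m' ->
      exec w (If e p q) m (cost e + t).+1 m'
  | exec_stop e p m : eval m e = 0 ->
      exec w (While e p) m (cost e).+1 m
  | exec_loop e p m1 m2 m3 t1 t2 : eval m1 e != 0 ->
      exec w p m1 t1 m2 -> exec w (While e p) m2 t2 m3 ->
      exec w (While e p) m1 (cost e + t1 + t2).+1 m3.

(* Vertices and darts are named by their ranks; cells beyond the input are 0. *)
Definition input (T : plane_graph) (P : transversal_pair T) : memory :=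
  let table (f : dart T -> nat) := [seq f x | x <- enum (dart T)] in
  let arrays :=
    [:: [:: #|vertex T|; #|dart T|; nat_of_ord (enum_rank (outer T))];
        table (fun x => enum_rank (org x));
        table (fun x => enum_rank (edge x));
        table (fun x => enum_rank (turn x));
        table (fun x => red P x);
        table (fun x => out P x)] in
  fun a i => nth 0 (nth [::] arrays a) i.

(* On termination, cell [enum_rank v] of arrays 6 and 7 holds the coordinates
of [v].  Words have O(log n) bits: stored values are at most linear in [n]. *)
Definition linear_time_algorithm (x y : forall T : plane_graph,
    transversal_pair T -> vertex T -> nat) :=
  exists (p : cmd) (c : nat),
    forall (T : plane_graph) (P : transversal_pair T),
      irreducible_triangulation T ->
      exists t m,
        [/\ exec (c * #|vertex T|) p (input P) t m,
            t <= c * #|vertex T| &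
            forall v, m 6 (enum_rank v) = x T P v
                   /\ m 7 (enum_rank v) = y T P v].

(* Main.v *)
(* Orient the outer edges from S through W and E to N.  The leftmost outgoing
edges of the vertices other than N then form a plane tree rooted at N, whose
contour, started at N, visits every dart once.  The separating red path of v
consists of the red edges whose right and left faces in the red map lie before
and after the moment when the contour enters v.  Each inner face of the red map
contributes one ingoing red dart off the tree, and the faces on the right of the
path are those whose dart is met before v is entered.  So their number, the
height of v, can be read along the contour.  It is monotone along red edges and
strictly monotone along blue ones.  A quarter turn exchanges the colours and
gives the ordinates, and by Euler's relation the two maps have n - 1 inner faces
altogether, which bounds the half-perimeter.

The coordinates send the edges of each class into a half-open quadrant, so that
the faces are drawn with their orientation.  The edges met by a vertical line
are then chained through the triangles between them, with increasing ordinates,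
and cannot cross.

Heights do not decrease along the contour.  Hence one walk along it suffices to
compute the compressed heights, by incrementing a counter whenever a vertex is
entered after a counted dart. *)

(* The rules are local: they do not say that leftmost edges lead to N, nor that the orientation is
   acyclic. Both follow from one invariance argument. A set stable under the contour of a tree is
   constant on the darts of all vertices that reach the root. This applies to the leftmost edges and
   also, in the dual graph, to the other outgoing edges, of which each inner triangle has exactly
   one. Since the two contours coincide, the orbit of the contour is stable both under turning and
   under following faces, hence contains every dart. The time [entry v] then strictly decreases
   along every directed edge, red or blue, and serves as a potential in place of acyclicity.

   Several vertices may share an abscissa. They then have the same separating path, and the drawing
   increases lexicographically along it, whence injectivity.

   Vertical and horizontal edges are the obstacle in the geometric part. They are the reason why
   quadrants and crossings are half-open, and why the sweep is also applied to the drawing turned by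
   a half-turn. *)
Require Import Defs.
From mathcomp Require Import all_boot all_order all_algebra.
From mathcomp Require Import zify ring lra.
Set Implicit Arguments.
Unset Strict Implicit.
Unset Printing Implicit Defensive.

(** * Contour of a plane tree *)

Section OrbitLemmas.
Variables (D : finType) (f : D -> D).

Lemma findex_iter_le (x : D) i : findex f x (iter i f x) <= i.
Proof.
have [lt|ge] := ltnP i (order f x); first by rewrite findex_iter.
by apply: leq_trans ge; apply: ltnW; apply: findex_max; apply: fconnect_iter.
Qed.

Lemma iter_of_findex (x y : D) : fconnect f x y ->
  exists2 i, i < order f x & y = iter i f x.
Proof. by move=> c; exists (findex f x y); [exact: findex_max | rewrite iter_findex]. Qed.

Hypothesis fI : injective f.

(** Only the step from [p] is not assumed, and the orbit closes up: going round from [f p] until [p]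
    is reached again makes up for it. *)
Lemma constant_on_orbit (S : D -> bool) (p : D) :
  (forall y, fconnect f p y -> y != p -> S (f y) = S y) -> S (f p) = S p.
Proof.
move=> h.
have key i : i.+1 <= order f p -> S (iter i f (f p)) = S (f p).
  elim: i => // i IH lt; rewrite iterS h ?IH -?iterSr //; first exact: ltnW.
    exact: fconnect_iter.
  by rewrite eq_sym -(findex_eq0 f) findex_iter.
rewrite -(key (order f p).-1) ?orderSpred //.
by rewrite -iterSr orderSpred iter_order.
Qed.

Variable r : D.
Hypothesis fr : forall x, fconnect f r x.
Let pos x := findex f r x.

Lemma findex_inj : injective (findex f r).
Proof. by move=> x y e; rewrite -(iter_findex (fr x)) e iter_findex. Qed.

Lemma findex_succ x : f x != r -> pos (f x) = (pos x).+1.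
Proof.
move=> ne; have := findex_max (fr x); rewrite -/(pos x) leq_eqVlt => /orP[/eqP e|lt].
  by case/eqP: ne; rewrite -{1}(iter_findex (fr x)) -iterS -/(pos x) e iter_order.
by rewrite -{1}(iter_findex (fr x)) -iterS /pos findex_iter.
Qed.

Section Interval.
Variables (X : pred D) (a b : D).
Hypothesis (Xr : ~~ X r) (Xa : X a).
Hypothesis enter : forall x, ~~ X x -> X (f x) -> f x = a.
Hypothesis exit : forall x, X x -> ~~ X (f x) -> x = b.

(** The walk starts at [r], outside [X], so it must have come in through [a]; it returns to [r], so
    it later goes out through [b]. Each of [a] and [b] is visited once, hence a single interval. *)
Lemma interval_of_mem y : X y -> pos a <= pos y <= pos b.
Proof.
move=> Xy; have [i lt e] := iter_of_findex (fr y); have py : pos y = i.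
  by rewrite e /pos findex_iter.
rewrite py; apply/andP; split.
  have {lt Xy}: X (iter i f r) by rewrite -e.
  elim: i {e py} => [|i IH]; first by rewrite (negPf Xr).
  case Xi: (X (iter i f r)) => /=; first by move=> _; apply: leqW; apply: IH.
  move=> /(enter (negbT Xi)) <-; exact: (findex_iter_le _ i.+1).
have ex : exists k, (i < k) && ~~ X (iter k f r).
  by exists (order f r); rewrite iter_order // lt.
case: (ex_minnP ex) => -[//|k] /andP[ik nX] kmin.
have lek : k.+1 <= order f r by apply: kmin; rewrite iter_order // lt.
have Xk : X (iter k f r).
  move: ik; rewrite ltnS leq_eqVlt => /orP[/eqP <-|ik]; first by rewrite -e.
  by apply: contraT => nXk; have := kmin k; rewrite ik nXk ltnn => /(_ isT).
by rewrite -(exit Xk nX) /pos findex_iter.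
Qed.

Lemma mem_of_interval y : pos a <= pos y <= pos b -> X y.
Proof.
move=> /andP[le1 le2]; rewrite -(iter_findex (fr y)) -/(pos y).
elim: (pos y) le1 le2 => [|i IH].
  rewrite leqn0 => /eqP e _; move: Xa; rewrite -(iter_findex (fr a)) -/(pos a) e //.
rewrite leq_eqVlt => /orP[/eqP e _|le1 le2].
  by rewrite -e /pos (iter_findex (fr a)).
apply: contraT => nX; have Xi : X (iter i f r) by apply: IH => //; apply: ltnW.
move: le2; rewrite -(exit Xi nX) => le2.
by have := findex_iter_le r i; rewrite leqNgt le2.
Qed.

End Interval.
End OrbitLemmas.

(* A plane tree [H], each of whose edges is represented by its dart leaving the
child, is explored by its contour [psi]. *)
Section Contour.
Variables (D V : finType) (org : D -> V) (edge turn : D -> D) (root : V).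
Variable H : pred D.
Hypothesis edgeK : involutive edge.
Hypothesis turnI : injective turn.
Hypothesis orgE : forall x y, (org x == org y) = fconnect turn x y.
Hypothesis H_uniq : forall x y, H x -> H y -> org x = org y -> x = y.
Hypothesis H_ex : forall x, org x != root -> exists2 p, H p & org p = org x.
Hypothesis H_root : forall p, H p -> org p != root.

Definition on_tree x := H x || H (edge x).
Definition contour x := turn (if on_tree x then edge x else x).
(** The root, having no dart in [H], is a fixed point, so that iterating too often does no harm. *)
Definition parent v :=
  if [pick p | H p && (org p == v)] is Some p then org (edge p) else v.
Local Notation psi := contour.

Lemma on_tree_edge x : on_tree (edge x) = on_tree x.
Proof. by rewrite /on_tree edgeK orbC. Qed.

Lemma contour_inj : injective psi.
Proof.
move=> x y /turnI; case: ifP => tx; case: ifP => ty //.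
- exact: (can_inj edgeK).
- by move=> e; rewrite -e on_tree_edge tx in ty.
- by move=> e; rewrite e on_tree_edge ty in tx.
Qed.

Lemma org_turn_contour x : org (turn x) = org x.
Proof. by apply/eqP; rewrite eq_sym orgE fconnect1. Qed.

Lemma parent_org p : H p -> parent (org p) = org (edge p).
Proof.
move=> Hp; rewrite /parent; case: pickP => [q /andP[Hq /eqP e]|/(_ p)].
  by rewrite (H_uniq Hq Hp e).
by rewrite Hp eqxx.
Qed.

Lemma parent_root : parent root = root.
Proof.
rewrite /parent; case: pickP => // p /andP[/H_root /negP ne /eqP e].
by case: ne; rewrite e.
Qed.

(** A priori parents may run in cycles. The invariance argument is restricted to the vertices that
    do reach the root. *)
Definition rooted v := fconnect parent v root.

Lemma iter_root k : iter k parent root = root.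
Proof. by elim: k => //= k ->; rewrite parent_root. Qed.

Lemma rooted_parent v : rooted (parent v) = rooted v.
Proof.
apply/idP/idP => c; first by apply: connect_trans c; apply: fconnect1.
have /iter_of_findex [k _ e] := c.
by rewrite /rooted -(parent_root) e -iterS iterSr fconnect_iter.
Qed.

Section Invariant.
Variable S : pred D.
Hypothesis Spsi : forall x, S (psi x) = S x.

(** A turn is a contour step, preceded by a change of side when the edge is in the tree. So an
    invariant set can change around a vertex only if it distinguishes the two sides of a tree
    edge. *)
Lemma S_turn x : S (turn x) = S (if on_tree x then edge x else x).
Proof.
rewrite -[RHS]Spsi /contour; case t: (on_tree x); last by rewrite t.
by rewrite on_tree_edge t edgeK.
Qed.

(* If the sides of [p] were distinguished by [S], turning around its origin would
give a child edge with the same property, and so on endlessly. *)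
Lemma two_sided p : H p -> rooted (org p) -> S p = S (edge p).
Proof.
move=> Hp Rp; apply/eqP; apply: contraT => bad.
have desc k : exists q, [/\ H q, rooted (org q), S q != S (edge q) &
    iter k parent (org q) = org p].
  elim: k => [|k [q [Hq Rq bq e]]]; first by exists p.
  case: (boolP [exists y, [&& org q == org y, y != q & S (turn y) != S y]]);
    last first.
    rewrite negb_exists => /forallP nex; case/negP: bq; apply/eqP; symmetry.
    have := @constant_on_orbit _ _ turnI S q; rewrite S_turn /on_tree Hq /=.
    apply=> y c ne; have := nex y; rewrite orgE c ne /= negbK => /eqP //.
  case/existsP=> y /and3P[/eqP yq ne Sy].
  have t : on_tree y by move: Sy; rewrite S_turn; case: ifP => //; rewrite eqxx.
  have He : H (edge y).
    by case/orP: (t) => // Hy; case/eqP: ne; apply: H_uniq.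
  have pe : parent (org (edge y)) = org q by rewrite parent_org // edgeK -yq.
  exists (edge y); split=> //.
  - by rewrite -rooted_parent pe.
  - by move: Sy; rewrite S_turn t edgeK.
  by rewrite iterSr pe.
(* A rooted vertex reaches the root in fewer than [#|V|] steps, so its ancestor after [#|V|] steps
   is the root; but it is [org p]. *)
have [q [Hq Rq _ e]] := desc #|V|.
have [i lt ei] := iter_of_findex Rq.
have := H_root Hp; rewrite -e.
have -> : #|V| = (#|V| - i) + i.
  by rewrite subnK //; apply: leq_trans (ltnW lt) (max_card _).
by rewrite iterD -ei iter_root eqxx.
Qed.

Lemma S_same_vertex x y : rooted (org x) -> org x = org y -> S x = S y.
Proof.
move=> Rx /eqP; rewrite orgE => /iter_of_findex [i _ ->] {y}.
elim: i => //= i ->.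
have /eqP e : org x == org (iter i turn x) by rewrite orgE fconnect_iter.
move: (iter i turn x) e => z e; rewrite S_turn.
case: ifP => // /orP[Hz|Hz]; first by apply: two_sided; rewrite -?e.
rewrite -{1}[z]edgeK; apply/esym/two_sided => //.
by rewrite -rooted_parent parent_org // edgeK -e.
Qed.

(** Climb to the root, alternately moving around a vertex to its tree edge and changing side along
    that edge. *)
Lemma S_rooted r x : org r = root -> rooted (org x) -> S x = S r.
Proof.
move=> er /[dup] Rx /iter_of_findex [k _]; elim: k x Rx => [|k IH] x Rx.
  by move=> /= e; apply: S_same_vertex => //; rewrite er.
rewrite iterSr => e; have [ex|ne] := eqVneq (org x) root.
  by apply: S_same_vertex => //; rewrite er.
have [p Hp ep] := H_ex ne.
rewrite (S_same_vertex Rx (esym ep)) two_sided ?ep //.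
have pe := parent_org Hp; rewrite ep in pe.
by apply: IH; rewrite -pe // rooted_parent.
Qed.
End Invariant.

Lemma rooted_contour x : rooted (org (psi x)) = rooted (org x).
Proof.
rewrite /contour org_turn_contour; case: ifP => // /orP[Hx|Hx].
  by rewrite -parent_org // rooted_parent.
by rewrite -(rooted_parent (org _)) parent_org // edgeK.
Qed.

(** The orbit of [r] is itself an invariant set, so [S_rooted] applies to it. *)
Lemma contour_component r x : org r = root -> fconnect psi r x = rooted (org x).
Proof.
move=> er; apply/idP/idP => [/iter_of_findex [i _ ->]|Rx].
  by elim: i => [|i IH]; rewrite ?iterS ?rooted_contour //= er /rooted connect0.
rewrite (@S_rooted (fconnect psi r) _ r) //.
by move=> y; rewrite -same_fconnect1_r //; apply: contour_inj.
Qed.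

Definition subtree v x := fconnect parent (org x) v.

Section Positions.
Variable r : D.
Hypothesis org_r : org r = root.
Hypothesis cover : forall x, fconnect psi r x.

Lemma rN v : v != root -> ~~ subtree v r.
Proof.
move=> ne; rewrite /subtree org_r; apply/negP => /iter_of_findex [k _].
by rewrite iter_root => e; rewrite e eqxx in ne.
Qed.

Lemma subtree_org p x : org x = org p -> subtree (org p) x.
Proof. by move=> e; rewrite /subtree e connect0. Qed.

(** The contour changes vertex only along tree edges, so it enters the subtree of [org p] only by
    traversing [edge p], which leads to [turn p], and leaves it only from [p]. *)
Lemma subtree_enter p x : H p -> ~~ subtree (org p) x ->
  subtree (org p) (psi x) -> psi x = turn p.
Proof.
move=> Hp; rewrite /subtree /contour org_turn_contour.
case: ifP => t nx sx; last by rewrite sx in nx.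
congr turn; case/orP: t => t.
  case/negP: nx; apply: connect_trans sx.
  by rewrite -parent_org // fconnect1.
apply: H_uniq => //; have /iter_of_findex [[|k] _ e] := sx; first by rewrite e.
by case/negP: nx; rewrite e iterSr parent_org // edgeK fconnect_iter.
Qed.

Lemma subtree_exit p x : H p -> subtree (org p) x ->
  ~~ subtree (org p) (psi x) -> x = p.
Proof.
move=> Hp; rewrite /subtree /contour org_turn_contour.
case: ifP => t sx nx; last by rewrite sx in nx.
case/orP: t => t; last first.
  case/negP: nx; apply: connect_trans sx.
  by have := parent_org t; rewrite edgeK => <-; exact: fconnect1.
apply: H_uniq => //; have /iter_of_findex [[|k] _ e] := sx; first by rewrite e.
by case/negP: nx; rewrite e iterSr parent_org // fconnect_iter.
Qed.

Let pos x := findex psi r x.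

Lemma subtree_pos p y : H p ->
  subtree (org p) y = (pos (turn p) <= pos y <= pos p).
Proof.
move=> Hp.
have h1 := rN (H_root Hp).
have h2 : subtree (org p) (turn p) by apply: subtree_org; exact: org_turn_contour.
apply/idP/idP => h.
  exact: (interval_of_mem contour_inj cover h1 (fun x => @subtree_enter p x Hp)
    (fun x => @subtree_exit p x Hp) h).
exact: (mem_of_interval cover h2 (fun x => @subtree_exit p x Hp) h).
Qed.

Lemma pos_turn p : H p -> pos (turn p) = (pos (edge p)).+1.
Proof.
move=> Hp; have <- : psi (edge p) = turn p.
  by rewrite /contour on_tree_edge /on_tree Hp edgeK.
apply: (findex_succ contour_inj cover).
apply/eqP => e; have := H_root Hp.
by rewrite -org_r -e /contour on_tree_edge /on_tree Hp edgeK org_turn_contour eqxx.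
Qed.

Lemma vertex_pos p y : H p -> org y = org p ->
  pos (edge p) < pos y <= pos p.
Proof. by move=> Hp /subtree_org; rewrite subtree_pos // pos_turn. Qed.

End Positions.
End Contour.

(** * Classes of darts *)

(* A class is a pair (outgoing, red); [next_class] is the clockwise successor
in the cyclic order of the four intervals around an inner vertex. *)
Definition next_class (c : bool * bool) := (if c.2 then c.1 else ~~ c.1, ~~ c.2).
Definition class_step : rel (bool * bool) :=
  [rel c d | (d == c) || (d == next_class c)].
Definition class_rank (c : bool * bool) : nat := 2 * ~~ c.1 + ~~ c.2.

Lemma path_nseq (A : eqType) (e : rel A) x n s :
  e x x -> path e x (nseq n x ++ s) = path e x s.
Proof. by move=> exx; elim: n => //= n ->; rewrite exx. Qed.

Definition full_turn a b c d :=
  nseq a.+1 (true, true) ++ nseq b.+1 (true, false)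
  ++ nseq c.+1 (false, true) ++ nseq d.+1 (false, false).

Lemma cycle_full_turn a b c d : cycle class_step (full_turn a b c d).
Proof.
rewrite /full_turn /=.
rewrite -cats1 -catA path_nseq // /= -catA path_nseq // /=.
by rewrite -catA path_nseq //= path_nseq.
Qed.

Lemma sorted_full_turn a b c d :
  sorted leq (map class_rank (full_turn a b c d)).
Proof.
rewrite /full_turn /= map_cat map_nseq path_nseq //= map_cat map_nseq path_nseq //=.
by rewrite map_cat map_nseq path_nseq //= map_nseq -[nseq d _]cats0 path_nseq.
Qed.

Section PlaneGraphBasics.
Variable T : plane_graph.
Implicit Types (x y : dart T).

Definition tinv x := finv (@turn T) x.

Lemma turn_tinv x : turn (tinv x) = x.
Proof. exact: f_finv (@turn_inj T) _. Qed.
Lemma tinv_turn x : tinv (turn x) = x.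
Proof. exact: finv_f (@turn_inj T) _. Qed.
Lemma org_turn1 x : org (turn x) = org x.
Proof. by apply/eqP; rewrite eq_sym org_turn fconnect1. Qed.
Lemma org_tinv x : org (tinv x) = org x.
Proof. by rewrite -{2}[x]turn_tinv org_turn1. Qed.
Lemma face_inj : injective (@face T).
Proof. by move=> x y /turn_inj /(can_inj (@edgeK T)). Qed.
Lemma org_face x : org (face x) = org (edge x).
Proof. by rewrite org_turn1. Qed.
Lemma face_edge x : face (edge x) = turn x.
Proof. by rewrite /face edgeK. Qed.
Lemma edge_neq x : edge x != x.
Proof. by apply: contraNneq (loopless x) => ->. Qed.

Lemma orbit_vertex x y : org x = org y -> y \in orbit (@turn T) x.
Proof. by move=> e; rewrite -fconnect_orbit -org_turn e. Qed.

Lemma org_iter_turn i x : org (iter i (@turn T) x) = org x.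
Proof. by elim: i => //= i <-; rewrite org_turn1. Qed.

Lemma outer_face_face x : (face x \in outer_face T) = (x \in outer_face T).
Proof.
by rewrite !inE -!fconnect_orbit -same_fconnect1_r //; apply: face_inj.
Qed.

End PlaneGraphBasics.

(** * The rules at a vertex and inside a triangle *)

Section Local.
Variables (T : plane_graph) (P : transversal_pair T).
Hypothesis irr : irreducible_triangulation T.
Implicit Types (x y : dart T) (u v : vertex T).

Local Notation oN := (dartN T).
Local Notation oE := (dartE T).
Local Notation oS := (dartS T).
Local Notation oW := (dartW T).

Lemma outer_orbit : orbit (@face T) (outer T) = [:: oN; oE; oS; oW].
Proof. by case: irr => o4 _ _ _; rewrite /orbit o4. Qed.

Lemma outerE x : (x \in outer_face T) = (x \in [:: oN; oE; oS; oW]).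
Proof. by rewrite inE outer_orbit. Qed.

Lemma face_oW : face oW = oN.
Proof. by case: irr => o4 _ _ _; have := iter_order (@face_inj T) (outer T); rewrite o4. Qed.

Lemma face3 x : x \notin outer_face T -> face (face (face x)) = x.
Proof.
case: irr => _ _ o3 _ /o3 e; by have := iter_order (@face_inj T) x; rewrite e.
Qed.

Lemma tinv_face x : x \notin outer_face T -> tinv x = edge (face (face x)).
Proof.
by move=> ix; rewrite -{1}[x]face3 // {1}/face tinv_turn.
Qed.

Definition eight := [:: oN; oE; oS; oW; edge oN; edge oE; edge oS; edge oW].

Lemma ends : [/\ org oN = vN T, org (edge oN) = vE T & org (edge oE) = vS T]
  /\ [/\ org (edge oS) = vW T, org (edge oW) = vN T, org oE = vE T,
     org oS = vS T & org oW = vW T].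
Proof. by rewrite -!org_face face_oW. Qed.

Lemma uniq_outer_vertices : uniq [:: vN T; vE T; vS T; vW T].
Proof. by case: irr. Qed.

Lemma eight_uniq : uniq eight.
Proof.
apply: (@map_uniq _ _ (fun x => (org x, org (edge x)))).
have := uniq_outer_vertices.
rewrite /= !edgeK; case: ends => [[-> -> ->] [-> -> -> -> ->]].
rewrite !inE !negb_or !xpair_eqE => /and4P[/and3P[h1 h2 h3] /andP[h4 h5] h6 _].
rewrite !(eq_sym (vE T) (vN T)) !(eq_sym (vS T) (vN T)) !(eq_sym (vW T) (vN T)).
rewrite !(eq_sym (vS T) (vE T)) !(eq_sym (vW T) (vE T)) !(eq_sym (vW T) (vS T)).
by rewrite !(negPf h1) !(negPf h2) !(negPf h3) !(negPf h4) !(negPf h5) !(negPf h6) !andbF.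
Qed.

Lemma eight_eq i j : i < 8 -> j < 8 ->
  (nth oN eight i == nth oN eight j) = (i == j).
Proof. by move=> hi hj; rewrite nth_uniq // eight_uniq. Qed.

Lemma inner_eight x : inner_edge x = (x \notin eight).
Proof.
rewrite /inner_edge !outerE /eight -negb_or; congr negb.
rewrite !inE -!(inv_eq (@edgeK T)) -!orbA; do 4!congr (_ || _).
Qed.

Lemma inner_edge_edge x : inner_edge (edge x) = inner_edge x.
Proof. by rewrite /inner_edge edgeK andbC. Qed.

(** Blue inner edges keep their direction too: [ot] orients the whole of [T], the outer edges being
    directed as in the red map. *)
Definition ot : pred (dart T) := out_red P.
(* With this colouring of the outer edges, the inner triangles along the outer
face have the same classes as the other ones. *)
Definition rd : pred (dart T) := [pred x |
  if inner_edge x then red P x else x \in [:: oS; edge oS; oN; edge oN]].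
Definition cls x := (ot x, rd x).

Lemma ot_inner x : inner_edge x -> ot x = out P x.
Proof. by rewrite /ot /out_red => ->. Qed.
Lemma rd_inner x : inner_edge x -> rd x = red P x.
Proof. by rewrite /rd /= => ->. Qed.

Lemma cls_outer : [/\ cls oN = (false, true), cls oE = (false, false),
  cls oS = (true, true) & cls oW = (true, false)] /\
  [/\ cls (edge oN) = (true, true), cls (edge oE) = (true, false),
  cls (edge oS) = (false, true) & cls (edge oW) = (false, false)].
Proof.
have ni i : i < 8 -> inner_edge (nth oN eight i) = false.
  by move=> hi; rewrite inner_eight mem_nth.
have q i j hi hj := @eight_eq i j hi hj.
rewrite /cls /ot /out_red /rd /=.
rewrite (ni 0) // (ni 1) // (ni 2) // (ni 3) // (ni 4) // (ni 5) // (ni 6) // (ni 7) //.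
rewrite !inE.
rewrite (q 0 2) // (q 0 3) // (q 0 5) // (q 0 4) // (q 0 6) // (q 0 0) //.
rewrite (q 1 2) // (q 1 3) // (q 1 5) // (q 1 4) // (q 1 6) // (q 1 0) //.
rewrite (q 2 2) // (q 2 3) // (q 2 5) // (q 2 4) // (q 2 6) // (q 2 0) //.
rewrite (q 3 2) // (q 3 3) // (q 3 5) // (q 3 4) // (q 3 6) // (q 3 0) //.
rewrite (q 4 2) // (q 4 3) // (q 4 5) // (q 4 4) // (q 4 6) // (q 4 0) //.
rewrite (q 5 2) // (q 5 3) // (q 5 5) // (q 5 4) // (q 5 6) // (q 5 0) //.
rewrite (q 6 2) // (q 6 3) // (q 6 5) // (q 6 4) // (q 6 6) // (q 6 0) //.
by rewrite (q 7 2) // (q 7 3) // (q 7 5) // (q 7 4) // (q 7 6) // (q 7 0).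
Qed.

Lemma cls_edge x : cls (edge x) = (~~ ot x, rd x).
Proof.
have [ix|] := boolP (inner_edge x).
  have ie : inner_edge (edge x) by rewrite inner_edge_edge.
  by rewrite /cls !ot_inner // !rd_inner // red_edge // out_edge.
rewrite inner_eight negbK.
case: cls_outer => [[n e s w] [en ee es ew]].
have val y c : cls y = c -> (~~ ot y, rd y) = (~~ c.1, c.2) by move=> <-.
rewrite !inE => /or4P[/eqP->|/eqP->|/eqP->|]; last case/or4P=> [/eqP->|/eqP->|/eqP->|];
  last case/orP=> /eqP->; rewrite ?edgeK.
- by rewrite en (val _ _ n).
- by rewrite ee (val _ _ e).
- by rewrite es (val _ _ s).
- by rewrite ew (val _ _ w).
- by rewrite n (val _ _ en).
- by rewrite e (val _ _ ee).
- by rewrite s (val _ _ es).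
- by rewrite w (val _ _ ew).
Qed.

Lemma ot_edge x : ot (edge x) = ~~ ot x.
Proof. by case: (cls_edge x). Qed.
Lemma rd_edge x : rd (edge x) = rd x.
Proof. by case: (cls_edge x). Qed.

Lemma eight_cases x : ~~ inner_edge x ->
  [\/ x = oN, x = oE, x = oS | x = oW] \/
  [\/ x = edge oN, x = edge oE, x = edge oS | x = edge oW].
Proof.
rewrite inner_eight negbK !inE => /or4P[/eqP->|/eqP->|/eqP->|];
  last case/or4P=> [/eqP->|/eqP->|/eqP->|]; last case/orP=> /eqP->;
  [left; constructor 1|left; constructor 2|left; constructor 3|left; constructor 4
  |right; constructor 1|right; constructor 2|right; constructor 3|right; constructor 4]; done.
Qed.

Lemma outer_vertex_neq : [/\ vN T != vE T, vN T != vS T & vN T != vW T] /\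
  [/\ vE T != vS T, vE T != vW T & vS T != vW T].
Proof.
by have := uniq_outer_vertices; rewrite /= !inE !negb_or => /and4P[/and3P[-> -> ->] /andP[-> ->] ->].
Qed.

Lemma inner_vertex_edge x : inner_vertex (org x) -> inner_edge x.
Proof.
move=> iv; apply: contraT => /eight_cases c; move: iv; rewrite /inner_vertex.
case: ends => [[en ee es] [ew eE eS eW eW']].
by case: c => -[] ->; rewrite ?(en,ee,es,ew,eE,eS,eW,eW') /= !inE eqxx ?orbT.
Qed.

Ltac outer_at x ix :=
  case: ends => [[en ee es] [ew eE eS eW eW']];
  case: outer_vertex_neq => [[/eqP d1 /eqP d2 /eqP d3] [/eqP d4 /eqP d5 /eqP d6]];
  have [ix|/eight_cases c] := boolP (inner_edge x).

Lemma dart_at_N x : org x = vN T ->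
  [\/ x = oN, x = edge oW | inner_edge x /\ cls x = (false, true)].
Proof.
outer_at x ix => ex.
  by constructor 3; rewrite /cls ot_inner // rd_inner //; case/andP: (rule_N P ix ex) => /negPf -> ->.
by case: c ex => -[] ->; rewrite ?(en,ee,es,ew,eE,eS,eW,eW') // => e;
  first [by constructor 1 | by constructor 2 | by case: (d1); congruence | congruence].
Qed.

Lemma dart_at_E x : org x = vE T ->
  [\/ x = oE, x = edge oN | inner_edge x /\ cls x = (false, false)].
Proof.
outer_at x ix => ex.
  by constructor 3; rewrite /cls ot_inner // rd_inner //; case/andP: (rule_E P ix ex) => /negPf -> /negPf ->.
by case: c ex => -[] ->; rewrite ?(en,ee,es,ew,eE,eS,eW,eW') // => e;
  first [by constructor 1 | by constructor 2 | congruence].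
Qed.

Lemma dart_at_S x : org x = vS T ->
  [\/ x = oS, x = edge oE | inner_edge x /\ cls x = (true, true)].
Proof.
outer_at x ix => ex.
  by constructor 3; rewrite /cls ot_inner // rd_inner //; case/andP: (rule_S P ix ex) => -> ->.
by case: c ex => -[] ->; rewrite ?(en,ee,es,ew,eE,eS,eW,eW') // => e;
  first [by constructor 1 | by constructor 2 | congruence].
Qed.

Lemma dart_at_W x : org x = vW T ->
  [\/ x = oW, x = edge oS | inner_edge x /\ cls x = (true, false)].
Proof.
outer_at x ix => ex.
  by constructor 3; rewrite /cls ot_inner // rd_inner //; case/andP: (rule_W P ix ex) => -> /negPf ->.
by case: c ex => -[] ->; rewrite ?(en,ee,es,ew,eE,eS,eW,eW') // => e;
  first [by constructor 1 | by constructor 2 | congruence].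
Qed.

Lemma turn_edge_outer : [/\ turn (edge oN) = oE, turn (edge oE) = oS,
  turn (edge oS) = oW & turn (edge oW) = oN].
Proof. by split=> //; apply: face_oW. Qed.

Lemma inner_rule_cls v : inner_vertex v -> exists x a b c d, org x = v /\
  [seq cls y | y <- orbit (@turn T) x] = full_turn a b c d.
Proof.
move=> iv; have [x [a [b [c [d [ex e]]]]]] := inner_rule P iv.
exists x, a, b, c, d; split=> //; rewrite /full_turn -e; apply/eq_in_map => y.
rewrite -fconnect_orbit -org_turn ex => /eqP ey.
have iy : inner_edge y by apply: inner_vertex_edge; rewrite -ey.
by rewrite /cls ot_inner // rd_inner.
Qed.

Lemma not_inner_vertex v : ~~ inner_vertex v ->
  [\/ v = vN T, v = vE T, v = vS T | v = vW T].
Proof.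
rewrite negbK !inE => /or4P[] /eqP->;
 [constructor 1|constructor 2|constructor 3|constructor 4]; done.
Qed.

(** At an inner vertex this is the cyclic order of the intervals. At an outer vertex the first dart
    after the outer corner has the class of the inner darts and the last one has the next class; the
    only irregular step is over the outer corner, which the hypothesis excludes. *)
Lemma class_step_turn x : turn x \notin outer_face T ->
  class_step (cls x) (cls (turn x)).
Proof.
case: (boolP (inner_vertex (org x))) => [iv _|/not_inner_vertex].
  have [x0 [a [b [c [d [ex e]]]]]] := inner_rule_cls iv.
  have cyc : cycle (relpre cls class_step) (orbit (@turn T) x0).
    have := cycle_full_turn a b c d; rewrite -e.
    by case: (orbit _ _) => //= y s; rewrite -map_rcons path_map.
  have m : x \in orbit (@turn T) x0 by apply: orbit_vertex.
  have := next_cycle cyc m.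
  by have /eqP <- := next_cycle (cycle_orbit (@turn_inj T) x0) m.
rewrite outerE !inE !negb_or => o /and4P[n1 n2 n3 n4].
case: turn_edge_outer cls_outer => t1 t2 t3 t4 [[n e s w] [en ee es ew]].
have ot1 := org_turn1 x.
case: o => ex; rewrite ex in ot1.
- case: (dart_at_N ex) => [x1|x1|[_ x1]]; case: (dart_at_N ot1) => [x2|x2|[_ x2]];
    by first [by rewrite x2 eqxx in n1 | by rewrite x1 t4 eqxx in n1
             | by rewrite x2 x1 ?n ?ew].
- case: (dart_at_E ex) => [x1|x1|[_ x1]]; case: (dart_at_E ot1) => [x2|x2|[_ x2]];
    by first [by rewrite x2 eqxx in n2 | by rewrite x1 t1 eqxx in n2
             | by rewrite x2 x1 ?e ?en].
- case: (dart_at_S ex) => [x1|x1|[_ x1]]; case: (dart_at_S ot1) => [x2|x2|[_ x2]];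
    by first [by rewrite x2 eqxx in n3 | by rewrite x1 t2 eqxx in n3
             | by rewrite x2 x1 ?s ?ee].
- case: (dart_at_W ex) => [x1|x1|[_ x1]]; case: (dart_at_W ot1) => [x2|x2|[_ x2]];
    by first [by rewrite x2 eqxx in n4 | by rewrite x1 t3 eqxx in n4
             | by rewrite x2 x1 ?w ?es].
Qed.

(* Modulo 4, the classes of two consecutive darts of a face differ by 2 or 3;
around a triangle these differences sum to 0, so two of them equal 3. *)
Lemma triangle_classes x : x \notin outer_face T ->
  [\/ cls (face x) = (~~ ot x, rd x) /\ cls (face (face x)) = next_class (cls x),
      cls (face x) = next_class (~~ ot x, rd x) /\
        cls (face (face x)) = (~~ ot x, rd x) |
      cls (face x) = next_class (~~ ot x, rd x) /\
        cls (face (face x)) = next_class (cls x)].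
Proof.
move=> ix.
have s y : y \notin outer_face T -> class_step (~~ ot y, rd y) (cls (face y)).
  move=> iy; rewrite -cls_edge; apply: class_step_turn.
  by rewrite -/(face y) outer_face_face.
have := s _ ix; have := s (face x); have := s (face (face x)).
rewrite !outer_face_face => /(_ ix); rewrite face3 // => + /(_ ix).
rewrite /class_step /cls /next_class /=.
move: (ot x) (rd x) (ot (face x)) (rd (face x)) (ot (face (face x))) (rd (face (face x))).
case=> [] [] [] [] [] [] //= _ _ _;
 first [by constructor 1 | by constructor 2 | by constructor 3].
Qed.

End Local.

(** * The tree of leftmost outgoing edges *)

Section Trees.
Variables (T : plane_graph) (P : transversal_pair T).
Hypothesis irr : irreducible_triangulation T.
Implicit Types (x y : dart T) (u v : vertex T).

Local Notation oN := (dartN T).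
Local Notation oE := (dartE T).
Local Notation oS := (dartS T).
Local Notation oW := (dartW T).
Local Notation ot := (ot P).
Local Notation rd := (rd P).
Local Notation cls := (cls P).

(** At the source S all darts are outgoing and none follows an ingoing one; there the first dart
    after the outer corner, [oS], is chosen. *)
Definition leftmost x := ot x && ((x == oS) || ~~ ot (tinv x)).
Definition coleftmost x := ot x && ~~ leftmost x.
Local Notation H := leftmost.
Local Notation HD := coleftmost.

Lemma ot_outer : [/\ ot oN = false, ot oE = false, ot oS & ot oW] /\
  [/\ ot (edge oN), ot (edge oE), ot (edge oS) = false & ot (edge oW) = false].
Proof.
by case: (cls_outer P irr) => [[[-> _] [-> _] [-> _] [-> _]] [[-> _] [-> _] [-> _] [-> _]]].
Qed.

Lemma rd_outer : [/\ rd oN, rd oE = false, rd oS & rd oW = false] /\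
  [/\ rd (edge oN), rd (edge oE) = false, rd (edge oS) & rd (edge oW) = false].
Proof.
by case: (cls_outer P irr) => [[[_ ->] [_ ->] [_ ->] [_ ->]] [[_ ->] [_ ->] [_ ->] [_ ->]]].
Qed.

Lemma ot_at_N x : org x = vN T -> ot x = false.
Proof.
case: ot_outer => [[n _ _ _] [_ _ _ w]].
by case/(dart_at_N P irr) => [->|->|[_ []]].
Qed.
Lemma ot_at_S x : org x = vS T -> ot x.
Proof.
case: ot_outer => [[_ _ s _] [_ e _ _]].
by case/(dart_at_S P irr) => [->|->|[_ []]].
Qed.
Lemma ot_at_E x : org x = vE T -> ot x -> x = edge oN.
Proof.
case: ot_outer => [[_ e _ _] _].
by case/(dart_at_E P irr) => [->|->|[_ []]] //; [rewrite e | move=> ->].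
Qed.
Lemma ot_at_W x : org x = vW T -> ~~ ot x -> x = edge oS.
Proof.
case: ot_outer => [[_ _ _ w] _].
by case/(dart_at_W P irr) => [->|->|[_ []]] //; [rewrite w | move=> ->].
Qed.

Lemma org_oS : org oS = vS T. Proof. by []. Qed.

Lemma leftmost_oS : H oS.
Proof. by case: ot_outer => [[_ _ s _] _]; rewrite /H s eqxx. Qed.
Lemma leftmost_oW : H oW.
Proof.
case: ot_outer => [[_ _ _ w] [_ _ s _]]; rewrite /H w.
by case: (turn_edge_outer irr) => _ _ <- _; rewrite tinv_turn s orbT.
Qed.
Lemma leftmost_eoN : H (edge oN).
Proof.
case: ot_outer => [[_ e _ w] [n _ s _]]; rewrite /H n /= orbC.
apply/orP; left; apply/negP => h.
have /ot_at_E/(_ h) : org (tinv (edge oN)) = vE T.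
  by rewrite org_tinv; case: (ends irr) => [[]].
move=> /(congr1 (@turn T)); rewrite turn_tinv; case: (turn_edge_outer irr) => -> _ _ _ q.
by rewrite -q n in e.
Qed.

Lemma leftmost_root x : H x -> org x != vN T.
Proof. by case/andP=> ox _; apply: contraTneq ox => /ot_at_N ->. Qed.

Lemma inner_out_interval v : inner_vertex v -> exists x0 m,
  [/\ org x0 = v, 0 < m < order (@turn T) x0, cls x0 = (true, true) &
   forall i, i < order (@turn T) x0 -> ot (iter i (@turn T) x0) = (i < m)].
Proof.
move=> iv; have [x0 [a [b [c [d [ex e]]]]]] := inner_rule_cls P irr iv.
have sz : order (@turn T) x0 = a + b + c + d + 4.
  by rewrite -size_orbit -(size_map cls) e !size_cat !size_nseq; lia.
(* The red and the blue outgoing intervals come first, with [a.+1] and [b.+1] darts. *)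
exists x0, (a + b + 2); split=> //; first lia.
  by have := congr1 (head (true,true)) e; rewrite /orbit -orderSpred.
move=> i lt; rewrite -(nth_traject _ lt) -[ot _]/(cls _).1.
rewrite -(nth_map _ (false, false)) ?size_traject //.
rewrite -/(orbit _ _) e /full_turn !nth_cat !nth_nseq !size_nseq.
by repeat (case: ifP => ? /=); lia.
Qed.

Lemma inner_leftmost v : inner_vertex v -> exists x0,
  [/\ org x0 = v, H x0, cls x0 = (true, true) & forall y, org y = v -> H y -> y = x0].
Proof.
move=> iv; have [x0 [m [ex mo c0 oi]]] := inner_out_interval iv.
have nS y : org y = v -> y != oS.
  by move=> ey; apply: contraTneq iv => e'; rewrite -ey e' /inner_vertex !inE eqxx !orbT.
have t0 : tinv x0 = iter (order (@turn T) x0).-1 (@turn T) x0 by [].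
exists x0; split=> //.
- by rewrite /H (oi 0) ?t0 ?oi //=; lia.
move=> y ey /andP[oy]; rewrite (negPf (nS _ ey)) /=.
have : fconnect (@turn T) x0 y by rewrite -org_turn ex ey.
case/iter_of_findex=> -[|i] // lt e'; rewrite e' /= tinv_turn oi ?(ltnW lt) //.
by move: oy; rewrite e' oi //; lia.
Qed.

Lemma leftmost_uniq x y : H x -> H y -> org x = org y -> x = y.
Proof.
move=> Hx Hy e; case: (boolP (inner_vertex (org x))) => [iv|/not_inner_vertex].
  by have [x0 [_ _ _ h]] := inner_leftmost iv; rewrite (h x) // (h y).
case=> ex; have ey := ex; rewrite e in ey.
- by case/eqP: (leftmost_root Hx).
- by case/andP: Hx Hy => /(ot_at_E ex) -> _ /andP[/(ot_at_E ey) -> _].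
- have k z : org z = vS T -> H z -> z = oS.
    by move=> ez /andP[_]; rewrite ot_at_S ?org_tinv // orbF => /eqP.
  by rewrite (k x) // (k y).
- have k z : org z = vW T -> H z -> z = oW.
    move=> ez /andP[_ /orP[/eqP ez'|]].
      by case: (outer_vertex_neq irr) => _ [_ _ /eqP[]]; rewrite -ez ez' org_oS.
    move/ot_at_W; rewrite org_tinv => /(_ ez) /(congr1 (@turn T)).
    by rewrite turn_tinv; case: (turn_edge_outer irr) => _ _ -> _.
  by rewrite (k x) // (k y).
Qed.

Lemma leftmost_ex v : v != vN T -> exists2 p, H p & org p = v.
Proof.
case: (boolP (inner_vertex v)) => [iv _|/not_inner_vertex].
  by have [x0 [? ? _ _]] := inner_leftmost iv; exists x0.
case: (ends irr) => [[_ e _] [_ _ _ s w]].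
case=> -> => [|_|_|_]; first by rewrite eqxx.
- by exists (edge oN); [exact: leftmost_eoN|].
- by exists oS; [exact: leftmost_oS|].
- by exists oW; [exact: leftmost_oW|].
Qed.

Lemma ot_in_outer x : x \in outer_face T -> ot x -> H x.
Proof.
rewrite (outerE irr) !inE; case: ot_outer => [[n e _ _] _].
case/or4P=> /eqP->; rewrite ?n ?e // => _; [exact: leftmost_oS|exact: leftmost_oW].
Qed.

Lemma coleftmost_inner x : HD x -> x \notin outer_face T.
Proof. by case/andP=> ox; apply: contra => /ot_in_outer; apply. Qed.

(** The dart before [x] around its origin is the reverse of the dart before [x] along the face. So
    [HD] marks the place where a walk along the face stops going against the orientation; as the
    directions in a triangle are not all equal, this happens exactly once. *)
Lemma coleftmost_face x : x \notin outer_face T ->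
  HD x = ot x && ~~ ot (face (face x)).
Proof.
move=> ix; rewrite /HD /H (tinv_face irr ix) ot_edge //.
case: (ot x) => //=; rewrite negb_or negbK.
by case: eqP ix => [->|//]; rewrite (outerE irr) !inE eqxx !orbT.
Qed.

Lemma face_outer x : (froot (@face T) x == froot (@face T) (outer T)) = (x \in outer_face T).
Proof.
rewrite eq_sym root_connect; last by apply: fconnect_sym; exact: face_inj.
by rewrite inE fconnect_orbit.
Qed.

Lemma face_rootE x y : (froot (@face T) x == froot (@face T) y) = fconnect (@face T) x y.
Proof. by rewrite root_connect //; apply: fconnect_sym; exact: face_inj. Qed.

Lemma inner_face_orbit x y : x \notin outer_face T -> fconnect (@face T) x y ->
  [\/ y = x, y = face x | y = face (face x)].
Proof.
move=> ix; rewrite fconnect_orbit /orbit; case: irr => _ _ -> // _.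
by rewrite !inE => /or3P[] /eqP ->; [constructor 1|constructor 2|constructor 3].
Qed.

Lemma coleftmost_uniq x y : HD x -> HD y ->
  froot (@face T) x = froot (@face T) y -> x = y.
Proof.
move=> hx hy /eqP; rewrite face_rootE => c.
have ix := coleftmost_inner hx; move: hx hy; rewrite coleftmost_face //.
case: (inner_face_orbit ix c) => -> //; rewrite coleftmost_face ?outer_face_face //.
  by rewrite face3 //; case: (ot x); rewrite ?andbF.
by case: (ot (face (face x))); rewrite ?andbF.
Qed.

Lemma triangle_mixed x : x \notin outer_face T ->
  ~~ ((ot (face x) == ot x) && (ot (face (face x)) == ot x)).
Proof.
move=> ix; case: (triangle_classes P irr ix) => -[[-> _] [-> _]] /=;
by case: (ot x); case: (rd x).
Qed.

Lemma coleftmost_ex x : froot (@face T) x != froot (@face T) (outer T) ->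
  exists2 p, HD p & froot (@face T) p = froot (@face T) x.
Proof.
rewrite face_outer => ix; have := triangle_mixed ix.
have e1 : froot (@face T) (face x) = froot (@face T) x.
  by apply/eqP; rewrite eq_sym face_rootE fconnect1.
have e2 : froot (@face T) (face (face x)) = froot (@face T) x.
  by apply/eqP; rewrite eq_sym face_rootE (fconnect_iter _ 2).
have := coleftmost_face ix; have := @coleftmost_face (face x); have := @coleftmost_face (face (face x)).
rewrite !outer_face_face => /(_ ix) + /(_ ix); rewrite !face3 ?outer_face_face //.
case: (ot x); case: (ot (face x)); case: (ot (face (face x))) => //= h1 h2 h3 _;
by first [by exists x; rewrite ?h3 | by exists (face x); rewrite ?h2 | by exists (face (face x)); rewrite ?h1].
Qed.

Lemma coleftmost_root p : HD p -> froot (@face T) p != froot (@face T) (outer T).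
Proof. by rewrite face_outer; exact: coleftmost_inner. Qed.

Definition psi := contour (@edge T) (@turn T) H.

Lemma on_tree_dual x : on_tree (@edge T) HD x = ~~ on_tree (@edge T) H x.
Proof.
rewrite /on_tree /HD /H !ot_edge //; case: (ot x) => //=.
by rewrite ?orbF.
Qed.

(** The two trees share out the edges, and exchanging [turn] with [face] exchanges following an edge
    with crossing it. *)
Lemma psi_dual x : psi x = contour (@edge T) (@face T) HD x.
Proof.
rewrite /psi /contour on_tree_dual; case: ifP => t //=.
by rewrite face_edge.
Qed.

Lemma psi_tree x : H x -> psi x = turn (edge x).
Proof. by move=> h; rewrite /psi /contour /on_tree h. Qed.
Lemma psi_edge x : H x -> psi (edge x) = turn x.
Proof. by move=> h; rewrite /psi /contour /on_tree edgeK h orbT. Qed.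
Lemma psi_cotree x : ~~ on_tree (@edge T) H x -> psi x = turn x.
Proof. by move=> /negPf h; rewrite /psi /contour h. Qed.

Lemma psi_inj : injective psi.
Proof. exact: contour_inj (@edgeK T) (@turn_inj T). Qed.

Lemma psi_turn x : fconnect psi oN (turn x) = fconnect psi oN x.
Proof.
have c := contour_component (@edgeK T) (@turn_inj T) (@org_turn T) leftmost_uniq
  (fun y => @leftmost_ex (org y)) leftmost_root.
by rewrite !(c oN) // org_turn1.
Qed.

(** The general result on contours is applied to the dual graph, a face being represented by the
    root of its [face] orbit and the outer face being the root of the tree. *)
Lemma psi_face x : fconnect psi oN (face x) = fconnect psi oN x.
Proof.
rewrite !(eq_connect (fun a b => congr1 (eq_op^~ b) (psi_dual a))).
have c := contour_component (@edgeK T) (@face_inj T) face_rootE coleftmost_uniq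
  coleftmost_ex coleftmost_root.
rewrite !(c oN) //; congr rooted.
by apply/eqP; rewrite eq_sym face_rootE fconnect1.
Qed.

(* [psi] is also the contour of the tree, in the dual graph, of the other outgoing
edges, so its orbit is closed under [turn] and [face]. *)
Lemma psi_cover x : fconnect psi oN x.
Proof.
have ve a b : org a = org b -> fconnect psi oN a -> fconnect psi oN b.
  move/eqP; rewrite org_turn => /iter_of_findex [i _ ->] ca.
  by elim: i => //= i; rewrite psi_turn.
have /connectP [p pp] := connected (vN T) (org x).
elim/last_ind: p x pp => [|p v IH] x; first by move=> _ /= e; apply: ve (connect0 _ _).
rewrite rcons_path last_rcons => /andP[pp /existsP[y /andP[/eqP e1 /eqP e2]]] e.
have {IH pp} cy := IH y pp e1.
apply: (ve (face y)); last by rewrite psi_face.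
by rewrite org_face e2.
Qed.

End Trees.

(** * Heights *)

Lemma eq_findex (D : finType) (f g : D -> D) (x y : D) :
  f =1 g -> fconnect f x y -> findex f x y = findex g x y.
Proof.
move=> e c; have ei k : iter k f x = iter k g x by elim: k => //= k ->.
rewrite -{2}(iter_findex c) ei findex_iter //.
by rewrite -[order g x](eq_card (eq_fconnect e x)) findex_max.
Qed.

Section Ranks.
Variables (T : plane_graph) (P : transversal_pair T).
Hypothesis irr : irreducible_triangulation T.
Implicit Types (x y p q d e : dart T) (u v : vertex T).

Local Notation oN := (dartN T).
Local Notation oE := (dartE T).
Local Notation oS := (dartS T).
Local Notation oW := (dartW T).
Local Notation ot := (ot P).
Local Notation rd := (rd P).
Local Notation cls := (cls P).
Local Notation H := (leftmost P).
Local Notation HD := (coleftmost P).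
Local Notation psi := (psi P).
Local Notation cover := (psi_cover P irr).
Local Notation psiI := (@psi_inj T P).

Definition pos x := findex psi oN x.
(* The time at which the contour of the tree of leftmost edges enters [v]. *)
Definition entry v :=
  if [pick p | H p && (org p == v)] is Some p then pos (turn p) else 0.
Definition counted q := [&& in_red P q, ~~ ot q & ~~ H (edge q)].
Definition height v := #|[pred q | counted q && (pos q < entry v)]|.
Definition n_counted := #|counted|.

Lemma pos_inj : injective pos. Proof. exact: findex_inj cover. Qed.

Lemma pos_psi x : psi x != oN -> pos (psi x) = (pos x).+1.
Proof. exact: (findex_succ psiI cover). Qed.

Lemma pos_oN : pos oN = 0. Proof. exact: findex0. Qed.

Let contour_pos := subtree_pos (@edgeK T) (@turn_inj T) (@org_turn T)
  (leftmost_uniq irr) (leftmost_root irr) (erefl (vN T) : org oN = vN T) cover.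

Lemma entry_leftmost p : H p -> entry (org p) = (pos (edge p)).+1.
Proof.
move=> hp; rewrite /entry; case: pickP => [q /andP[hq /eqP e]|/(_ p)]; last by rewrite hp eqxx.
rewrite (leftmost_uniq irr hq hp e).
exact: (pos_turn (@edgeK T) (@turn_inj T) (@org_turn T) (leftmost_root irr) (erefl (vN T) : org oN = vN T) cover hp).
Qed.

Lemma entry_N : entry (vN T) = 0.
Proof.
rewrite /entry; case: pickP => // p /andP[/(leftmost_root irr) /negP h /eqP e].
by rewrite e eqxx in h.
Qed.

Lemma entry_le x : entry (org x) <= pos x.
Proof.
have [->|] := eqVneq (org x) (vN T); first by rewrite entry_N.
case/(leftmost_ex P irr) => p hp ep; rewrite -ep entry_leftmost //.
by case/andP: (vertex_pos (@edgeK T) (@turn_inj T) (@org_turn T) (leftmost_uniq irr)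
 (leftmost_root irr) (erefl (vN T) : org oN = vN T) cover hp (esym ep)).
Qed.

Lemma pos_le_leftmost p y : H p -> org y = org p -> pos y <= pos p.
Proof.
move=> hp ey.
by case/andP: (vertex_pos (@edgeK T) (@turn_inj T) (@org_turn T) (leftmost_uniq irr)
 (leftmost_root irr) (erefl (vN T) : org oN = vN T) cover hp ey).
Qed.

Lemma subtree_entry p y : H p ->
  subtree (@org T) (@edge T) H (org p) y = (entry (org p) <= pos y <= pos p).
Proof.
move=> hp; rewrite contour_pos // entry_leftmost //.
by rewrite (pos_turn (@edgeK T) (@turn_inj T) (@org_turn T) (leftmost_root irr) (erefl (vN T) : org oN = vN T) cover hp).
Qed.

(** This is [vertex_pos] for the dual tree: the darts of a face are met between the two passages
    along the edge to its parent. *)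
Lemma pos_face p y : HD p -> fconnect (@face T) p y -> pos (edge p) < pos y <= pos p.
Proof.
move=> hp; rewrite -face_rootE => /eqP c.
have cover' x : fconnect (contour (@edge T) (@face T) HD) oN x.
  by rewrite -(eq_fconnect (psi_dual P irr)) cover.
rewrite /pos !(eq_findex (psi_dual P irr) (cover _)).
exact: (vertex_pos (@edgeK T) (@face_inj T) (@face_rootE T) (coleftmost_uniq irr)
  (coleftmost_root irr) (erefl _) cover' hp (esym c)).
Qed.

Lemma coleftmost_tinv x : HD x -> ot (tinv x).
Proof. by case/andP=> ox; rewrite /H ox negb_or negbK => /andP[]. Qed.

Lemma leftmost_ot x : H x -> ot x. Proof. by case/andP. Qed.

Lemma leftmost_coleftmost x : ot x -> ~~ H x -> HD x.
Proof. by rewrite /HD => -> ->. Qed.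

Lemma not_on_tree x : ~~ H x -> ~~ H (edge x) -> psi x = turn x.
Proof. by move=> h1 h2; apply: psi_cotree; rewrite /on_tree negb_or h1. Qed.

(** Move from [e] counterclockwise to the leftmost outgoing edge: [edge (tinv e)] lies on the face
    whose parent edge is [e], so it is met after [edge e]. Together with [entry_le], this makes
    [entry] decrease along every directed edge, so there is no directed cycle. *)
Lemma entry_lt e : ot e -> pos (edge e) < entry (org e).
Proof.
have [n] := ubnP (#|dart T| - pos (edge e)); elim: n e => // n IH e lt oe.
have [he|/(leftmost_coleftmost oe) he] := boolP (H e); first by rewrite entry_leftmost.
have og := coleftmost_tinv he.
have fe : fconnect (@face T) e (edge (tinv e)).
  rewrite -face_rootE eq_sym face_rootE.
  by apply: connect1; rewrite /= face_edge turn_tinv.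
case/andP: (pos_face he fe) => l1 _.
apply: (ltn_trans l1); rewrite -(org_tinv e); apply: IH => //.
have := findex_max (cover (edge e)); rewrite -/(pos _).
have : order psi oN <= #|dart T| by exact: max_card.
by move: lt l1; clear; lia.
Qed.

Lemma in_redE x : in_red P x = ~~ inner_edge x || rd x.
Proof. by rewrite /in_red implybE /rd /=; case: (boolP (inner_edge x)). Qed.

(** The only class step from ingoing to outgoing goes from ingoing blue to outgoing red. *)
Lemma leftmost_red x : H x -> inner_edge x -> rd x.
Proof.
case/andP=> ox /orP[/eqP->|ot'].
  by rewrite (inner_eight irr) !inE eqxx !orbT.
move=> ix; have /(class_step_turn P irr) : turn (tinv x) \notin outer_face T.
  by rewrite turn_tinv; case/andP: ix.
rewrite turn_tinv /class_step /next_class /cls /=; move: ox ot'.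
by case: (ot x) (ot (tinv x)) (rd x) (rd (tinv x)) => [] // [] // [] // [].
Qed.

Lemma leftmost_in_red x : H x -> in_red P x.
Proof. by move=> h; rewrite in_redE; case: (boolP (inner_edge x)) => //= /(leftmost_red h). Qed.

Lemma leftmost_blue x : H x -> ~~ rd x -> x = oW.
Proof.
move=> hx; have [ix|/(eight_cases irr) c] := boolP (inner_edge x).
  by rewrite leftmost_red.
have ox := leftmost_ot hx; move: ox hx.
case: (ot_outer P irr) (rd_outer P irr) => [[a1 a2 a3 a4] [a5 a6 a7 a8]] [[b1 b2 b3 b4] [b5 b6 b7 b8]].
case: c => -[] -> //; rewrite ?a1 ?a2 ?a7 ?a8 ?b3 ?b5 // => _ h _.
have := leftmost_uniq irr h (leftmost_oS P irr).
case: (ends irr) => [[_ _ ->] _] /(_ erefl) /eqP.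
by rewrite (@eight_eq _ irr 5 2).
Qed.

Lemma counted_oE : counted oE.
Proof.
rewrite /counted in_redE; case: (ot_outer P irr) => [[_ -> _ _] [_ o _ _]] /=.
rewrite (inner_eight irr) !inE eqxx !orbT /=.
rewrite /H o /=; apply/norP; split.
  by rewrite -[X in X == _]/(nth oN (eight T) 5) (@eight_eq _ irr 5 2).
rewrite negbK ot_at_S // org_tinv; by case: (ends irr) => [[]].
Qed.

Lemma oN_red : rd oN. Proof. by case: (rd_outer P irr) => [[]]. Qed.

(* Going down through the triangles below a blue edge, one reaches a triangle
with a red lower apex, whose right edge is counted. *)
Lemma blue_counted d : ~~ ot d -> ~~ rd d ->
  exists q, [/\ counted q, entry (org d) <= pos q & pos q <= pos d].
Proof.
have [n] := ubnP (pos d); elim: n d => // n IH d lt od rdd.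
have [od'|ix] := boolP (d \in outer_face T).
  have -> : d = oE.
    move: od' od rdd; rewrite (outerE irr) !inE.
    case: (ot_outer P irr) (rd_outer P irr) => [[a1 a2 a3 a4] _] [[b1 _ _ _] _].
    by case/or4P=> /eqP -> //; rewrite ?a3 ?a4 ?b1.
  by exists oE; split=> //; [exact: counted_oE | exact: entry_le].
have dN : d != oN by apply: contraNneq rdd => ->; exact: oN_red.
set d1 := face d; set d2 := face d1.
have td : tinv d = edge d2 by rewrite (tinv_face irr).
have o2 : org (edge d2) = org d by rewrite -td org_tinv.
have td2 : turn (edge d2) = d by rewrite -td turn_tinv.
have t1 : turn (edge d1) = d2 by [].
have i2 : d2 \notin outer_face T by rewrite !outer_face_face.
have ppsi : ~~ H (edge d2) -> ~~ H d2 -> pos d = (pos (edge d2)).+1.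
  move=> h1 h2; rewrite -td2 -not_on_tree ?edgeK // pos_psi //.
  by rewrite not_on_tree ?edgeK // td2.
have Hin x : ~~ ot x -> ~~ H x by apply: contra; exact: leftmost_ot.
move: od rdd; case: (triangle_classes P irr ix) => -[]; rewrite -/d1 -/d2 /next_class /cls /=;
  case=> c1 r1 [c2 r2] /[dup] od /negPf od' /[dup] rdd /negPf rdd';
  rewrite od' rdd' /= in c1 r1 c2 r2.
(* Here [d2] is red and enters [org d]. If it is in the tree, the contour returns along it just
   before [d], and the search goes on with the ingoing blue dart [edge d1] at its lower end;
   otherwise [edge d2] is counted. *)
- have oe2 : ~~ ot (edge d2) by rewrite ot_edge // c2.
  have [h2|h2] := boolP (H d2).
    have pd : pos d = (pos d2).+1.
      by rewrite -td2 -(psi_tree h2) pos_psi // (psi_tree h2) td2.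
    have l1 : pos (edge d1) <= pos d2.
      by apply: pos_le_leftmost; rewrite // -(org_face d1).
    have [|||q [cq q1 q2]] := IH (edge d1); first by rewrite pd ltnS in lt; apply: leq_ltn_trans lt.
    + by rewrite ot_edge // c1.
    + by rewrite rd_edge // r1.
    exists q; split=> //; last by rewrite pd ltnW // ltnS; exact: leq_trans q2 l1.
    apply: leq_trans q1; rewrite -o2 -(org_face d1) -/d2.
    apply: leq_trans (entry_le _) _; apply: ltnW; apply: entry_lt; exact: leftmost_ot.
  exists (edge d2); split.
  + by rewrite /counted in_redE rd_edge // r2 orbT oe2 edgeK.
  + by rewrite -o2; exact: entry_le.
  + by rewrite ppsi // Hin.
(* Here [edge d2] is the preceding dart at the same vertex, again ingoing blue. *)
- have oe2 : ~~ ot (edge d2) by rewrite ot_edge // c2.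
  have h2 : ~~ H d2.
    apply/negP=> /leftmost_blue; rewrite r2 => /(_ isT) e.
    by case: (turn_edge_outer irr) => _ _ _ q; rewrite -td2 e q eqxx in dN.
  have pd : pos d = (pos (edge d2)).+1 by rewrite ppsi // Hin.
  have [|//||q [cq q1 q2]] := IH (edge d2); first by rewrite pd in lt.
    by rewrite rd_edge // r2.
  by exists q; split=> //; [rewrite -o2 | rewrite pd ltnW].
(* Here the red [d2] comes just after the outgoing [edge d1], so it is not leftmost and [edge d2] is
   counted. *)
- have oe2 : ~~ ot (edge d2) by rewrite ot_edge // c2.
  have h2 : ~~ H d2.
    rewrite /H c2 -t1 tinv_turn ot_edge // c1 /= orbF.
    by apply: contraNneq i2; rewrite -t1 => ->; rewrite (outerE irr) !inE eqxx !orbT.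
  exists (edge d2); split.
  + by rewrite /counted in_redE rd_edge // r2 orbT oe2 edgeK.
  + by rewrite -o2; exact: entry_le.
  + by rewrite ppsi // Hin.
Qed.

Lemma height_le u v : entry u <= entry v -> height u <= height v.
Proof.
move=> le; apply: subset_leq_card; apply/subsetP => q; rewrite !inE => /andP[-> lt] /=.
exact: leq_trans lt le.
Qed.

Lemma height_le_counted v : height v <= n_counted.
Proof. by apply: subset_leq_card; apply/subsetP => q; rewrite !inE => /andP[]. Qed.

Lemma height_out e : ot e -> height (org (edge e)) <= height (org e).
Proof.
move=> oe; apply: height_le; apply: leq_trans (entry_le _) _.
by apply: ltnW; exact: entry_lt.
Qed.

Lemma height_blue e : ot e -> ~~ rd e -> height (org (edge e)) < height (org e).
Proof.
move=> oe re; have [||q [cq q1 q2]] := @blue_counted (edge e).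
- by rewrite ot_edge // oe.
- by rewrite rd_edge.
have le := entry_lt oe.
apply: proper_card; apply/properP; split.
  apply/subsetP => r; rewrite !inE => /andP[-> lt] /=; lia.
by exists q; rewrite !inE cq /=; lia.
Qed.

Lemma height_N : height (vN T) = 0.
Proof. by apply: eq_card0 => q; rewrite !inE entry_N andbF. Qed.

(** E is entered at time 1, when only [oN] has been met, and [oN] is the reverse of a leftmost
    edge. *)
Lemma height_E : height (vE T) = 0.
Proof.
apply: eq_card0 => q; rewrite !inE.
have -> : vE T = org (edge oN) by case: (ends irr) => [[]].
rewrite entry_leftmost; last exact: leftmost_eoN.
rewrite edgeK pos_oN ltnS leqn0 -pos_oN; apply/negP => /andP[c /eqP /pos_inj e].
by move: c; rewrite e /counted (leftmost_eoN P irr) !andbF.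
Qed.

Lemma parent_cases u : parent (@org T) (@edge T) H u = u \/
  exists p, [/\ H p, org p = u & parent (@org T) (@edge T) H u = org (edge p)].
Proof.
rewrite /parent; case: pickP => [p /andP[hp /eqP e]|_]; last by left.
by right; exists p.
Qed.

Lemma iter_parent_S k u : iter k (parent (@org T) (@edge T) H) u = vS T -> u = vS T.
Proof.
elim: k u => // k IH u; rewrite iterSr => /IH.
case: (parent_cases u) => [-> //|[p [hp _ ->]]] e.
by have := ot_at_S P irr e; rewrite ot_edge // (leftmost_ot hp).
Qed.

(** The only ingoing edge at W comes from S, and no edge enters S. *)
Lemma iter_parent_W k u : iter k (parent (@org T) (@edge T) H) u = vW T ->
  u = vW T \/ u = vS T.
Proof.
elim: k u => [|k IH] u /=; first by left.
case: (parent_cases (iter k (parent (@org T) (@edge T) H) u)) => [->|[p [hp e ->]] ew]; first exact: IH.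
have := @ot_at_W T P irr _ ew; rewrite ot_edge // (leftmost_ot hp) => /(_ isT) /(can_inj (@edgeK T)) ep.
right; apply: (@iter_parent_S k); by rewrite -e ep.
Qed.

Lemma pos_le_oW x : pos x <= pos oW.
Proof.
have l1 := findex_max (cover oW); have l2 := findex_max (cover x).
move: l1; rewrite leq_eqVlt => /orP[/eqP l1|l1]; first by rewrite -ltnS [X in _ < X]l1.
have hW := leftmost_oW P irr.
have := findex_iter l1; rewrite iterS iter_findex ?cover // psi_tree //.
by case: (turn_edge_outer irr) => _ _ _ ->; rewrite findex0.
Qed.

(** The contour ends with [oW], so from the entry into W on it remains in the subtree of W, that is
    at W and S, where no dart is counted. *)
Lemma height_W : height (vW T) = n_counted.
Proof.
apply: eq_card => q; rewrite -[RHS]/(counted q) -[LHS]/(counted q && (pos q < entry (vW T))).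
case c: (counted q) => //=.
rewrite ltnNge; apply/negP => le; have hW := leftmost_oW P irr.
have eW : org oW = vW T by case: (ends irr) => _ [].
have last := pos_le_oW q.
have : subtree (@org T) (@edge T) H (org oW) q by rewrite subtree_entry // eW le.
case/iter_of_findex=> k _ /esym; rewrite eW => /iter_parent_W; move: c; rewrite /counted.
case/and3P=> _ oq hq [e|e]; last by rewrite (ot_at_S P irr e) in oq.
by move: hq; rewrite (ot_at_W irr e oq) edgeK (leftmost_oS P irr).
Qed.

Lemma height_S : height (vS T) = n_counted.
Proof.
apply/eqP; rewrite eqn_leq height_le_counted -height_W.
have := @height_out oS; rewrite (leftmost_ot (leftmost_oS P irr)) => /(_ isT).
by case: (ends irr) => _ [-> _ _ -> _].
Qed.

End Ranks.

(** * Separating paths *)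

Lemma prev_head (A : eqType) (x : A) t : x \notin t -> prev (x :: t) x = last x t.
Proof.
rewrite /=; move: {4 5}x => y; elim: t y => [|z t IH] y; first by rewrite /= eqxx.
by rewrite inE negb_or /= => /andP[/negPf -> /IH].
Qed.

Section SeparatingPaths.
Variables (T : plane_graph) (P : transversal_pair T).
Hypothesis irr : irreducible_triangulation T.
Implicit Types (x y p q d e g h : dart T) (u v w : vertex T).

Local Notation oN := (dartN T).
Local Notation oE := (dartE T).
Local Notation oS := (dartS T).
Local Notation oW := (dartW T).
Local Notation ot := (ot P).
Local Notation rd := (rd P).
Local Notation cls := (cls P).
Local Notation H := (leftmost P).
Local Notation HD := (coleftmost P).
Local Notation psi := (psi P).
Local Notation cover := (psi_cover P irr).
Local Notation psiI := (@psi_inj T P).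
Local Notation pos := (pos P).
Local Notation entry := (entry P).
Local Notation inr := (in_red P).

Lemma in_red_edge x : inr (edge x) = inr x.
Proof. by rewrite !in_redE inner_edge_edge rd_edge. Qed.

Lemma blue_inner x : ~~ inr x -> inner_edge x /\ ~~ rd x.
Proof. by rewrite in_redE negb_or negbK => /andP. Qed.

Lemma inner_outer x : inner_edge x -> x \notin outer_face T.
Proof. by case/andP. Qed.

(** Among the outgoing as among the ingoing darts, red comes before blue clockwise, so a blue dart
    never opens a range. *)
Lemma blue_tinv x : ~~ inr x -> ot (tinv x) = ot x.
Proof.
case/blue_inner => /inner_outer ix rx.
have /(class_step_turn P irr) : turn (tinv x) \notin outer_face T by rewrite turn_tinv.
rewrite turn_tinv /class_step /next_class /cls /=; move: rx.
by case: (ot x) (ot (tinv x)) (rd x) (rd (tinv x)) => [] [] [] [].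
Qed.

(** Counterpart of [leftmost]; at the sink N, where all darts are ingoing, the first dart after the
    outer corner is [oN]. *)
Definition first_in x := ~~ ot x && ((x == oN) || ot (tinv x)).
Local Notation FI := first_in.

Lemma first_in_red x : FI x -> inr x.
Proof.
case/andP=> ox ox'; apply: contraT => nx; have := blue_tinv nx; move: ox'.
have [ix _] := blue_inner nx.
have -> : (x == oN) = false.
  by apply/negP => /eqP e; move: ix; rewrite e (inner_eight irr) inE eqxx.
by move=> /= ->; rewrite (negPf ox).
Qed.

Lemma outer_first_in x : x \in outer_face T -> ~~ ot x -> FI x.
Proof.
rewrite (outerE irr) !inE; case: (ot_outer P irr) => [[n e s w] [en _ _ _]].
case/or4P=> /eqP->; rewrite ?n ?e ?s ?w // => _; rewrite /FI ?n ?e ?eqxx //=.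
by case: (turn_edge_outer irr) => <- _ _ _; rewrite tinv_turn en orbT.
Qed.

(** The darts skipped by [prevK] are blue and have the direction of their predecessors, so the
    previous dart of the red map and the previous dart of [T] have the same direction. *)
Lemma firstE x : first (inr) (out_red P) x =
  inr x && ((x \in outer_face T) || (ot (tinv x) != ot x)).
Proof.
rewrite /first; case Kx: (inr x) => //=; congr (_ || (_ != _)).
rewrite /prevK /orbit -orderSpred /= Kx prev_head; last first.
  rewrite mem_filter Kx /=; have := orbit_uniq (@turn T) x.
  by rewrite /orbit -orderSpred /= => /andP[].
have -> : tinv x = iter (order (@turn T) x).-1 (@turn T) x by [].
elim: (order _ _).-1 => // n IH.
rewrite trajectSr filter_rcons; case: ifP => K; first by rewrite last_rcons iterSr.
rewrite IH -[RHS]blue_tinv ?iterS ?tinv_turn //.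
by rewrite -iterS iterSr K.
Qed.

Lemma first_leftmost x : first inr (out_red P) x && ot x = H x.
Proof.
rewrite firstE; apply/idP/idP => [/andP[/andP[_ /orP[o|n]] ox]|hx].
- exact: ot_in_outer.
- by move: n; rewrite ox eqb_id /H ox => ->; rewrite orbT.
rewrite (leftmost_in_red irr hx); case/andP: hx => -> /orP[/eqP->|/negPf ->] /=.
  by rewrite (outerE irr) !inE eqxx !orbT.
by rewrite orbT.
Qed.

Lemma first_first_in x : first inr (out_red P) x && ~~ ot x = FI x.
Proof.
rewrite firstE; apply/idP/idP => [/andP[/andP[_ /orP[o|n]] ox]|hx].
- exact: outer_first_in.
- by move: n; rewrite /FI ox (negPf ox) eqbF_neg negbK => ->; rewrite orbT.
rewrite (first_in_red hx); case/andP: hx => /[dup] n -> /orP[/eqP->|->] /=.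
  by rewrite (outerE irr) !inE eqxx.
by rewrite (negPf n) orbT.
Qed.

Definition up := [rel u v | [exists x, [&& H x, org x == u & org (edge x) == v]]].
Definition down := [rel u v | [exists x, [&& FI x, org x == u & org (edge x) == v]]].

Lemma sep_pathE v x : sep_path inr (out_red P) v x =
  (H x && connect up v (org x)) || (FI (edge x) && connect down v (org (edge x))).
Proof.
rewrite /sep_path /= -!first_leftmost -!first_first_in !andbA; congr (_ && _ || _ && _).
  apply: eq_connect => a b /=; apply: eq_existsb => y.
  by rewrite -first_leftmost -!andbA.
apply: eq_connect => a b /=; apply: eq_existsb => y.
by rewrite -first_first_in -!andbA.
Qed.

(** The edge of the dual tree from the face of [y] to its parent. The default concerns the outer
    face, which is the root. *)
Definition face_parent y := odflt y [pick p | HD p && fconnect (@face T) y p].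
Local Notation fp := face_parent.

Lemma face_parentP y : y \notin outer_face T -> HD (fp y) /\ fconnect (@face T) y (fp y).
Proof.
rewrite -face_outer => /(coleftmost_ex P irr) [p hp /eqP c].
rewrite /fp; case: pickP => [q /andP[]//|/(_ p)].
by rewrite hp -face_rootE eq_sym c.
Qed.

Lemma face_parent_eq y p : HD p -> fconnect (@face T) y p -> fp y = p.
Proof.
move=> hp c; rewrite /fp; case: pickP => [q /andP[hq c']|/(_ p)]; last by rewrite hp c.
apply: (@coleftmost_uniq _ P irr) => //=; apply/eqP; rewrite face_rootE.
by apply: connect_trans c; rewrite fconnect_sym //; exact: face_inj.
Qed.

Lemma pos_face_parent y : y \notin outer_face T -> pos (edge (fp y)) < pos y.
Proof.
move=> /face_parentP [hp c]; have c' : fconnect (@face T) (fp y) y.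
  by rewrite fconnect_sym //; exact: face_inj.
by case/andP: (pos_face irr hp c').
Qed.

Lemma face_parent_out y : y \notin outer_face T -> ~~ inr (fp y) ->
  edge (fp y) \notin outer_face T.
Proof. by move=> _ /blue_inner [/andP[]]. Qed.

(** Crossing a parent edge lowers [pos], by [pos_face_parent], so [(pos y).+1] rounds of fuel
    suffice. *)
Fixpoint bottom_rec n y :=
  if n is n'.+1 then
    if inr (fp y) then fp y else bottom_rec n' (edge (fp y))
  else fp y.
(* The lowest right edge of the face of the red map containing [y], reached by
crossing blue edges downwards. *)
Definition bottom y := bottom_rec (pos y).+1 y.

Lemma bottom_recE m n y : y \notin outer_face T -> pos y < m -> pos y < n ->
  bottom_rec m y = bottom_rec n y.
Proof.
elim: m n y => // m IH [//|n] y iy lm ln /=; case: ifP => // /negbT b.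
have lt := pos_face_parent iy.
apply: IH; first exact: face_parent_out; lia.
Qed.

Lemma bottomE y : y \notin outer_face T ->
  bottom y = if inr (fp y) then fp y else bottom (edge (fp y)).
Proof.
move=> iy; rewrite {1}/bottom /=; case: ifP => // /negbT b.
have lt := pos_face_parent iy.
by apply: bottom_recE => //; apply: face_parent_out.
Qed.

Lemma bottomP y : y \notin outer_face T ->
  [/\ HD (bottom y), inr (bottom y) & pos (edge (bottom y)) < pos y].
Proof.
have [n] := ubnP (pos y); elim: n y => // n IH y lt iy; rewrite bottomE //.
have l := pos_face_parent iy; case: ifP => [i|/negbT b].
  by split=> //; case: (face_parentP iy).
have [] := IH (edge (fp y)); first by lia.
  exact: face_parent_out.
by move=> h1 h2 h3; split=> //; lia.
Qed.

Lemma bottom_face y : y \notin outer_face T -> bottom (face y) = bottom y.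
Proof.
move=> iy; have [hp c] := face_parentP iy.
have e : fp (face y) = fp y.
  apply: face_parent_eq => //; apply: connect_trans c.
  by rewrite fconnect_sym ?fconnect1 //; exact: face_inj.
by rewrite [LHS]bottomE ?outer_face_face // [RHS]bottomE // e.
Qed.

Lemma bottom_id y : HD y -> inr y -> bottom y = y.
Proof.
move=> hy i; have iy := coleftmost_inner irr hy.
by rewrite bottomE // (face_parent_eq hy (connect0 _ _)) i.
Qed.

(** A blue edge is never leftmost, so its outgoing dart is the parent edge of the triangle on its
    left, which is the one that [bottom] crosses. *)
Lemma bottom_blue x : ~~ inr x -> bottom (edge x) = bottom x.
Proof.
have key y : ~~ inr y -> ot y -> bottom y = bottom (edge y).
  move=> b oy; have hy : HD y.
    by rewrite /HD oy; apply: contra b; exact: leftmost_in_red.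
  have iy := coleftmost_inner irr hy.
  by rewrite bottomE // (face_parent_eq hy (connect0 _ _)) (negPf b).
move=> b; case o: (ot x); first by rewrite -key.
by rewrite key ?edgeK // ?in_red_edge // ot_edge // o.
Qed.

(* The rank of the face of the red map on the left of [y]; it is zero on the
right of the map and maximal on its left. *)
Definition rank y :=
  if y \in outer_face T then if ot y then #|dart T|.+1 else 0
  else (pos (edge (bottom y))).+1.

Lemma pos_lt x : pos x < #|dart T|.
Proof. by apply: leq_trans (max_card (fconnect psi oN)); apply: findex_max; exact: cover. Qed.

Lemma entry_lt_card v : entry v < #|dart T|.
Proof. by have [x <-] := org_surj v; apply: leq_ltn_trans (entry_le P irr x) (pos_lt x). Qed.

Lemma rank_face y : y \notin outer_face T -> rank (face y) = rank y.
Proof. by move=> iy; rewrite /rank outer_face_face (negPf iy) bottom_face. Qed.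

Lemma edge_outer_turn x : (edge x \in outer_face T) = (turn x \in outer_face T).
Proof. by rewrite -face_edge outer_face_face. Qed.

Lemma rank_turn x : turn x \notin outer_face T -> rank (turn x) = rank (edge x).
Proof. by rewrite -edge_outer_turn => ix; rewrite -face_edge rank_face. Qed.

Lemma rank_blue x : ~~ inr x -> rank (edge x) = rank x.
Proof.
move=> b; have [/andP[i1 i2] _] := blue_inner b.
by rewrite /rank (negPf i1) (negPf i2) bottom_blue.
Qed.

Lemma rank_pos y : y \notin outer_face T -> rank y <= pos y.
Proof. by move=> iy; rewrite /rank (negPf iy); case: (bottomP iy). Qed.

Lemma rank_in y : ~~ ot y -> rank y <= pos y.
Proof.
move=> oy; have [o|] := boolP (y \in outer_face T); last exact: rank_pos.
by rewrite /rank o (negPf oy).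
Qed.

Lemma rank_id y : HD y -> inr y -> rank y = (pos (edge y)).+1.
Proof. by move=> hy i; rewrite /rank (negPf (coleftmost_inner irr hy)) bottom_id. Qed.

Lemma turn_oN_org x : turn x = oN -> org x = vN T.
Proof. by move=> e; rewrite -org_turn1 e. Qed.

Lemma entryP v : v = vN T \/ exists p, [/\ H p, org p = v & entry v = (pos (edge p)).+1].
Proof.
have [->|/(leftmost_ex P irr) [p hp e]] := eqVneq v (vN T); first by left.
by right; exists p; rewrite -e entry_leftmost.
Qed.

(** A vertex is entered only right after the reverse of its leftmost edge; after any other dart,
    time passes without any entry. *)
Lemma entry_neq v x : ~~ H (edge x) -> entry v != (pos x).+1.
Proof.
move=> hx; case: (entryP v) => [->|[p [hp _ ->]]]; first by rewrite (entry_N P irr).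
apply: contra hx => /eqP [] /(pos_inj irr) <-; by rewrite edgeK.
Qed.

Lemma in_not_leftmost x : ~~ ot x -> ~~ H x.
Proof. by apply: contra; exact: leftmost_ot. Qed.

Lemma pos_turn_cotree x : ~~ H x -> ~~ H (edge x) -> turn x != oN ->
  pos (turn x) = (pos x).+1.
Proof.
by move=> h1 h2 ne; rewrite -[turn x](not_on_tree h1 h2) pos_psi // not_on_tree.
Qed.

Lemma pos_turn_leftmost p : H p -> turn (edge p) != oN -> pos (turn (edge p)) = (pos p).+1.
Proof. by move=> hp ne; rewrite -(psi_tree hp) pos_psi // psi_tree. Qed.

Lemma outer_oN x : x \notin outer_face T -> x != oN.
Proof. by apply: contraNneq => ->; rewrite (outerE irr) inE eqxx. Qed.

(* After crossing the bottom edge of a red face, the contour climbs along the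
right boundary of this face without entering any vertex. *)
Lemma entry_lt_rank v h : ~~ ot h -> turn h \notin outer_face T ->
  entry v <= pos (turn h) -> entry v < rank (turn h).
Proof.
have [n] := ubnP (pos (turn h)); elim: n h => // n IH h lt oh ih le.
have [->|vN] := eqVneq v (vN T); first by rewrite (entry_N P irr) /rank (negPf ih).
have tN := outer_oN ih; have nh := in_not_leftmost oh.
rewrite rank_turn //; have [red|blue] := boolP (inr h); last first.
  have [/andP[i1 _] _] := blue_inner blue.
  have nh' : ~~ H (edge h).
    by apply: contra blue => /(leftmost_in_red irr); rewrite in_red_edge.
  have pt := pos_turn_cotree nh nh' tN.
  rewrite rank_blue // -[h]turn_tinv; apply: IH.
  - by rewrite turn_tinv; lia.
  - by rewrite blue_tinv.
  - by rewrite turn_tinv.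
  rewrite turn_tinv; have := entry_neq v nh'; lia.
have [he|he] := boolP (H (edge h)); last first.
  have pt := pos_turn_cotree nh he tN.
  rewrite rank_id ?in_red_edge //; last by apply: leftmost_coleftmost; rewrite ?ot_edge.
  by rewrite edgeK; have := entry_neq v he; lia.
(* The contour has just come back along the tree edge [edge h], which bounds the same face. Being
   leftmost, it follows an ingoing dart, so the induction applies at its origin. *)
have pt := pos_turn_leftmost he; rewrite edgeK in pt; have {}pt := pt tN.
have ie : edge h \notin outer_face T by rewrite edge_outer_turn.
rewrite -[edge h]turn_tinv; apply: IH.
- by rewrite turn_tinv; lia.
- case/andP: he => _ /orP[/eqP e|//].
  by move: ie; rewrite e (outerE irr) !inE eqxx !orbT.
- by rewrite turn_tinv.
rewrite turn_tinv; have := @entry_neq v (edge h); rewrite edgeK => /(_ nh); lia.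
Qed.

Lemma entry_lt_rank_leftmost v p : H p -> entry v <= pos p -> entry v < rank p.
Proof.
move=> hp le; have [o|ip] := boolP (p \in outer_face T).
  by rewrite /rank o (leftmost_ot hp) ltnS ltnW // entry_lt_card.
rewrite -[p]turn_tinv; apply: entry_lt_rank; rewrite ?turn_tinv //.
case/andP: hp => _ /orP[/eqP e|//].
by move: ip; rewrite e (outerE irr) !inE eqxx !orbT.
Qed.

(** If [e] is leftmost, the entry into [org e] falls between the ranks of its two sides; otherwise
    [e] is the bottom edge of the red face on its left. *)
Lemma rank_lt e : inr e -> ot e -> rank (edge e) < rank e.
Proof.
move=> red oe; have o' : ~~ ot (edge e) by rewrite ot_edge // oe.
have le := rank_in o'.
have [he|he] := boolP (H e).
  apply: leq_ltn_trans le _; apply: ltn_trans (entry_lt irr oe) _.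
  by apply: entry_lt_rank_leftmost => //; exact: entry_le.
by rewrite (rank_id (leftmost_coleftmost oe he) red).
Qed.

Lemma rank_le e : ot e -> rank (edge e) <= rank e.
Proof.
move=> oe; have [red|blue] := boolP (inr e); first by rewrite ltnW ?rank_lt.
by rewrite rank_blue.
Qed.

(** After entering a vertex, the contour turns through its outgoing darts off the tree without
    entering any other vertex. *)
Lemma entry_le_out v o : ot o -> entry v <= pos (turn o) -> entry v <= entry (org o).
Proof.
have [n] := ubnP (pos (turn o)); elim: n o => // n IH o lt oo.
have tN : turn o != oN.
  by apply/eqP => /turn_oN_org /(ot_at_N P irr); rewrite oo.
have [ho|ho] := boolP (H o).
  have <- : pos (turn o) = entry (org o) by rewrite entry_leftmost // -pos_psi // psi_edge.
  by [].
have he : ~~ H (edge o) by apply: in_not_leftmost; rewrite ot_edge // oo.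
rewrite (pos_turn_cotree ho he tN) leq_eqVlt (negPf (entry_neq v he)) ltnS => le.
rewrite -org_tinv; apply: IH; rewrite ?turn_tinv //.
  by rewrite (pos_turn_cotree ho he tN) in lt.
exact: coleftmost_tinv (leftmost_coleftmost oo ho).
Qed.

Lemma entry_le_leftmost_outer v p : p \in outer_face T -> H p -> entry v <= pos p.
Proof.
move=> op hp; have oW_max : entry v <= pos oW.
  by have [x <-] := org_surj v; apply: leq_trans (entry_le P irr x) (pos_le_oW P irr x).
have : [|| p == oN, p == oE, p == oS | p == oW] by move: op; rewrite (outerE irr) !inE.
have op' := leftmost_ot hp; case: (ot_outer P irr) => [[a1 a2 _ _] [_ _ eS _]].
case/or4P=> /eqP e; rewrite e ?a1 ?a2 // in op' *.
move: oW_max; have <- : turn (edge oS) = oW by case: (turn_edge_outer irr).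
rewrite pos_turn_leftmost ?leftmost_oS //.
  rewrite leq_eqVlt (negPf (@entry_neq v oS _)) //.
  by apply: in_not_leftmost; rewrite eS.
case: (turn_edge_outer irr) => _ _ -> _.
by rewrite -[oW]/(nth oN (eight T) 3) (@eight_eq _ irr 3 0).
Qed.

(** Compare [entry v] with the entry into the upper end [org g] and with [pos g]. Up to [pos g],
    [entry_lt_rank] forces [g] to be first; between the two times, [entry_le_out] gives a
    contradiction. After [pos g], the edge must be in the tree, for otherwise it would be the bottom
    of its left face, whose rank would be too small. *)
Lemma cross_in v g : ~~ ot g -> inr g ->
  rank g <= entry v < rank (edge g) ->
  entry v <= entry (org g) /\ FI g \/
  H (edge g) /\ entry (org (edge g)) <= entry v <= pos (edge g).
Proof.
move=> og red /andP[l1 l2].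
have nFI : entry v <= pos g -> FI g.
  move=> le; apply: contraT => nf; have ig : g \notin outer_face T.
    by apply: contra nf => /outer_first_in; apply.
  have : entry v < rank (turn (tinv g)).
    apply: entry_lt_rank; rewrite ?turn_tinv //.
    by apply: contra nf => o; rewrite /FI og o orbT.
  by rewrite turn_tinv ltnNge l1.
have [le|lt] := leqP (entry v) (entry (org g)).
  by left; split=> //; apply: nFI; apply: leq_trans le (entry_le P irr g).
have [le|lt'] := leqP (entry v) (pos g).
  have := nFI le; rewrite /FI og /= => /orP[/eqP e|o].
    by move: le lt; rewrite e pos_oN; lia.
  have := entry_le_out o; rewrite turn_tinv org_tinv => /(_ _ le).
  by rewrite leqNgt lt.
right; have [he|he] := boolP (H (edge g)).
  rewrite entry_leftmost // edgeK lt'; split=> //.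
  have [oe|ie] := boolP (edge g \in outer_face T).
    by rewrite entry_le_leftmost_outer.
  by have := rank_pos ie; lia.
move: l2; rewrite rank_id ?in_red_edge ?edgeK //; first by rewrite ltnNge lt'.
by apply: leftmost_coleftmost; rewrite ?ot_edge.
Qed.

Lemma entry_inj : injective entry.
Proof.
move=> u v; case: (entryP u) => [->|[p [_ <- ->]]]; case: (entryP v) => [->|[q [_ <- ->]]];
  rewrite ?(entry_N P irr) // => -[] /(pos_inj irr) /(can_inj (@edgeK T)) -> //.
Qed.

(** A discrete intermediate value argument: counterclockwise from [g], the faces between the
    outgoing darts start with a rank at most [entry v] and end, on the left of the leftmost one,
    with a rank above [entry w]. *)
Lemma vertex_crossing v w g : FI g -> org g = w -> rank g <= entry v < entry w ->
  exists o, [/\ ot o, org o = w & rank (edge o) <= entry v < rank o].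
Proof.
move=> fg eg /andP[l1 l2].
have wN : w != vN T by apply: contraTneq l2 => ->; rewrite (entry_N P irr).
case: (boolP [exists o, [&& ot o, org o == w & rank (edge o) <= entry v < rank o]]).
  by case/existsP=> o /and3P[h1 /eqP h2 h3]; exists o.
rewrite negb_exists => /forallP no.
have {}no o : ot o -> org o = w -> rank (edge o) <= entry v -> rank o <= entry v.
  by move=> h1 h2 h3; have := no o; rewrite h1 h2 h3 eqxx /= -leqNgt.
have run o : ot o -> org o = w -> rank o <= entry v -> False.
  have [n] := ubnP (pos o); elim: n o => // n IH o lt oo eo le.
  have H_contra o' : H o' -> org o' = w -> rank o' <= entry v -> False.
    move=> ho eo' le'; have := entry_lt_rank_leftmost ho (entry_le P irr o').
    by rewrite eo'; lia.
  have [|ho] := boolP (H o); first by move/H_contra; apply.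
  have hd := leftmost_coleftmost oo ho; have ot' := coleftmost_tinv hd.
  have et : org (tinv o) = w by rewrite org_tinv.
  have le' : rank (tinv o) <= entry v.
    by apply: no => //; rewrite -rank_turn turn_tinv // (coleftmost_inner irr hd).
  have [|ho'] := boolP (H (tinv o)); first by move/H_contra; apply.
  apply: (IH (tinv o)) => //.
  have := @pos_turn_cotree (tinv o) ho'; rewrite turn_tinv => e.
  move: lt; rewrite e //; first by apply: in_not_leftmost; rewrite ot_edge // ot'.
  by apply/eqP => e'; rewrite -eo e' eqxx in wN.
case/andP: (fg) => og /orP[/eqP e|ot']; first by rewrite -eg e eqxx in wN.
case: (run (tinv g)) => //; first by rewrite org_tinv.
apply: no; rewrite ?org_tinv //.
have [o|ig] := boolP (g \in outer_face T); last by rewrite -rank_turn turn_tinv.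
have : edge (tinv g) \in outer_face T by rewrite edge_outer_turn turn_tinv.
by rewrite {1}/rank => ->; rewrite ot_edge // ot'.
Qed.

(** Climb from [org g]: [vertex_crossing] gives the next crossing edge and [cross_in] makes it a
    first ingoing one. The entry times decrease until that of [v] is reached, and they determine the
    vertex. *)
Lemma cross_down v g : ~~ ot g -> inr g ->
  rank g <= entry v < rank (edge g) -> entry v <= entry (org g) ->
  FI g /\ connect down v (org g).
Proof.
have [n] := ubnP (entry (org g)); elim: n g => // n IH g lt og red cr le.
have fg : FI g.
  case: (cross_in og red cr) => [[] //|[he /andP[l _]]].
  by move: l; rewrite entry_leftmost // edgeK; have := entry_le P irr g; lia.
split=> //; move: le; rewrite leq_eqVlt => /orP[/eqP /entry_inj <-|le]; first exact: connect0.
have [|o [oo eo cro]] := @vertex_crossing v (org g) g fg erefl; first by lia.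
have redo : inr o.
  by apply: contraTT cro => /rank_blue ->; lia.
have oeo : ~~ ot (edge o) by rewrite ot_edge // oo.
have lt2 : entry (org (edge o)) < entry (org g).
  by rewrite -eo; apply: leq_ltn_trans (entry_le P irr _) (entry_lt irr oo).
have := @cross_in v (edge o) oeo; rewrite edgeK in_red_edge => /(_ redo cro) [[l fo]|].
  have [_ c] : FI (edge o) /\ connect down v (org (edge o)).
    by apply: IH; rewrite ?in_red_edge ?edgeK //; lia.
  apply: connect_trans c _; apply: connect1; apply/existsP; exists (edge o).
  by rewrite fo edgeK eo !eqxx.
by case=> ho; rewrite eo; lia.
Qed.

Lemma up_parent u v : connect up u v = fconnect (parent (@org T) (@edge T) H) u v.
Proof.
have par x : H x -> parent (@org T) (@edge T) H (org x) = org (edge x).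
  by move=> hx; rewrite parent_org //; exact: leftmost_uniq irr.
apply/idP/idP; apply: connect_sub => a b.
  by case/existsP=> x /and3P[hx /eqP <- /eqP <-]; rewrite -par // fconnect1.
move=> /eqP <-; case: (parent_cases P a) => [->|[p [hp e ->]]]; first exact: connect0.
by apply: connect1; apply/existsP; exists p; rewrite hp e !eqxx.
Qed.

Lemma up_entry v e : H e -> connect up v (org e) = (entry (org e) <= entry v <= pos e).
Proof.
move=> he; rewrite up_parent.
case: (entryP v) => [ev|[p [hp <- ep]]].
  rewrite ev (entry_N P irr) entry_leftmost //=; apply/negP => /iter_of_findex [k _].
  rewrite iter_root => [e'|]; last exact: leftmost_root irr.
  by have := leftmost_root irr he; rewrite e' eqxx.
have pt : pos (turn p) = entry (org p).
  rewrite ep -(psi_edge hp) pos_psi // psi_edge //.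
  by apply/eqP => /turn_oN_org e'; have := leftmost_root irr hp; rewrite e' eqxx.
by rewrite -pt -subtree_entry // /subtree org_turn1.
Qed.

Lemma crossing_sep_path v e : inr e -> ot e ->
  rank (edge e) <= entry v < rank e -> sep_path inr (out_red P) v e.
Proof.
move=> red oe cr; rewrite sep_pathE.
have oe' : ~~ ot (edge e) by rewrite ot_edge // oe.
have := @cross_in v (edge e) oe'; rewrite edgeK in_red_edge => /(_ red cr) [[le _]|[he l]].
  have := @cross_down v (edge e) oe'; rewrite edgeK in_red_edge => /(_ red cr le) [-> ->].
  by rewrite orbT.
by rewrite he up_entry // l.
Qed.
End SeparatingPaths.

(** * Face counts *)

Section NextInSubmap.
Variables (T : plane_graph) (K : pred (dart T)).
Implicit Types (x y : dart T).

Lemma head_filter_traject x y n :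
  (exists i, [/\ i < n, K (iter i (@turn T) y),
     forall j, j < i -> ~~ K (iter j (@turn T) y) &
     head x [seq z <- traject (@turn T) y n | K z] = iter i (@turn T) y]) \/
  (forall j, j < n -> ~~ K (iter j (@turn T) y)) /\
    head x [seq z <- traject (@turn T) y n | K z] = x.
Proof.
elim: n y => [|n IH] y /=; first by right.
have [Ky|nKy] := boolP (K y); first by left; exists 0.
case: (IH (turn y)) => [[i [lt Ki mi e]]|[nK e]].
  by left; exists i.+1; rewrite !iterSr; split=> // -[|j] // lj; rewrite iterSr mi.
by right; split=> // -[|j] // lj; rewrite iterSr nK.
Qed.

Lemma turnK_spec x : K x -> exists i,
  [/\ turnK K x = iter i.+1 (@turn T) x, K (turnK K x) &
      forall j, j < i -> ~~ K (iter j.+1 (@turn T) x)].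
Proof.
move=> Kx; have -> : turnK K x =
    head x [seq z <- traject (@turn T) (turn x) (order (@turn T) x).-1 | K z].
  rewrite /turnK /orbit -orderSpred /= Kx /=.
  by case: [seq z <- _ | _] => //=; rewrite eqxx.
case: (head_filter_traject x (turn x) (order (@turn T) x).-1) => [[i [lt Ki mi ->]]|[nK ->]].
  by exists i; rewrite iterSr; split=> // j lj; rewrite iterSr mi.
exists (order (@turn T) x).-1; rewrite orderSpred iter_order; last exact: turn_inj.
by split=> // j lj; rewrite iterSr nK.
Qed.

Lemma turnK_inj x y : K x -> K y -> turnK K x = turnK K y -> x = y.
Proof.
move=> Kx Ky; have [i [-> _ mi]] := turnK_spec Kx; have [j [-> _ mj]] := turnK_spec Ky.
wlog le : x y i j Kx Ky mi mj / i <= j.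
  move=> h e; case: (leqP i j) => [le|/ltnW le]; first exact: h mi mj le e.
  by symmetry; apply: h mj mi le (esym e).
rewrite -(subnK le) addnC -addSn iterD; elim: i.+1 => [|n IH] /=; last by move/turn_inj.
case e: (j - i) => [|m] // ex; have := mj m; rewrite -ex Kx; by move=> /(_ ltac:(lia)).
Qed.

Hypothesis K_edge : forall x, K (edge x) = K x.

Lemma faceK_in x : K x -> K (faceK K x).
Proof. by rewrite -K_edge => /turnK_spec [i []]. Qed.

(** [next] fixes what is not in the list. Hence [faceK] is injective on all darts, and its orbits
    are symmetric without restriction. *)
Lemma faceK_out x : ~~ K x -> faceK K x = edge x.
Proof.
rewrite -K_edge /faceK /turnK; move: (edge x) => y nK.
have : y \notin [seq z <- orbit (@turn T) y | K z] by rewrite mem_filter (negPf nK).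
case: [seq _ <- _ | _] => //= z s; rewrite inE negb_or => /andP[].
move: {2}z => w; elim: s z => [|a s IH] z /= /negPf -> //.
by rewrite inE negb_or => /andP[h1 h2]; apply: IH.
Qed.

Lemma faceK_inj : injective (faceK K).
Proof.
move=> x y; have [Kx|nx] := boolP (K x); have [Ky|ny] := boolP (K y).
- by move/turnK_inj; rewrite !K_edge => /(_ Kx Ky) /(can_inj (@edgeK T)).
- by move=> e; have := faceK_in Kx; rewrite e faceK_out // K_edge (negPf ny).
- by move=> e; have := faceK_in Ky; rewrite -e faceK_out // K_edge (negPf nx).
by rewrite !faceK_out // => /(can_inj (@edgeK T)).
Qed.

Lemma dual_step_sym wall : connect_sym (dual_step (faceK K) wall).
Proof.
suff h x y : connect (dual_step (faceK K) wall) x y -> connect (dual_step (faceK K) wall) y x.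
  by move=> x y; apply/idP/idP; apply: h.
case/connectP=> p; elim: p x => [|z p IH] x /=; first by move=> _ ->.
case/andP=> s pp e; apply: connect_trans (IH _ pp e) _.
case/orP: s => [/eqP ->|/and3P[/eqP-> w1 w2]].
  have : fconnect (faceK K) (faceK K x) x by rewrite fconnect_sym ?fconnect1 //; exact: faceK_inj.
  by apply: connect_sub => a b /= /eqP <-; apply: connect1; rewrite /= eqxx.
by apply: connect1; rewrite /= edgeK eqxx w1 w2 orbT.
Qed.

Lemma fconnect_dual_step wall x y : fconnect (faceK K) x y -> connect (dual_step (faceK K) wall) x y.
Proof.
by apply: connect_sub => a b /= /eqP <-; apply: connect1; rewrite /= eqxx.
Qed.

Lemma dual_step_edge wall x : ~~ wall x -> ~~ wall (edge x) ->
  connect (dual_step (faceK K) wall) (edge x) x.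
Proof. by move=> w1 w2; apply: connect1; rewrite /= edgeK eqxx w1 w2 orbT. Qed.

End NextInSubmap.

Section FaceCounts.
Variables (T : plane_graph) (P : transversal_pair T).
Hypothesis irr : irreducible_triangulation T.
Implicit Types (x y p q d e g h : dart T) (u v w : vertex T).

Local Notation oN := (dartN T).
Local Notation oE := (dartE T).
Local Notation oS := (dartS T).
Local Notation oW := (dartW T).
Local Notation ot := (ot P).
Local Notation cls := (cls P).
Local Notation H := (leftmost P).
Local Notation HD := (coleftmost P).
Local Notation psi := (psi P).
Local Notation pos := (pos P).
Local Notation entry := (entry P).
Local Notation inr := (in_red P).
Local Notation FI := (first_in P).
Local Notation rank := (rank P).
Local Notation bottom := (bottom P).

Let inr_edge x : inr (edge x) = inr x. Proof. exact: in_red_edge. Qed.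
Local Notation fK := (faceK inr).
Let fK_inj : injective fK := faceK_inj inr_edge.

Lemma inner_first_in v : inner_vertex v -> exists x1, forall y, org y = v -> FI y -> y = x1.
Proof.
move=> iv; have [x0 [m [ex mo c0 oi]]] := inner_out_interval P irr iv.
exists (iter m (@turn T) x0) => y ey /andP[oy].
have nN : y != oN by apply: contraTneq iv => e'; rewrite -ey e' /inner_vertex !inE eqxx.
rewrite (negPf nN) /=.
have : fconnect (@turn T) x0 y by rewrite -org_turn ex ey.
case/iter_of_findex=> -[|i] lt e; move: oy; rewrite e oi //; first by lia.
rewrite iterS tinv_turn oi ?(ltnW lt) // => h1 h2.
by have -> : m = i.+1 by lia.
Qed.

Lemma first_in_uniq x y : FI x -> FI y -> org x = org y -> x = y.
Proof.
move=> Hx Hy e; case: (boolP (inner_vertex (org x))) => [iv|/not_inner_vertex].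
  by have [x0 h] := inner_first_in iv; rewrite (h x) // (h y).
have k z w : org z = w -> [\/ w = vN T, w = vE T, w = vS T | w = vW T] -> FI z ->
  [\/ z = oN /\ w = vN T, z = oE /\ w = vE T | z = edge oS /\ w = vW T].
  move=> ez [] ew; rewrite ew in ez * => /andP[oz].
  - case/orP=> [/eqP->|]; first by constructor 1.
    by rewrite (ot_at_N P irr) // org_tinv.
  - case/orP=> [/eqP e'|]; first by constructor 1; rewrite -ez e'.
    move/(ot_at_E irr); rewrite org_tinv => /(_ ez) e'.
    by constructor 2; rewrite -[z]turn_tinv e'; case: (turn_edge_outer irr).
  - by rewrite (ot_at_S P irr ez) in oz.
  by move=> _; constructor 3; rewrite (ot_at_W irr ez oz).
case: (outer_vertex_neq irr) => [[/eqP d1 /eqP d2 /eqP d3] [/eqP d4 /eqP d5 /eqP d6]] o.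
by case: (k _ _ erefl o Hx) => -[ex e1]; case: (k _ _ (esym e) o Hy) => -[ey e2]; first [by rewrite ex ey | congruence].
Qed.

Lemma rank_outer_in g : g \in outer_face T -> ~~ ot g -> rank g = 0.
Proof. by rewrite /rank => -> /negPf ->. Qed.

(** Turning clockwise through the outgoing darts crosses them from left to right, and each crossing
    can only lower the rank. *)
Lemma rank_first_in_le g e : FI g -> ot e -> org e = org g -> rank g <= rank (edge e).
Proof.
move=> fg oe /eqP; rewrite org_turn => /iter_of_findex [[|m] _ eg].
  by case/andP: fg; rewrite eg oe.
elim: m e oe eg => [|m IH] e oe eg.
  have [o|ig] := boolP (g \in outer_face T).
    by rewrite rank_outer_in //; case/andP: fg.
  by rewrite eg rank_turn //; rewrite eg in ig.
have orgt : org (turn e) = org g by rewrite eg org_iter_turn org_turn1.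
have [ote|nte] := boolP (ot (turn e)).
  apply: leq_trans (IH (turn e) ote _) _; first by rewrite eg iterSr.
  apply: leq_trans (rank_le irr ote) _; rewrite rank_turn //.
  apply/negP; rewrite (outerE irr) !inE; case: (ot_outer P irr) => [[a1 a2 _ _] [_ _ b _]].
  case/or4P=> /eqP e'; rewrite e' ?a1 ?a2 // in ote.
    by case/andP: fg; rewrite (ot_at_S P irr) // -orgt e'.
  move: oe; have -> : e = edge oS by apply: turn_inj; rewrite e'; case: (turn_edge_outer irr).
  by rewrite b.
have ft : FI (turn e) by rewrite /FI nte tinv_turn oe orbT.
rewrite (first_in_uniq fg ft (esym orgt)).
have [o|ig] := boolP (turn e \in outer_face T); first by rewrite rank_outer_in.
by rewrite rank_turn.
Qed.

(** Downwards, [entry] grows by [entry_lt], whereas the rank of the face on the right of the path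
    does not, by [rank_first_in_le] at each vertex. *)
Lemma down_rank v w : connect (down P) v w ->
  entry v <= entry w /\ forall g, FI g -> org g = w -> rank g <= entry v.
Proof.
case/connectP=> p; elim/last_ind: p w => [|p u IH] w.
  move=> _ /= ->; split=> // g fg eg; case/andP: (fg) => og.
  case/orP=> [/eqP e|o].
    by rewrite rank_outer_in // e (outerE irr) inE eqxx.
  have := rank_first_in_le fg o; rewrite org_tinv => /(_ erefl) le.
  apply: leq_trans le _; have o' : ~~ ot (edge (tinv g)) by rewrite ot_edge // o.
  apply: leq_trans (rank_in irr o') _; have := entry_lt irr o; rewrite org_tinv eg.
  exact: ltnW.
rewrite rcons_path last_rcons => /andP[pp /existsP[g /and3P[fg /eqP eg /eqP eu]]] ew.
have [le r] := IH _ pp erefl; have rg := r g fg eg.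
have og : ~~ ot g by case/andP: fg.
have oe : ot (edge g) by rewrite ot_edge.
split.
  rewrite ew -eu; apply: leq_trans le _; rewrite -eg.
  apply: leq_trans (entry_le P irr _) _; apply: ltnW.
  by have := entry_lt irr oe; rewrite edgeK.
move=> g' fg' eg'; apply: leq_trans rg; rewrite -[g]edgeK.
by apply: rank_first_in_le => //; rewrite eg' ew.
Qed.

Lemma sep_path_crossing v e : sep_path inr (out_red P) v e ->
  [/\ inr e, ot e & rank (edge e) <= entry v < rank e].
Proof.
rewrite sep_pathE // => /orP[/andP[he]|/andP[fg c]].
  rewrite up_entry // => /andP[l1 l2]; have oe := leftmost_ot he.
  split=> //; first exact: leftmost_in_red.
  rewrite (entry_lt_rank_leftmost irr) // andbT; apply: leq_trans l1.
  have o' : ~~ ot (edge e) by rewrite ot_edge // oe.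
  by apply: leq_trans (rank_in irr o') (ltnW (entry_lt irr oe)).
have [le r] := down_rank c; have oe' : ~~ ot (edge e) by case/andP: fg.
have oe : ot e by rewrite ot_edge // negbK in oe'.
split=> //; first by rewrite -inr_edge; exact: first_in_red fg.
rewrite r //=; have [o|ie] := boolP (e \in outer_face T).
  by rewrite /rank o oe ltnS ltnW // entry_lt_card.
have it : turn (edge e) \notin outer_face T by rewrite -edge_outer_turn edgeK.
have := entry_lt_rank irr oe' it; rewrite rank_turn // edgeK; apply.
by apply: leq_trans le _; rewrite -org_turn1; exact: entry_le.
Qed.

Lemma submap_turn x : inr x -> exists i,
  [/\ turnK inr x = iter i.+1 (@turn T) x, inr (turnK inr x),
   ot (iter i (@turn T) x) = ot x &
   forall j, j < i -> ~~ inr (iter j.+1 (@turn T) x)].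
Proof.
move=> rx; have [i [e1 e2 e3]] := turnK_spec rx; exists i; split=> //.
elim: i e3 {e1} => // i IH e3; rewrite -IH => [|j lj]; last by rewrite e3 // ltnW.
have := blue_tinv irr (e3 i (ltnSn i)); rewrite iterS tinv_turn => <- //.
Qed.

(** The darts skipped along a red face are blue, and [bottom] agrees on the two sides of a blue
    edge. *)
Lemma faceK_bottom x : inr x -> x \notin outer_face T ->
  fK x \notin outer_face T /\ bottom (fK x) = bottom x.
Proof.
rewrite -inr_edge => rx ix; have [i [e _ _ bl]] := submap_turn rx.
rewrite /faceK e {e}.
elim: i bl => [|i IH] bl.
  by rewrite -[iter 1 _ _]/(face x) outer_face_face bottom_face.
have [|i1 i2] := IH; first by move=> j lj; rewrite bl // ltnW.
have b := bl i (ltnSn i); rewrite iterS; move: (iter i.+1 _ _) i1 i2 b => y i1 i2 b.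
have [/andP[_ ie] _] := blue_inner b.
by rewrite -edge_outer_turn -face_edge bottom_face // bottom_blue.
Qed.

Lemma faceK_orbit x y : inr x -> x \notin outer_face T -> fconnect fK x y ->
  [/\ inr y, y \notin outer_face T & bottom y = bottom x].
Proof.
move=> rx ix /iter_of_findex [i _ ->]; elim: i => //= i [h1 h2 h3].
by have [-> ->] := faceK_bottom h1 h2; rewrite h3; split=> //; exact: faceK_in.
Qed.

Lemma org_faceK x : inr x -> org (fK x) = org (edge x).
Proof. by rewrite -inr_edge => /submap_turn [i [e _ _ _]]; rewrite /faceK e org_iter_turn. Qed.

(** A red face with ingoing darts only would be bounded by a directed cycle, along which [entry]
    would grow forever. *)
Lemma orbit_out x : inr x -> x \notin outer_face T -> exists2 y, fconnect fK x y & ot y.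
Proof.
move=> rx ix; case: (boolP [exists y, fconnect fK x y && ot y]) => [/existsP[y /andP[]]|].
  by exists y.
rewrite negb_exists => /forallP no.
have key i : entry (org x) + i <= entry (org (iter i fK x)).
  elim: i => [|i IH]; first by rewrite addn0.
  have := no (iter i fK x); rewrite fconnect_iter /= => o.
  have [r1 r2 _] := faceK_orbit rx ix (fconnect_iter fK i x).
  rewrite org_faceK // addnS; apply: leq_ltn_trans IH _.
  apply: leq_ltn_trans (entry_le P irr _) _.
  by rewrite -{1}[iter i fK x]edgeK; apply: entry_lt => //; rewrite ot_edge.
have := key #|dart T|; have := entry_lt_card P irr (org (iter #|dart T| fK x)); lia.
Qed.

Lemma orbit_in x : inr x -> x \notin outer_face T -> exists2 y, fconnect fK x y & ~~ ot y.
Proof.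
move=> rx ix; case: (boolP [exists y, fconnect fK x y && ~~ ot y]) => [/existsP[y /andP[]]|].
  by exists y.
rewrite negb_exists => /forallP no.
have key i : entry (org (iter i fK x)) + i <= entry (org x).
  elim: i => [|i IH]; first by rewrite addn0.
  have := no (iter i fK x); rewrite fconnect_iter /= negbK => o.
  have [r1 r2 _] := faceK_orbit rx ix (fconnect_iter fK i x).
  rewrite org_faceK // addnS; apply: leq_trans IH; rewrite ltn_add2r.
  apply: leq_ltn_trans (entry_le P irr _) _; exact: entry_lt.
have := key (entry (org x)).+1; lia.
Qed.

(** Having darts of both directions, the orbit contains an ingoing dart followed by an outgoing one;
    the latter is [HD] and red, hence the bottom. So [bottom] determines the face. *)
Lemma bottom_orbit x : inr x -> x \notin outer_face T -> fconnect fK x (bottom x).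
Proof.
move=> rx ix; have [t ct ot'] := orbit_in rx ix.
have [rt it bt] := faceK_orbit rx ix ct.
have ex : exists n, ot (iter n fK t).
  by have [y /iter_of_findex [n _ ->] oy] := orbit_out rt it; exists n.
case: (ex_minnP ex) => -[|n] on nmin; first by rewrite /= (negPf ot') in on.
have on' : ~~ ot (iter n fK t) by apply/negP => /nmin; rewrite ltnn.
have [r1 i1 b1] := faceK_orbit rt it (fconnect_iter fK n t).
have c2 := fconnect_iter fK n.+1 t; have [r2 i2 b2] := faceK_orbit rt it c2.
rewrite -bt -b2; move: c2 r2 i2 on {b2 nmin}; rewrite iterS.
move: (iter n fK t) r1 on' => z rz oz c2 r2 i2 o2.
have hd : HD (fK z).
  rewrite /HD o2 /H o2 /= negb_or negbK; apply/andP; split.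
    by apply: contraNneq i2 => ->; rewrite (outerE irr) !inE eqxx !orbT.
  move: rz; rewrite -inr_edge => /submap_turn [i [e _ oi _]].
  by rewrite /faceK e iterS tinv_turn oi ot_edge.
by rewrite (bottom_id irr hd r2); apply: connect_trans ct c2.
Qed.

Lemma rank_bottom y : y \notin outer_face T -> rank y = (pos (edge (bottom y))).+1.
Proof. by rewrite /rank => /negPf ->. Qed.

(** The map [edge (bottom r)] is a bijection from the faces, represented by the roots of their
    orbits, to the counted darts. The condition [c] on ranks is left free so as to serve both sides
    of the path. *)
Lemma card_faces (S : {set dart T}) (c : pred nat) :
  (forall y, (y \in S) = [&& y \notin outer_face T, inr y & c (rank y)]) ->
  fcard fK (mem S) = #|[pred q | counted P q && c (pos q).+1]|.
Proof.
move=> SE; have sub r : r \in [set r | froots fK r && (r \in S)] ->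
   [/\ froots fK r, r \notin outer_face T, inr r & c (rank r)].
  by rewrite inE SE => /andP[-> /and3P[]].
set A := [set r | froots fK r && (r \in S)] in sub *.
have cA : #|A| = fcard fK (mem S).
  by apply: eq_card => r; rewrite !inE.
rewrite -cA -(card_in_imset (f := fun r => edge (bottom r))).
  apply: eq_card => q; rewrite inE /=; apply/imsetP/andP => [[r /sub [_ ir rr cr] ->]|[cq c']].
    have [hb rb _] := bottomP P irr ir; rewrite -rank_bottom //; split=> //.
    by case/andP: (hb) => ob nh; rewrite /counted inr_edge rb ot_edge // ob edgeK.
  case/and3P: cq => rq oq hq.
  have hd : HD (edge q) by apply: leftmost_coleftmost; rewrite ?ot_edge.
  have re : inr (edge q) by rewrite inr_edge.
  have ie := coleftmost_inner irr hd; have be := bottom_id irr hd re.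
  have cr := connect_root (frel fK) (edge q).
  have [r1 r2 r3] := faceK_orbit re ie cr.
  exists (froot fK (edge q)); last by rewrite r3 be edgeK.
  rewrite inE roots_root /=; last by apply: fconnect_sym; exact: fK_inj.
  by rewrite SE r1 r2 rank_bottom // r3 be edgeK.
move=> r r' /sub [fr ir rr _] /sub [fr' ir' rr' _] /(can_inj (@edgeK T)) e.
have c1 := bottom_orbit rr ir; have c2 := bottom_orbit rr' ir'.
have sym := fconnect_sym fK_inj.
have : fconnect fK r r' by apply: connect_trans c1 _; rewrite sym e.
by rewrite -(root_connect sym) (eqP fr) (eqP fr') => /eqP.
Qed.

Lemma sep_step v y : inr y -> y \notin outer_face T -> edge y \notin outer_face T ->
  ~~ path_wall inr (out_red P) v y -> ~~ path_wall inr (out_red P) v (edge y) ->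
  (rank y <= entry v) = (rank (edge y) <= entry v).
Proof.
have key e : inr e -> ot e -> ~~ path_wall inr (out_red P) v e ->
    (rank e <= entry v) = (rank (edge e) <= entry v).
  rewrite /path_wall /= negb_or => re oe /andP[ns _].
  have lt := rank_lt irr re oe; apply/idP/idP; first lia.
  move=> le; rewrite leqNgt; apply: contra ns => lt'.
  by apply: crossing_sep_path => //; rewrite le.
move=> ry iy ie w1 w2; have [oy|ny] := boolP (ot y); first exact: key.
by have := @key (edge y); rewrite edgeK inr_edge ot_edge // => ->.
Qed.

Lemma dual_closed v x y : inr x -> x \notin outer_face T ->
  connect (dual_step fK (path_wall inr (out_red P) v)) x y ->
  [/\ inr y, y \notin outer_face T & (rank y <= entry v) = (rank x <= entry v)].
Proof.
move=> rx ix /connectP[p]; elim: p x rx ix => [|z p IH] x rx ix /=; first by move=> _ ->.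
case/andP=> /orP[/eqP->|/and3P[/eqP-> w1 w2]] pp ey.
  have [b1 b2] := faceK_bottom rx ix.
  have [r1 r2 ->] := IH _ (faceK_in inr_edge rx) b1 pp ey.
  by rewrite !rank_bottom // b2.
have ie : edge x \notin outer_face T by move: w2; rewrite /= negb_or => /andP[].
by case: (IH (edge x)) => //; [rewrite inr_edge | move=> ? ? ->; rewrite -sep_step].
Qed.

(** Without crossing the path one stays on the same side of time [entry v]. Conversely, leave the
    face of [y] leftwards through an ingoing dart of its boundary: the rank grows, so the path is
    met before the rank exceeds [entry v]. *)
Lemma mem_right_of v y : (y \in right_of inr (out_red P) v) =
  [&& y \notin outer_face T, inr y & rank y <= entry v].
Proof.
rewrite inE; apply/existsP/and3P => [[x /and3P[ix sx c]]|[iy ry le]].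
  have [re oe /andP[l1 l2]] := sep_path_crossing sx; rewrite inr_edge in re.
  have [r1 r2 r3] := dual_closed re ix c; split=> //.
  by rewrite r3; move: l1; rewrite edgeK.
have [n] := ubnP (entry v - rank y); elim: n y iy ry le => // n IH y iy ry le lt.
have sym := dual_step_sym inr_edge (path_wall inr (out_red P) v).
have [y' c oy'] := orbit_in ry iy; have [ry' iy' by'] := faceK_orbit ry iy c.
have rk : rank y' = rank y by rewrite !rank_bottom // by'.
have cy : connect (dual_step fK (path_wall inr (out_red P) v)) y' y.
  by rewrite sym; exact: fconnect_dual_step.
have oe : ot (edge y') by rewrite ot_edge.
have re : inr (edge y') by rewrite inr_edge.
have [s|ns] := boolP (sep_path inr (out_red P) v (edge y')).
  by exists y'; rewrite iy' s cy.
have := @crossing_sep_path _ _ irr v _ re oe; rewrite (negPf ns) edgeK rk le /=.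
case: ltnP => [_ /(_ isT) //|le' _].
have ie : edge y' \notin outer_face T.
  apply: contraL le'; rewrite -ltnNge => o.
  by rewrite /rank o oe ltnS ltnW // entry_lt_card.
have lt' := rank_lt irr re oe; rewrite edgeK rk in lt'.
have [|x /and3P[h1 h2 h3]] := IH _ ie re le'; first by lia.
exists x; rewrite h1 h2 /=; apply: connect_trans h3 (connect_trans _ cy).
have ns' : ~~ sep_path inr (out_red P) v y'.
  by apply: contra oy' => /sep_path_crossing [].
by apply: dual_step_edge; apply/norP.
Qed.

Lemma mem_left_of v y : (y \in left_of inr (out_red P) v) =
  [&& y \notin outer_face T, inr y & entry v < rank y].
Proof.
rewrite inE; apply/existsP/and3P => [[x /and3P[ix sx c]]|[iy ry le]].
  have [re oe /andP[l1 l2]] := sep_path_crossing sx.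
  have [r1 r2 r3] := dual_closed re ix c; split=> //.
  by rewrite ltnNge r3 -ltnNge.
have [n] := ubnP (rank y); elim: n y iy ry le => // n IH y iy ry le lt.
have sym := dual_step_sym inr_edge (path_wall inr (out_red P) v).
have [y' c oy'] := orbit_out ry iy; have [ry' iy' by'] := faceK_orbit ry iy c.
have rk : rank y' = rank y by rewrite !rank_bottom // by'.
have cy : connect (dual_step fK (path_wall inr (out_red P) v)) y' y.
  by rewrite sym; exact: fconnect_dual_step.
have re : inr (edge y') by rewrite inr_edge.
have [s|ns] := boolP (sep_path inr (out_red P) v y').
  by exists y'; rewrite iy' s cy.
have := @crossing_sep_path _ _ irr v _ ry' oy'; rewrite (negPf ns) rk le andbT.
case: leqP => [_ /(_ isT) //|le' _].
have ne : ~~ ot (edge y') by rewrite ot_edge // oy'.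
have ie : edge y' \notin outer_face T.
  by apply: contraL le' => o; rewrite rank_outer_in.
have lt' := rank_lt irr ry' oy'; rewrite rk in lt'.
have [|x /and3P[h1 h2 h3]] := IH _ ie re le'; first by lia.
exists x; rewrite h1 h2 /=; apply: connect_trans h3 (connect_trans _ cy).
have ns' : ~~ sep_path inr (out_red P) v (edge y').
  by apply: contra ne => /sep_path_crossing [].
by apply: dual_step_edge; apply/norP.
Qed.

Lemma faces_rightE v : faces_right inr (out_red P) v = height P v.
Proof.
rewrite /faces_right (@card_faces _ (fun k => k <= entry v)) //.
exact: mem_right_of.
Qed.

Lemma faces_leftE v : faces_left inr (out_red P) v = n_counted P - height P v.
Proof.
rewrite /faces_left (@card_faces _ (fun k => entry v < k)); last exact: mem_left_of.
rewrite /n_counted -(cardID [pred q | pos q < entry v] (counted P)).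
have -> : height P v = #|[predI (counted P) & [pred q | pos q < entry v]]|.
  by apply: eq_card => q; rewrite !inE.
rewrite addKn; apply: eq_card => q; rewrite !inE andbC; congr andb.
by rewrite ltnS -leqNgt.
Qed.

End FaceCounts.

(** * Quarter turn *)

(** The same map whose outer face starts one dart later: E, S, W, N take the parts of N, E, S, W. *)
Definition rotate (T : plane_graph) : plane_graph :=
  @PlaneGraph (vertex T) (dart T) (@org T) (@edge T) (@turn T) (dartE T)
    (@edgeK T) (@turn_inj T) (@org_turn T) (@org_surj T) (@loopless T)
    (@no_multi T) (@connected T) (euler T).

Section Rotation.
Variable T : plane_graph.
Implicit Types (x y : dart T) (u v : vertex T).

Lemma outer_face_rotate x : (x \in outer_face (rotate T)) = (x \in outer_face T).
Proof.
rewrite !inE -!fconnect_orbit; symmetry.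
exact: (same_fconnect1 (@face_inj T) (outer T) x).
Qed.

Lemma inner_edge_rotate x : @inner_edge (rotate T) x = inner_edge x.
Proof. by rewrite /inner_edge !outer_face_rotate. Qed.

Section FacesRight.
Variables (K K' O O' : pred (dart T)).
Hypothesis eqK : K =1 K'.
Hypothesis eqO : forall x, K x -> O x = O' x.

Lemma turnK_ext x : @turnK (rotate T) K' x = turnK K x.
Proof. by rewrite /turnK -(eq_filter eqK). Qed.

Lemma prevK_ext x : @prevK (rotate T) K' x = prevK K x.
Proof. by rewrite /prevK -(eq_filter eqK). Qed.

Lemma first_ext x : @first (rotate T) K' O' x = first K O x.
Proof.
rewrite /first -eqK outer_face_rotate prevK_ext; case Kx: (K x) => //=.
rewrite -!eqO //; have : prevK K x \in [seq y <- orbit (@turn T) x | K y].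
  by rewrite /prevK mem_prev mem_filter Kx in_orbit.
by rewrite mem_filter => /andP[].
Qed.

Lemma first_O_ext x : @first (rotate T) K' O' x && O' x = first K O x && O x.
Proof.
rewrite first_ext; case f: (first K O x) => //=; rewrite -eqO //.
by case/andP: f.
Qed.
Lemma first_nO_ext x : @first (rotate T) K' O' x && ~~ O' x = first K O x && ~~ O x.
Proof.
rewrite first_ext; case f: (first K O x) => //=; rewrite -eqO //.
by case/andP: f.
Qed.

Lemma sep_path_ext v x : @sep_path (rotate T) K' O' v x = sep_path K O v x.
Proof.
rewrite /sep_path /= !andbA first_O_ext first_nO_ext.
congr (_ && _ || _ && _); apply: eq_connect => a b /=; apply: eq_existsb => y.
  by have := first_O_ext y; rewrite !andbA => ->.
by have := first_nO_ext y; rewrite !andbA => ->.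
Qed.

(** The directions need to agree only on the submap: the quarter turn reverses the red edges, which
    are absent from the blue map. *)
Lemma faces_right_ext v :
  @faces_right (rotate T) K' O' v = faces_right K O v.
Proof.
have eF : @faceK (rotate T) K' =1 faceK K by move=> x; exact: turnK_ext.
rewrite /faces_right (eq_fcard eF); apply: eq_n_comp_r => y; rewrite !inE.
apply: eq_existsb => x; rewrite outer_face_rotate sep_path_ext; congr [&& _, _ & _].
apply: eq_connect => a b /=; rewrite eF /path_wall /=.
by rewrite !sep_path_ext !outer_face_rotate.
Qed.
End FacesRight.

Hypothesis irr : irreducible_triangulation T.

Lemma dartW_rotate : dartW (rotate T) = dartN T.
Proof. exact: face_oW irr. Qed.

Lemma vW_rotate : vW (rotate T) = vN T.
Proof. by rewrite /vW dartW_rotate. Qed.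

Lemma irreducible_rotate : irreducible_triangulation (rotate T).
Proof.
case: (irr) => o4 un o3 sep; split.
- rewrite -[RHS]o4; apply: eq_card => x; symmetry.
  exact: (same_fconnect1 (@face_inj T) (outer T) x).
- by rewrite vW_rotate; move: un; rewrite -(rot_uniq 1).
- by move=> x; rewrite outer_face_rotate; exact: o3.
exact: sep.
Qed.

Variable P : transversal_pair T.

Lemma inner_vertex_rotate v : @inner_vertex (rotate T) v = inner_vertex v.
Proof.
rewrite /inner_vertex vW_rotate; congr negb.
rewrite -[[:: vN T; _; _; _]]/([:: vN T] ++ [:: vE T; vS T; vW T]).
by rewrite mem_cat orbC -mem_cat.
Qed.

Definition rotate_red : pred (dart T) := fun x => ~~ red P x.
Definition rotate_out : pred (dart T) := fun x => if red P x then ~~ out P x else out P x.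

Lemma orbit_iter_turn k x : k < order (@turn T) x ->
  orbit (@turn T) (iter k (@turn T) x) = rot k (orbit (@turn T) x).
Proof.
move=> lt; have := orbitE (cycle_orbit (@turn_inj T) x) (orbit_uniq _ x).
move=> /(_ (iter k (@turn T) x)) ->; last by rewrite -fconnect_orbit fconnect_iter.
by rewrite -/(findex _ _ _) findex_iter.
Qed.

Lemma rotate_rule v : @inner_vertex (rotate T) v -> exists x a b c d,
  org x = v /\ [seq (rotate_out y, rotate_red y) | y <- orbit (@turn T) x]
   = full_turn a b c d.
Proof.
rewrite inner_vertex_rotate => iv.
have [x [a [b [c [d [ex e]]]]]] := inner_rule P iv.
(* Start after the outgoing red interval: outgoing blue becomes outgoing red, ingoing red becomes
   outgoing blue, ingoing blue becomes ingoing red, and outgoing red comes last as ingoing blue. *)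
exists (iter a.+1 (@turn T) x), b, c, d, a; split; first by rewrite org_iter_turn.
have sz : a.+1 < order (@turn T) x.
  have := congr1 size e; rewrite size_map size_orbit => ->.
  by rewrite !size_cat !size_nseq; lia.
rewrite orbit_iter_turn //.
pose g (c : bool * bool) := (if c.2 then ~~ c.1 else c.1, ~~ c.2).
rewrite (eq_map (_ : _ =1 g \o (fun y => (out P y, red P y)))) // map_comp map_rot e.
rewrite -[X in rot X _](size_nseq a.+1 (true, true)) rot_size_cat.
by rewrite !map_cat !map_nseq /full_turn -!catA.
Qed.

Lemma rotate_red_edge x : @inner_edge (rotate T) x -> rotate_red (edge x) = rotate_red x.
Proof. by rewrite inner_edge_rotate => ix; rewrite /rotate_red red_edge. Qed.

Lemma rotate_out_edge x : @inner_edge (rotate T) x -> rotate_out (edge x) = ~~ rotate_out x.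
Proof.
rewrite inner_edge_rotate => ix; rewrite /rotate_out red_edge // out_edge //.
by case: (red P x).
Qed.

Lemma rotate_N x : @inner_edge (rotate T) x -> org x = vN (rotate T) -> ~~ rotate_out x && rotate_red x.
Proof.
rewrite inner_edge_rotate /rotate_out /rotate_red => ix /(rule_E P ix) /andP[/negPf -> /negPf ->] //.
Qed.
Lemma rotate_E x : @inner_edge (rotate T) x -> org x = vE (rotate T) -> ~~ rotate_out x && ~~ rotate_red x.
Proof.
by rewrite inner_edge_rotate /rotate_out /rotate_red => ix /(rule_S P ix) /andP[-> ->].
Qed.
Lemma rotate_S x : @inner_edge (rotate T) x -> org x = vS (rotate T) -> rotate_out x && rotate_red x.
Proof.
by rewrite inner_edge_rotate /rotate_out /rotate_red => ix /(rule_W P ix) /andP[-> /negPf ->].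
Qed.
Lemma rotate_W x : @inner_edge (rotate T) x -> org x = vW (rotate T) -> rotate_out x && ~~ rotate_red x.
Proof.
rewrite inner_edge_rotate vW_rotate /rotate_out /rotate_red => ix.
by move=> /(rule_N P ix) /andP[/negPf -> ->].
Qed.

(* The blue map of [P] is the red map of [rotate_pair], with the directions of
the red edges of [P], now blue, reversed. *)
Definition rotate_pair : transversal_pair (rotate T) :=
  @TransversalPair (rotate T) rotate_red rotate_out rotate_red_edge rotate_out_edge
    rotate_rule rotate_N rotate_E rotate_S rotate_W.

Lemma in_red_rotate x : in_red rotate_pair x = in_blue P x.
Proof. by rewrite /in_red /in_blue inner_edge_rotate. Qed.

Lemma out_red_rotate x : in_blue P x -> out_red rotate_pair x = out_blue P x.
Proof.
rewrite /in_blue /out_red /out_blue inner_edge_rotate.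
case: (inner_edge x) => [/= /negPf nr|_]; first by rewrite /rotate_out nr.
by rewrite dartW_rotate.
Qed.

Lemma transversal_yE v : transversal_y P v = height rotate_pair v.
Proof.
rewrite -(faces_rightE rotate_pair irreducible_rotate); symmetry.
by apply: faces_right_ext => x; [rewrite in_red_rotate | move/out_red_rotate].
Qed.

Lemma transversal_xE v : transversal_x P v = n_counted P - height P v.
Proof. exact: faces_leftE. Qed.

Lemma cls_rotate x : cls rotate_pair x = (if rd P x then ~~ ot P x else ot P x, ~~ rd P x).
Proof.
have [ix|] := boolP (inner_edge x).
  by rewrite /cls !ot_inner ?inner_edge_rotate // !rd_inner ?inner_edge_rotate.
have := cls_outer rotate_pair irreducible_rotate; rewrite dartW_rotate => -[[a1 a2 a3 a4] [a5 a6 a7 a8]].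
have val y c : cls P y = c ->
  (if rd P y then ~~ ot P y else ot P y, ~~ rd P y) = (if c.2 then ~~ c.1 else c.1, ~~ c.2).
  by move=> <-.
case: (cls_outer P irr) => [[b1 b2 b3 b4] [b5 b6 b7 b8]].
by case/(eight_cases irr) => -[] ->;
 [rewrite (val _ _ b1)|rewrite (val _ _ b2)|rewrite (val _ _ b3)|rewrite (val _ _ b4)
 |rewrite (val _ _ b5)|rewrite (val _ _ b6)|rewrite (val _ _ b7)|rewrite (val _ _ b8)].
Qed.

End Rotation.

(** * Compact coordinates *)

Section Compress.
Variables (T : plane_graph) (z : vertex T -> nat).

Lemma compressD u v : z u <= z v ->
  compress z v = compress z u + count [in codom z] (iota (z u) (z v - z u)).
Proof. by move=> le; rewrite /compress -{1}(subnKC le) iotaD count_cat. Qed.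

Lemma compress_le u v : z u <= z v -> compress z u <= compress z v.
Proof. by move=> /compressD ->; apply: leq_addr. Qed.

Lemma compress_lt u v : z u < z v -> compress z u < compress z v.
Proof.
move=> lt; rewrite (compressD (ltnW lt)) -addn1 leq_add2l.
have -> : z v - z u = (z v - z u).-1.+1 by lia.
by rewrite /= codom_f.
Qed.

Lemma compress_bound v : compress z v <= z v.
Proof. by apply: leq_trans (count_size _ _) _; rewrite size_iota. Qed.

Lemma compress_eq u v : compress z u = compress z v -> z u = z v.
Proof. by case: (ltngtP (z u) (z v)) => // /compress_lt; lia. Qed.
End Compress.

(** * Counting darts with Euler's relation *)

Section Euler.
Variable T : plane_graph.

Lemma order_edge x : order (@edge T) x = 2.
Proof.
have c : fcycle (@edge T) [:: x; edge x] by rewrite /= edgeK !eqxx.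
rewrite (order_cycle c) ?inE ?eqxx //=.
by rewrite inE eq_sym edge_neq.
Qed.

Lemma fcard_edge : fcard (@edge T) (dart T) * 2 = #|dart T|.
Proof.
apply: (fcard_order_set (can_inj (@edgeK T))) => //.
by apply/subsetP => x _; rewrite inE order_edge.
Qed.

Hypothesis irr : irreducible_triangulation T.

Lemma card_outer_face : #|outer_face T| = 4.
Proof.
rewrite /outer_face cardsE (card_uniqP _) ?size_orbit ?orbit_uniq //.
by case: irr.
Qed.

Lemma outer_face_closed : fclosed (@face T) (mem (outer_face T)).
Proof. by move=> x y /eqP <-; rewrite outer_face_face. Qed.

(** With [D] darts there are [D / 2] edges and [1 + (D - 4) / 3] faces, the outer one being a
    quadrangle and the others triangles. *)
Lemma card_darts : #|dart T| + 14 = 6 * #|vertex T|.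
Proof.
have e := euler T; have f2 := fcard_edge.
have f1 : fcard (@face T) (mem (outer_face T)) * 4 = 4.
  rewrite -[RHS]card_outer_face; apply: (fcard_order_set (@face_inj T)).
    apply/subsetP => x; rewrite inE -fconnect_orbit => c; rewrite inE.
    have o4 : order (@face T) (outer T) = 4 by case: irr.
    rewrite -[X in _ == X]o4; apply/eqP/eq_card => y.
    by rewrite -!topredE /= (same_connect (fconnect_sym (@face_inj T)) c).
  exact: outer_face_closed.
have f3 : fcard (@face T) [predC outer_face T] * 3 = #|[predC outer_face T]|.
  apply: (fcard_order_set (@face_inj T)).
    by case: irr => _ _ o3 _; apply/subsetP => x ox; rewrite inE o3.
  by apply: predC_closed; exact: outer_face_closed.
have cC : 4 + #|[predC outer_face T]| = #|dart T|.
  by rewrite -card_outer_face; exact: (cardC (mem (outer_face T))).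
have e' : fcard (@turn T \o @edge T) (dart T) =
   fcard (@face T) (mem (outer_face T)) + fcard (@face T) [predC outer_face T].
  exact: (n_compC (mem (outer_face T)) (frel (@face T))).
rewrite {}e' in e.
have {}f1 : fcard (@face T) (mem (outer_face T)) = 1 by lia.
rewrite f1 in e; move: f3 cC e f2.
set c := fcard _ [predC _]; set c' := #|[predC _]|; set d := fcard _ _.
lia.
Qed.
End Euler.

Lemma card_leftmost (T : plane_graph) (Q : transversal_pair T) (irr : irreducible_triangulation T) : #|leftmost Q|.+1 = #|vertex T|.
Proof.
rewrite -[in RHS]cardsT (cardsD1 (vN T)) inE add1n; congr _.+1.
rewrite -(card_in_imset (f := @org T)); last first.
  by move=> x y hx hy; apply: leftmost_uniq irr _ _ hx hy.
apply: eq_card => v; rewrite !inE andbT; apply/imsetP/idP => [[x hx ->]|].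
  exact: leftmost_root irr _ hx.
by case/(leftmost_ex Q irr) => p hp <-; exists p.
Qed.

(** Half of the darts of the red map are ingoing, and each of these is either counted or the reverse
    of a leftmost edge. *)
Lemma card_in_red (U : plane_graph) (Q : transversal_pair U) : irreducible_triangulation U ->
  #|in_red Q| = 2 * (n_counted Q + #|leftmost Q|).
Proof.
move=> irrU.
pose A := [set x | in_red Q x && ~~ ot Q x]; pose B := [set x | in_red Q x && ot Q x].
have cB : #|B| = #|A|.
  rewrite -(card_imset _ (can_inj (@edgeK U))); apply: eq_card => x.
  apply/imsetP/idP => [[y]|]; rewrite !inE.
    by case/andP=> ry oy ->; rewrite in_red_edge // ry ot_edge // oy.
  case/andP=> rx ox; exists (edge x); last by rewrite edgeK.
  by rewrite inE in_red_edge // rx ot_edge // ox.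
have -> : #|in_red Q| = #|A| + #|B|.
  rewrite -cardsUI (_ : A :&: B = set0) ?cards0 ?addn0; last first.
    by apply/setP => x; rewrite !inE; case: (ot Q x); rewrite ?andbF.
  by apply: eq_card => x; rewrite !inE -[x \in in_red Q]/(in_red Q x); case: (in_red Q x) (ot Q x) => [] [].
rewrite cB addnn -mul2n; congr (2 * _).
pose C := [set x | counted Q x]; pose L := [set x | leftmost Q (edge x)].
have cL : #|L| = #|leftmost Q|.
  rewrite -(card_imset _ (can_inj (@edgeK U))); apply: eq_card => x.
  apply/imsetP/idP => [[y]|hx]; first by rewrite inE => hy ->.
  by exists (edge x); rewrite ?inE edgeK.
have cC : #|C| = n_counted Q by rewrite /C cardsE.
rewrite -cL -cC -cardsUI (_ : C :&: L = set0) ?cards0 ?addn0; last first.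
  by apply/setP => x; rewrite !inE /counted; case: (leftmost Q (edge x)); rewrite ?andbF.
apply: eq_card => x; rewrite !inE /counted.
case h: (leftmost Q (edge x)); rewrite ?andbT ?andbF ?orbT ?orbF //.
rewrite -in_red_edge // (leftmost_in_red irrU h) /= -[x]edgeK ot_edge //.
by rewrite (leftmost_ot h).
Qed.

(** * Monotonicity, half-perimeter and injectivity of the coordinates *)

Section Coordinates.
Variables (T : plane_graph) (P : transversal_pair T).
Hypothesis irr : irreducible_triangulation T.
Implicit Types (x y e : dart T) (u v : vertex T).
Local Notation X := (compact_x P).
Local Notation Y := (compact_y P).
Local Notation P' := (rotate_pair irr P).
Let irr' := irreducible_rotate irr.

Lemma compact_x_le u v : height P v <= height P u -> X u <= X v.
Proof. by move=> le; apply: compress_le; rewrite !transversal_xE // leq_sub2l. Qed.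

Lemma compact_x_lt u v : height P v < height P u -> X u < X v.
Proof.
move=> lt; apply: compress_lt; rewrite !transversal_xE //.
by rewrite ltn_sub2l //; apply: leq_trans lt _; exact: height_le_counted.
Qed.

Lemma compact_y_le u v : height P' u <= height P' v -> Y u <= Y v.
Proof. by move=> le; apply: compress_le; rewrite !(transversal_yE irr). Qed.

Lemma compact_y_lt u v : height P' u < height P' v -> Y u < Y v.
Proof. by move=> le; apply: compress_lt; rewrite !(transversal_yE irr). Qed.

Lemma red_direction e : ot P e -> rd P e ->
  X (org e) <= X (org (edge e)) /\ Y (org e) < Y (org (edge e)).
Proof.
move=> oe re; split; first by apply: compact_x_le; exact: height_out.
(* After the quarter turn [edge e] is outgoing blue, which makes the inequality strict. *)
apply: compact_y_lt; have := cls_rotate irr P (edge e).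
rewrite ot_edge // rd_edge // oe re => -[o r].
rewrite -{1}[e]edgeK; exact: (@height_blue _ P' irr' (edge e) o (negbT r)).
Qed.

Lemma blue_direction e : ot P e -> ~~ rd P e ->
  X (org e) < X (org (edge e)) /\ Y (org (edge e)) <= Y (org e).
Proof.
move=> oe re; split; first by apply: compact_x_lt; exact: height_blue.
apply: compact_y_le; have := cls_rotate irr P e.
rewrite oe (negPf re) => -[o r].
exact: (@height_out _ P' irr' e o).
Qed.

Lemma corners : [/\ X (vS T) = 0, X (vW T) = 0, Y (vE T) = 0 & Y (vS T) = 0] /\
  forall v, [/\ X v <= X (vN T), X v <= X (vE T), Y v <= Y (vN T) & Y v <= Y (vW T)].
Proof.
have z0 (z : vertex T -> nat) u : z u = 0 -> compress z u = 0 by rewrite /compress => ->.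
split; first split.
- by apply: z0; rewrite transversal_xE // height_S // subnn.
- by apply: z0; rewrite transversal_xE // height_W // subnn.
- by apply: z0; rewrite (transversal_yE irr); exact: (height_N P').
- by apply: z0; rewrite (transversal_yE irr); exact: (@height_E _ P' irr').
move=> v; split.
- by apply: compact_x_le; rewrite height_N.
- by apply: compact_x_le; rewrite height_E.
- apply: compact_y_le; rewrite -(vW_rotate irr) (height_W P' irr').
  exact: height_le_counted.
apply: compact_y_le; rewrite -[vW T]/(vS (rotate T)) (height_S P' irr').
exact: height_le_counted.
Qed.




(** The two maps share the eight outer darts only. So with [n] and [n'] counted darts, [V] vertices
    and [D] darts, [2 * (n + n' + 2 * (V - 1)) = D + 8], where [D = 6 * V - 14]. *)
Lemma n_counted_sum : n_counted P + n_counted P' = #|vertex T| - 1.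
Proof.
have e1 := card_in_red P irr; have e2 := card_in_red P' irr'.
have l1 := card_leftmost P irr; have l2 := card_leftmost P' irr'.
have e3 : #|in_red P| + #|in_red P'| = #|dart T| + 8.
  have hU x : in_red P x || in_red P' x.
    by rewrite in_red_rotate /in_red /in_blue; case: (inner_edge x) (red P x) => [] [].
  have hI x : in_red P x && in_red P' x = (x \in eight T).
    rewrite in_red_rotate -[RHS]negbK -(inner_eight irr) /in_red /in_blue.
    by case: (inner_edge x) (red P x) => [] [].
  rewrite -(cardUI (in_red P) (in_red P')); congr (_ + _).
    by apply: eq_card => x; rewrite inE; exact: hU.
  rewrite -[8]/(size (eight T)) -(card_uniqP (eight_uniq irr)).
  by apply: eq_card => x; rewrite inE; exact: hI.
have := card_darts irr; have l2' : #|leftmost P'|.+1 = #|vertex T| := l2.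
lia.
Qed.

Lemma compact_half_perimeter : half_perimeter X Y <= #|vertex T| - 1.
Proof.
rewrite -n_counted_sum; apply: leq_add; apply/bigmax_leqP => v _.
  by apply: leq_trans (compress_bound _ _) _; rewrite transversal_xE // leq_subr.
apply: leq_trans (compress_bound _ _) _; rewrite (transversal_yE irr).
exact: height_le_counted.
Qed.

Definition lex_before u v := X u < X v \/ X u = X v /\ Y u < Y v.

Lemma lex_out e : ot P e -> lex_before (org e) (org (edge e)).
Proof.
move=> oe; have [re|re] := boolP (rd P e).
  have [l1 l2] := red_direction oe re; rewrite /lex_before; lia.
by left; case: (blue_direction oe re).
Qed.

Lemma connect_lex (r : rel (vertex T)) u v :
  (forall a b, r a b -> lex_before a b) -> connect r u v -> u = v \/ lex_before u v.
Proof.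
move=> h /connectP [p]; elim: p u => [|w p IH] u /=; first by left.
case/andP=> /h uw pp /(IH _ pp) [<-|wv]; first by right.
by right; rewrite /lex_before in uw wv *; lia.
Qed.

(** With equal heights, no counted dart is met between the two entries, hence no face of the red map
    has its rank there. *)
Lemma height_rank u v y : height P u = height P v -> entry P u <= entry P v ->
  (rank P y <= entry P u) = (rank P y <= entry P v).
Proof.
move=> e le; apply/idP/idP => [l|]; first exact: leq_trans l le.
rewrite /rank; case: ifP => iy; first by case: ifP => // _; have := entry_lt_card P irr v; lia.
have [hb rb _] := bottomP P irr (negbT iy) => lt.
have c : counted P (edge (bottom P y)).
  case/andP: (hb) => ob nh.
  by rewrite /counted in_red_edge // rb ot_edge // ob edgeK.
have sub : [pred q | counted P q & pos P q < entry P u] \subset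
           [pred q | counted P q & pos P q < entry P v].
  by apply/subsetP => q; rewrite !inE => /andP[-> l]; exact: leq_trans l le.
have := subset_cardP e sub => /(_ (edge (bottom P y))).
by rewrite !inE c lt.
Qed.

Lemma sep_path_height u v e : height P u = height P v ->
  sep_path (in_red P) (out_red P) u e -> sep_path (in_red P) (out_red P) v e.
Proof.
move=> eh /(sep_path_crossing irr) [re oe /andP[l1 l2]].
apply: crossing_sep_path => //; rewrite ltnNge in l2; rewrite ltnNge.
have [le|/ltnW le] := leqP (entry P u) (entry P v).
  by rewrite -!(height_rank _ eh le) l1 l2.
by rewrite !(height_rank _ (esym eh) le) l1 l2.
Qed.

(** Equal abscissas give equal heights, hence equal separating paths. The leftmost edge of [v],
    which exists once [v] is not N, is then on the path of [u], so [u] and [v] are joined by a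
    directed path, along which [lex_before] holds. *)
Lemma compact_inj u v : X u = X v -> Y u = Y v -> u = v.
Proof.
move=> eX eY; have eh : height P u = height P v.
  have := compress_eq eX; rewrite !transversal_xE //.
  have := height_le_counted P u; have := height_le_counted P v; lia.
have nlex a b : X a = X b -> Y a = Y b -> lex_before a b -> False.
  by rewrite /lex_before; lia.
wlog vN : u v eX eY eh / v != vN T.
  move=> h; have [ev|] := eqVneq v (vN T); last exact: h.
  have [eu|] := eqVneq u (vN T); first by rewrite eu ev.
  by move/h => /(_ v (esym eX) (esym eY) (esym eh)).
have [p hp ep] := leftmost_ex P irr vN.
have : sep_path (in_red P) (out_red P) v p.
  by rewrite sep_pathE // hp ep connect0.
move/(sep_path_height (esym eh)); rewrite sep_pathE // => /orP[/andP[_]|/andP[fp]] c.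
  rewrite ep in c; have [|//|] := @connect_lex (up P) u v _ c.
    by move=> a b /existsP[x /and3P[hx /eqP <- /eqP <-]]; apply: lex_out; exact: leftmost_ot.
  by move/(nlex _ _ eX eY).
have cd : connect (down P) u v.
  apply: connect_trans c _; apply: connect1; apply/existsP; exists (edge p).
  by rewrite fp edgeK ep !eqxx.
have : connect [rel a b | down P b a] v u by rewrite connect_rev.
case/connect_lex => [a b /existsP[x /and3P[fx /eqP <- /eqP <-]]|//|].
  rewrite -{2}[x]edgeK; apply: lex_out; rewrite ot_edge //; by case/andP: fx.
by move/(nlex _ _ (esym eX) (esym eY)).
Qed.

End Coordinates.

(** * Sweeping a drawing by a vertical line *)

Import Order.TTheory GRing.Theory Num.Theory.

Section Sweep.
Local Open Scope ring_scope.
Variables (T : plane_graph) (R : realFieldType) (pos : vertex T -> R * R).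
Hypothesis irr : irreducible_triangulation T.
Implicit Types (x y d e : dart T) (u v : vertex T).

Local Notation X v := (pos v).1.
Local Notation Y v := (pos v).2.
Local Notation tail d := (org d).
Local Notation tip d := (org (edge d)).

Definition area (p q r : R * R) := (q.1 - p.1) * (r.2 - p.2) - (q.2 - p.2) * (r.1 - p.1).

(** All that the sweep requires: inner triangles keep their orientation, at most one outer dart goes
    rightwards, and an outer dart pointing vertically down is on the right border. The record is
    also satisfied by the half-turned drawing. *)
Record convex_drawing : Prop := ConvexDrawing {
  area_gt0 : forall x, x \notin outer_face T ->
    0 < area (pos (tail x)) (pos (tip x)) (pos (tip (face x)));
  top_edge : exists top, forall d, d \in outer_face T -> X (tail d) < X (tip d) -> d = top;
  right_edge : forall d, d \in outer_face T -> X (tail d) = X (tip d) ->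
    Y (tip d) < Y (tail d) -> forall v, X v <= X (tail d) }.

Hypothesis good : convex_drawing.

Variable x0 : R.

(** Half-open, so that at a vertex on the line only the edges leaving to the right count. The line
    then splits the vertices into two classes, and each triangle has either two crossing edges or
    none. *)
Definition crosses d := (X (tail d) <= x0) && (x0 < X (tip d)).
Definition slope d := (Y (tip d) - Y (tail d)) / (X (tip d) - X (tail d)).
Definition ordinate d := Y (tail d) + (x0 - X (tail d)) * slope d.
(** The other crossing edge of the triangle on the left of [d], directed rightwards again; a dart
    below the outer face is a fixed point. *)
Definition above d :=
  if d \in outer_face T then d
  else if X (tail (face (face d))) <= x0 then edge (face d) else edge (face (face d)).

Lemma crosses_lt d : crosses d -> X (tail d) < X (tip d).
Proof. by case/andP; apply: le_lt_trans. Qed.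

Lemma slopeK d : X (tail d) < X (tip d) ->
  slope d * (X (tip d) - X (tail d)) = Y (tip d) - Y (tail d).
Proof. by move=> lt; rewrite divfK // subr_eq0 gt_eqF. Qed.

Lemma tip_face2 d : d \notin outer_face T -> tip (face (face d)) = tail d.
Proof. by move=> id; rewrite -org_face face3. Qed.

(** The two crossing edges of a triangle share an endpoint, and the orientation of the triangle
    compares their slopes. If they share the tip, which is strictly to the right of the line, the
    ordinates differ. *)
Lemma above_spec d : crosses d -> d \notin outer_face T ->
  crosses (above d) /\
  (ordinate d < ordinate (above d) \/
   [/\ ordinate d = ordinate (above d), tail (above d) = tail d, X (tail d) = x0
     & slope d < slope (above d)]).
Proof.
move=> cd id; have ar := area_gt0 good id; have /andP[l1 l2] := cd.
have ld := crosses_lt cd; have sd := slopeK ld.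
rewrite /above (negPf id); case: (leP (X (tail (face (face d)))) x0) => lc.
  have ce : crosses (edge (face d)) by rewrite /crosses -org_face lc edgeK org_face l2.
  have se := slopeK (crosses_lt ce); split=> //; left.
  have le := crosses_lt ce; rewrite edgeK !org_face -(org_face (face d)) in se le.
  rewrite /area -(org_face (face d)) in ar; rewrite /ordinate -(org_face (face d)).
  move: (slope d) (slope (edge (face d))) (pos (tail d)) (pos (tip d)) (pos (tail (face (face d)))) ar l1 l2 lc ld sd se le.
  move=> s s' [xa ya] [xb yb] [xc yc] /= ar l1 l2 lc ld sd se le.
  have lt : s' < s.
    have e : (s - s') * ((xb - xa) * (xb - xc)) = (xb - xa) * (yc - ya) - (yb - ya) * (xc - xa).
      have -> : yb = ya + s * (xb - xa) by rewrite sd; ring.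
      have -> : yc = yb - s' * (xb - xc) by rewrite se; ring.
      have -> : yb = ya + s * (xb - xa) by rewrite sd; ring.
      ring.
    have pp : 0 < (xb - xa) * (xb - xc) by apply: mulr_gt0; rewrite subr_gt0.
    by rewrite -subr_gt0 -(pmulr_lgt0 _ pp) e.
  have -> : ya = yb - s * (xb - xa) by rewrite sd; ring.
  have -> : yc = yb - s' * (xb - xc) by rewrite se; ring.
  have := mulr_gt0 (_ : 0 < s - s') (_ : 0 < xb - x0); rewrite !subr_gt0 => /(_ lt l2).
  lra.
(* Now the edges share their tail. If it lies on the line the ordinates are equal and only the
   slopes differ. *)
have ce : crosses (edge (face (face d))).
  by rewrite /crosses tip_face2 // edgeK l1 lc.
have le := crosses_lt ce; have se := slopeK le; split=> //.
rewrite edgeK tip_face2 // in se le.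
rewrite /area -(org_face (face d)) in ar; rewrite /ordinate tip_face2 //.
move: (slope d) (slope (edge (face (face d)))) (pos (tail d)) (pos (tip d)) (pos (tail (face (face d)))) ar l1 l2 lc ld sd se le.
move=> s s' [xa ya] [xb yb] [xc yc] /= ar l1 l2 lc ld sd se le.
have lt : s < s'.
  have e : (s' - s) * ((xb - xa) * (xc - xa)) = (xb - xa) * (yc - ya) - (yb - ya) * (xc - xa).
    by rewrite -sd -se; ring.
  have pp : 0 < (xb - xa) * (xc - xa) by apply: mulr_gt0; rewrite subr_gt0.
  by rewrite -subr_gt0 -(pmulr_lgt0 _ pp) e.
move: l1; rewrite le_eqVlt => /orP[/eqP ex|l1].
  by right; split=> //; rewrite ex subrr !mul0r.
left; rewrite ltrD2l ltr_pM2l //; by rewrite subr_gt0.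
Qed.

(** Comparing slopes when the ordinates are equal orders the edges that leave a vertex of the line,
    so that [above] is strictly increasing. *)
Definition lower d e := (ordinate d < ordinate e) ||
  (ordinate d == ordinate e) && (slope d < slope e).

Lemma lower_above d : crosses d -> d \notin outer_face T -> lower d (above d).
Proof.
move=> cd id; rewrite /lower; case: (above_spec cd id) => _ [->//|[-> _ _ ->]].
by rewrite eqxx orbT.
Qed.

Lemma lower_trans : transitive lower.
Proof.
move=> b a c; rewrite /lower => /orP[h1|/andP[/eqP h1 h2]] /orP[h3|/andP[/eqP h3 h4]].
- by rewrite (lt_trans h1 h3).
- by rewrite -h3 h1.
- by rewrite h1 h3.
by rewrite h1 h3 eqxx (lt_trans h2 h4) orbT.
Qed.

Lemma lower_irr d : lower d d = false.
Proof. by rewrite /lower !ltxx andbF. Qed.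

Lemma reach_outer d : crosses d -> exists n,
  [/\ iter n above d \in outer_face T, crosses (iter n above d)
    & forall k, (k < n)%N -> iter k above d \notin outer_face T].
Proof.
have [n] := ubnP #|[pred e | crosses e && lower d e]|; elim: n d => // n IH d lt cd.
have [o|id] := boolP (d \in outer_face T); first by exists 0.
have [ca _] := above_spec cd id; have la := lower_above cd id.
have [|m [h1 h2 h3]] := IH (above d) _ ca.
  rewrite ltnS in lt; apply: leq_trans lt; apply: proper_card; apply/properP; split.
    by apply/subsetP => e; rewrite !inE => /andP[-> l]; exact: lower_trans la l.
  by exists (above d); rewrite inE ca ?la // lower_irr.
exists m.+1; rewrite iterSr; split=> // -[|k] // lk; rewrite iterSr; exact: h3.
Qed.

Lemma above_inj d e : crosses d -> crosses e -> d \notin outer_face T -> e \notin outer_face T ->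
  above d = above e -> d = e.
Proof.
move=> cd ce id ie; rewrite /above (negPf id) (negPf ie).
have bad d' e' : crosses d' -> crosses e' -> d' = face e' -> False.
  by move=> /andP[l _] /andP[_ l'] e1; move: l; rewrite e1 org_face leNgt l'.
case: ifP => _; case: ifP => _ /(can_inj (@edgeK T)) /(@face_inj T) //.
- by move/(bad _ _ cd ce).
- by move/esym/(bad _ _ ce cd).
exact: face_inj.
Qed.

Lemma iter_crosses n d : crosses d ->
  (forall k, (k < n)%N -> iter k above d \notin outer_face T) -> crosses (iter n above d).
Proof.
move=> cd; elim: n => //= n IH h; have c := IH (fun k l => h k (ltnW l)).
by case: (above_spec c (h n (ltnSn n))).
Qed.

Lemma iter_above_inj n d e : crosses d -> crosses e ->
  (forall k, (k < n)%N -> iter k above d \notin outer_face T) ->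
  (forall k, (k < n)%N -> iter k above e \notin outer_face T) ->
  iter n above d = iter n above e -> d = e.
Proof.
elim: n d e => // n IH d e cd ce hd he; rewrite !iterSr => eq.
have id := hd 0%N isT; have ie := he 0%N isT.
apply: above_inj => //; apply: IH => //.
- by case: (above_spec cd id).
- by case: (above_spec ce ie).
- by move=> k lk; rewrite -iterSr; exact: hd.
by move=> k lk; rewrite -iterSr; exact: he.
Qed.

(** Both chains end at the unique outer dart that goes rightwards, and [above] is injective on inner
    crossings, so the shorter chain is the end of the longer one. *)
Lemma comparable_crossings d e : crosses d -> crosses e ->
  exists k, e = iter k above d \/ d = iter k above e.
Proof.
move=> cd ce; have [top htop] := top_edge good.
have [m [m1 m2 m3]] := reach_outer cd; have [n [n1 n2 n3]] := reach_outer ce.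
have em := htop _ m1 (crosses_lt m2); have en := htop _ n1 (crosses_lt n2).
wlog le : d e m n cd ce m1 m2 m3 n1 n2 n3 em en / (m <= n)%N.
  move=> h; case: (leqP m n) => [le|/ltnW le].
    exact: (h d e m n cd ce m1 m2 m3 n1 n2 n3 em en le).
  have [k [e1|e1]] := h e d n m ce cd n1 n2 n3 m1 m2 m3 en em le.
    by exists k; right.
  by exists k; left.
exists (n - m)%N; right; apply: (@iter_above_inj m) => //.
- by apply: iter_crosses => // k lk; apply: n3; lia.
- by move=> k lk; rewrite -iterD; apply: n3; lia.
by rewrite -iterD subnKC // em en.
Qed.

Lemma above_outer d : d \in outer_face T -> above d = d.
Proof. by rewrite /above => ->. Qed.

Lemma iter_above_spec k d : crosses d -> crosses (iter k above d) /\
  (iter k above d = d \/ ordinate d < ordinate (iter k above d) \/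
   [/\ ordinate d = ordinate (iter k above d), tail (iter k above d) = tail d
     & X (tail d) = x0]).
Proof.
move=> cd; elim: k => [|k [c h]] /=; first by split=> //; left.
have [o|i] := boolP (iter k above d \in outer_face T); first by rewrite above_outer.
have [c' h'] := above_spec c i; split=> //; right.
case: h => [e|[l|[e1 e2 e3]]].
- by move: h'; rewrite e => -[l|[<- <- -> _]]; [left | right].
- by left; case: h' => [|[<- _ _ _]] //; exact: lt_trans l.
by case: h' => [l|[<- -> _ _]]; [left; rewrite e1 | right].
Qed.


Lemma same_ordinate d e : crosses d -> crosses e -> ordinate d = ordinate e -> d <> e ->
  tail d = tail e /\ X (tail d) = x0.
Proof.
move=> cd ce eq ne; have [k [e1|e1]] := comparable_crossings cd ce.
  have [_ h] := iter_above_spec k cd; move: h; rewrite -e1 eq ltxx.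
  by case=> [e2|[//|[_ -> ->]]] //; case: ne.
have [_ h] := iter_above_spec k ce; move: h; rewrite -e1 eq ltxx.
by case=> [e2|[//|[_ -> ->]]] //; case: ne.
Qed.

Lemma ordinate_iter_above k d : crosses d -> ordinate d <= ordinate (iter k above d).
Proof.
move=> cd; have [_ [->//|[/ltW//|[-> _ _]]]] := iter_above_spec k cd; exact: lexx.
Qed.

Lemma crossings_cases d e : crosses d -> crosses e -> 
  d \notin outer_face T -> e \notin outer_face T ->
  [\/ d = e, ordinate (above d) <= ordinate e | ordinate (above e) <= ordinate d].
Proof.
move=> cd ce id ie; have [cad _] := above_spec cd id; have [cae _] := above_spec ce ie.
have [[|k] [e1|e1]] := comparable_crossings cd ce; [by constructor 1|by constructor 1| |].
  by constructor 2; rewrite e1 iterSr; exact: ordinate_iter_above.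
by constructor 3; rewrite e1 iterSr; exact: ordinate_iter_above.
Qed.

Lemma crossings_weak d e : crosses d -> crosses e -> d \notin outer_face T ->
  ordinate e <= ordinate d \/ ordinate (above d) <= ordinate e.
Proof.
move=> cd ce id; have [cad _] := above_spec cd id.
have [[|k] [e1|e1]] := comparable_crossings cd ce.
- by left; rewrite e1; exact: lexx.
- by left; rewrite e1; exact: lexx.
- by right; rewrite e1 iterSr; exact: ordinate_iter_above.
by left; rewrite e1; exact: ordinate_iter_above.
Qed.

Lemma segment_fst (p q r : R * R) : p.1 <= q.1 -> on_segment p q r -> p.1 <= r.1 <= q.1.
Proof. by move=> le [t /andP[t0 t1] ->] /=; apply/andP; split; nra. Qed.

Lemma segment_snd (p q r : R * R) : p.2 <= q.2 -> on_segment p q r -> p.2 <= r.2 <= q.2.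
Proof. by move=> le [t /andP[t0 t1] ->] /=; apply/andP; split; nra. Qed.

Lemma segment_ordinate d (r : R * R) : X (tail d) < X (tip d) ->
  on_segment (pos (tail d)) (pos (tip d)) r -> r.1 = x0 -> r.2 = ordinate d.
Proof.
move=> lt [t _ ->] /= e; rewrite /ordinate; have sd := slopeK lt.
have -> : Y (tip d) = Y (tail d) + slope d * (X (tip d) - X (tail d)) by rewrite sd; ring.
by rewrite -e; ring.
Qed.

Definition upright x := X (tail x) = x0 /\ X (tip x) = x0 /\ Y (tail x) < Y (tip x).

(** A vertical edge crosses no line in the above sense. The triangle on its right replaces it: its
    other two sides are consecutive in the chain and start at the two ends of [x]. *)
Lemma upright_triangle x : upright x -> edge x \notin outer_face T ->
  [/\ crosses (turn x), turn x \notin outer_face T, tail (turn x) = tail x,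
      tail (above (turn x)) = tip x & crosses (above (turn x))] /\
  ordinate (turn x) = Y (tail x) /\ ordinate (above (turn x)) = Y (tip x).
Proof.
case=> e1 [e2 lt] ie; have it : turn x \notin outer_face T by rewrite -edge_outer_turn.
have ar := area_gt0 good ie; rewrite edgeK face_edge in ar.
have c : crosses (turn x).
  rewrite /crosses org_turn1 e1 lexx /=; move: ar; rewrite /area e1 e2.
  set c := tip _; nra.
have f3 : face (face (turn x)) = edge x by rewrite -face_edge face3.
have [ca _] := above_spec c it.
have ta : tail (above (turn x)) = tip x.
  by rewrite /above (negPf it) f3 e2 lexx -org_face f3.
split; first by rewrite org_turn1.
split; first by rewrite /ordinate org_turn1 e1 subrr mul0r addr0.
by rewrite /ordinate ta e2 subrr mul0r addr0.
Qed.

Definition shared x y (p : R * R) := exists v,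
  [/\ v \in [:: tail x; tip x], v \in [:: tail y; tip y] & p = pos v].

Hypothesis pos_inj : injective pos.

Lemma crossing_shared x y p : crosses x -> crosses y -> x <> y -> p.1 = x0 ->
  on_segment (pos (tail x)) (pos (tip x)) p ->
  on_segment (pos (tail y)) (pos (tip y)) p -> shared x y p.
Proof.
move=> cx cy ne ep sx sy.
have ox := segment_ordinate (crosses_lt cx) sx ep.
have oy := segment_ordinate (crosses_lt cy) sy ep.
have [et e0] := same_ordinate cx cy (etrans (esym ox) oy) ne.
exists (tail x); rewrite -et !inE !eqxx; split=> //.
apply/eqP; rewrite -pair_eqE /= ep e0 eqxx /=.
by rewrite ox /ordinate e0 subrr mul0r addr0.
Qed.

Lemma upright_point x p : upright x -> p.1 = x0 -> p.2 = Y (tail x) -> p = pos (tail x).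
Proof. by case=> e1 _ e2 e3; apply/eqP; rewrite -pair_eqE /= e1 e2 e3 !eqxx. Qed.
Lemma upright_point' x p : upright x -> p.1 = x0 -> p.2 = Y (tip x) -> p = pos (tip x).
Proof. by case=> _ [e1 _] e2 e3; apply/eqP; rewrite -pair_eqE /= e1 e2 e3 !eqxx. Qed.

(** No crossing edge passes strictly between two consecutive ones of the chain, so [p] is an end of
    [x], and [y] starts there. *)
Lemma upright_crossing_shared x y p : upright x -> edge x \notin outer_face T ->
  crosses y -> p.1 = x0 ->
  on_segment (pos (tail x)) (pos (tip x)) p ->
  on_segment (pos (tail y)) (pos (tip y)) p -> shared x y p.
Proof.
move=> ux ie cy ep sx sy; have [[c1 i1 t1 t2 c2] [o1 o2]] := upright_triangle ux ie.
have oy := segment_ordinate (crosses_lt cy) sy ep.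
have lt : Y (tail x) < Y (tip x) by case: ux => _ [].
have /andP[b1 b2] := segment_snd (ltW lt) sx.
have key d v : crosses d -> tail d = v -> v \in [:: tail x; tip x] -> p = pos v ->
    ordinate d = ordinate y -> shared x y p.
  move=> cd td vx pv eq; exists v; split=> //.
  have [<-|/eqP ne] := eqVneq d y; first by rewrite td inE eqxx.
  by have [<- _] := same_ordinate cd cy eq ne; rewrite td inE eqxx.
have [le|le] := crossings_weak c1 cy i1.
  have e2 : p.2 = Y (tail x) by apply/eqP; rewrite eq_le b1 andbT -o1 oy.
  apply: (key (turn x) (tail x)) => //; first by rewrite inE eqxx.
    exact: upright_point.
  by rewrite o1 -e2.
have e2 : p.2 = Y (tip x) by apply/eqP; rewrite eq_le b2 -o2 oy.
apply: (key (above (turn x)) (tip x)) => //; first by rewrite !inE eqxx orbT.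
  exact: upright_point'.
by rewrite o2 -e2.
Qed.

Lemma upright_shared x y p : upright x -> edge x \notin outer_face T ->
  upright y -> edge y \notin outer_face T -> x <> y -> p.1 = x0 ->
  on_segment (pos (tail x)) (pos (tip x)) p ->
  on_segment (pos (tail y)) (pos (tip y)) p -> shared x y p.
Proof.
move=> ux ix uy iy ne ep sx sy.
have [[c1 i1 t1 t2 c2] [o1 o2]] := upright_triangle ux ix.
have [[c3 i3 t3 t4 c4] [o3 o4]] := upright_triangle uy iy.
have ltx : Y (tail x) < Y (tip x) by case: ux => _ [].
have lty : Y (tail y) < Y (tip y) by case: uy => _ [].
have /andP[b1 b2] := segment_snd (ltW ltx) sx.
have /andP[b3 b4] := segment_snd (ltW lty) sy.
case: (crossings_cases c1 c3 i1 i3) => [/turn_inj //|le|le].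
  rewrite o2 o3 in le.
  have e1 : p.2 = Y (tip x) by apply/eqP; rewrite eq_le b2 (le_trans le).
  have e2 : p.2 = Y (tail y) by apply/eqP; rewrite eq_le b3 andbT (le_trans b2).
  exists (tip x); split; [by rewrite !inE eqxx orbT| |exact: upright_point'].
  suff -> : tip x = tail y by rewrite inE eqxx.
  apply: pos_inj; rewrite -(upright_point' ux ep e1); exact: upright_point.
rewrite o4 o1 in le.
have e1 : p.2 = Y (tail x) by apply/eqP; rewrite eq_le b1 andbT (le_trans b4).
have e2 : p.2 = Y (tip y) by apply/eqP; rewrite eq_le b4 (le_trans le).
exists (tail x); split; [by rewrite inE eqxx| |exact: upright_point].
suff -> : tail x = tip y by rewrite !inE eqxx orbT.
apply: pos_inj; rewrite -(upright_point ux ep e1); exact: upright_point'.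
Qed.

End Sweep.

(** * Two edges meet only at a common endpoint *)

Section Noncrossing.
Local Open Scope ring_scope.
Variables (T : plane_graph) (R : realFieldType) (pos : vertex T -> R * R).
Hypothesis irr : irreducible_triangulation T.
Hypothesis good : convex_drawing pos.
Hypothesis good_opp : convex_drawing (fun v => - pos v).
Hypothesis pos_inj : injective pos.
Hypothesis wide : exists u v, (pos u).1 < (pos v).1.
Implicit Types (x y : dart T).

Local Notation X v := (pos v).1.
Local Notation Y v := (pos v).2.
Local Notation tail d := (org d).
Local Notation tip d := (org (edge d)).
Local Notation segment d := (on_segment (pos (tail d)) (pos (tip d))).

Lemma segment_opp x p : segment x p ->
  on_segment (- pos (tail (edge x))) (- pos (tip (edge x))) (- p).
Proof.
case=> t /andP[t0 t1] ->; exists (1 - t); first by apply/andP; split; lra.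
by rewrite edgeK; apply/eqP; rewrite -pair_eqE /=; apply/andP; split; apply/eqP; ring.
Qed.

Lemma segment_edge x p : segment x p -> segment (edge x) p.
Proof.
case=> t /andP[t0 t1] ->; exists (1 - t); first by apply/andP; split; lra.
by rewrite edgeK; apply/eqP; rewrite -pair_eqE /=; apply/andP; split; apply/eqP; ring.
Qed.

Lemma shared_sym x y p : shared pos x y p -> shared pos y x p.
Proof. by case=> v [h1 h2 h3]; exists v. Qed.

Lemma shared_edge x y p : shared pos (edge x) y p -> shared pos x y p.
Proof.
case=> v [h1 h2 h3]; exists v; split=> //.
by move: h1; rewrite edgeK !inE orbC.
Qed.

Lemma shared_opp x y p : shared (fun v => - pos v) (edge x) (edge y) (- p) -> shared pos x y p.
Proof.
case=> v [h1 h2 h3]; exists v; split; last exact: oppr_inj.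
  by move: h1; rewrite edgeK !inE orbC.
by move: h2; rewrite edgeK !inE orbC.
Qed.

Lemma opp_inj : injective (fun v => - pos v).
Proof. by move=> u v /oppr_inj /pos_inj. Qed.

Definition upward x := X (tail x) < X (tip x) \/ X (tail x) = X (tip x) /\ Y (tail x) < Y (tip x).

Lemma upward_cases x : upward x \/ upward (edge x).
Proof.
rewrite /upward edgeK; have := loopless x; case: (ltgtP (X (tail x)) (X (tip x))) => [|gt|e]; [by left; left|by right; left|].
case: (ltgtP (Y (tail x)) (Y (tip x))) => [|gt|e']; [by left; right|by right; right|].
move=> /eqP[]; apply: pos_inj; apply/eqP.
by rewrite -pair_eqE /= e e' !eqxx.
Qed.

Lemma segment_tip x p : X (tail x) < X (tip x) -> segment x p -> p.1 = X (tip x) -> p = pos (tip x).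
Proof.
move=> lt [t _ ->] /= e; have t1 : t = 1.
  apply/eqP; rewrite -subr_eq0; have : (1 - t) * (X (tip x) - X (tail x)) = 0 by lra.
  by move/eqP; rewrite mulf_eq0 [z in _ || z]subr_eq0 (gt_eqF lt) orbF -opprB oppr_eq0.
by apply/eqP; rewrite -pair_eqE /= t1; apply/andP; split; apply/eqP; ring.
Qed.

Lemma segment_tail x p : X (tail x) < X (tip x) -> segment x p -> p.1 = X (tail x) -> p = pos (tail x).
Proof.
move=> lt [t _ ->] /= e; have t0 : t = 0.
  apply/eqP; have : t * (X (tip x) - X (tail x)) = 0 by lra.
  by move/eqP; rewrite mulf_eq0 [z in _ || z]subr_eq0 (gt_eqF lt) orbF.
by apply/eqP; rewrite -pair_eqE /= t0; apply/andP; split; apply/eqP; ring.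
Qed.

(** Half-open crossings miss the tips. If [p] is the tip of one edge, either it is the tail of the
    other, or the sweep is applied after a half-turn, which exchanges tips and tails. *)
Lemma oblique_shared x y p : X (tail x) < X (tip x) -> X (tail y) < X (tip y) -> x <> y ->
  segment x p -> segment y p -> shared pos x y p.
Proof.
move=> lx ly ne sx sy.
have /andP[x1 x2] := segment_fst (ltW lx) sx.
have /andP[y1 y2] := segment_fst (ltW ly) sy.
have tipx : p.1 = X (tip x) -> shared pos x y p.
  move=> e; have ep := segment_tip lx sx e.
  move: (y1); rewrite le_eqVlt => /orP[/eqP e'|y1'].
    have ep' := segment_tail ly sy (esym e').
    exists (tip x); split=> //; first by rewrite !inE eqxx orbT.
    by rewrite (pos_inj (etrans (esym ep) ep')) inE eqxx.
  apply: shared_opp; apply: (crossing_shared irr good_opp (x0 := - p.1)) => //.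
  - by rewrite /crosses edgeK /= lerN2 ltrN2 x2 e lx.
  - by rewrite /crosses edgeK /= lerN2 ltrN2 y2 y1'.
  - by move/(can_inj (@edgeK T)).
  - exact: segment_opp.
  - exact: segment_opp.
move: (x2); rewrite le_eqVlt => /orP[/eqP/tipx//|x2'].
move: (y2); rewrite le_eqVlt => /orP[/eqP e|y2'].
  have ep := segment_tip ly sy e; move: (x1); rewrite le_eqVlt => /orP[/eqP e'|x1'].
    have ep' := segment_tail lx sx (esym e').
    exists (tail x); split=> //; first by rewrite !inE eqxx.
    by rewrite -(pos_inj (etrans (esym ep) ep')) !inE eqxx orbT.
  apply: shared_opp; apply: (crossing_shared irr good_opp (x0 := - p.1)) => //.
  - by rewrite /crosses edgeK /= lerN2 ltrN2 x2 x1'.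
  - by rewrite /crosses edgeK /= lerN2 ltrN2 y2 e ly.
  - by move/(can_inj (@edgeK T)).
  - exact: segment_opp.
  - exact: segment_opp.
by apply: (crossing_shared irr good (x0 := p.1)) => //; rewrite /crosses ?x1 ?y1.
Qed.

Lemma upright_opp x (x0 : R) : upright pos x0 x -> upright (fun v => - pos v) (- x0) (edge x).
Proof. by case=> e1 [e2 lt]; rewrite /upright edgeK /= e1 e2 ltrN2. Qed.

Lemma upright_inner x (x0 : R) v : upright pos x0 x -> x0 < X v -> edge x \notin outer_face T.
Proof.
case=> e1 [e2 lt] ltv; apply: contraTN ltv => o; rewrite -leNgt -e2.
by apply: (right_edge good o); rewrite edgeK ?e1 ?e2.
Qed.

Lemma upright_inner_opp x (x0 : R) v : upright pos x0 x -> X v < x0 -> x \notin outer_face T.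
Proof.
case=> e1 [e2 lt] ltv; apply: contraTN ltv => o; rewrite -leNgt -e1 -lerN2.
by apply: (right_edge good_opp o) => /=; rewrite ?e1 ?e2 ?ltrN2.
Qed.

Lemma upright_oblique_shared x y p : upright pos p.1 x -> X (tail y) < X (tip y) ->
  segment x p -> segment y p -> shared pos x y p.
Proof.
move=> ux ly sx sy; have /andP[y1 y2] := segment_fst (ltW ly) sy.
move: (y2); rewrite le_eqVlt => /orP[/eqP e|y2'].
  have lt : X (tail y) < p.1 by rewrite e.
  apply: shared_opp; apply: (upright_crossing_shared irr good_opp (x0 := - p.1)) => //.
  - exact: upright_opp.
  - by rewrite edgeK; exact: upright_inner_opp ux lt.
  - by rewrite /crosses edgeK /= lerN2 ltrN2 y2.
  - exact: segment_opp.
  - exact: segment_opp.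
apply: (upright_crossing_shared irr good (x0 := p.1)) => //.
- exact: upright_inner ux y2'.
by rewrite /crosses y1.
Qed.

(** By [wide] some vertex is off the line; on its side the vertical edges do not border the outer
    face, so their triangles on that side are available, possibly after a half-turn. *)
Lemma uprights_shared x y p : upright pos p.1 x -> upright pos p.1 y -> x <> y ->
  segment x p -> segment y p -> shared pos x y p.
Proof.
move=> ux uy ne sx sy; have [u [v uv]] := wide.
have [lt|ge] := ltP p.1 (X v).
  apply: (upright_shared irr good (x0 := p.1)) => //.
  - exact: upright_inner ux lt.
  - exact: upright_inner uy lt.
have lt := lt_le_trans uv ge.
apply: shared_opp; apply: (upright_shared irr good_opp (x0 := - p.1)) => //.
- exact: opp_inj.
- exact: upright_opp.
- by rewrite edgeK; exact: upright_inner_opp ux lt.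
- exact: upright_opp.
- by rewrite edgeK; exact: upright_inner_opp uy lt.
- by move/(can_inj (@edgeK T)).
- exact: segment_opp.
- exact: segment_opp.
Qed.

Lemma upright_of x p : X (tail x) = X (tip x) -> Y (tail x) < Y (tip x) -> segment x p ->
  upright pos p.1 x.
Proof.
by move=> e lt [t _ ->]; rewrite /upright /= e; split; [ring | split; [ring|]].
Qed.

Lemma upward_shared x y p : upward x -> upward y -> x <> y ->
  segment x p -> segment y p -> shared pos x y p.
Proof.
move=> [lx|[ex lx]] [ly|[ey ly]] ne sx sy.
- exact: oblique_shared.
- by apply: shared_sym; apply: upright_oblique_shared => //; exact: upright_of.
- by apply: upright_oblique_shared => //; exact: upright_of.
by apply: uprights_shared => //; exact: upright_of.
Qed.

Lemma noncrossing x y p : y <> x -> y <> edge x -> segment x p -> segment y p -> shared pos x y p.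
Proof.
move=> n1 n2 sx sy; have sx' := segment_edge sx; have sy' := segment_edge sy.
have [ux|ux] := upward_cases x; have [uy|uy] := upward_cases y.
- by apply: upward_shared => // /esym.
- apply: shared_sym; apply: shared_edge; apply: shared_sym; apply: upward_shared => // e.
  by apply: n2; rewrite e edgeK.
- by apply: shared_edge; apply: upward_shared => // /esym.
apply: shared_edge; apply: shared_sym; apply: shared_edge; apply: shared_sym.
by apply: upward_shared => // /(can_inj (@edgeK T)) /esym.
Qed.

End Noncrossing.

(** * The drawing *)

Section VertexOrder.
Variables (T : plane_graph) (P : transversal_pair T).
Hypothesis irr : irreducible_triangulation T.
Implicit Types (x y : dart T).
Local Notation oN := (dartN T).
Local Notation oE := (dartE T).
Local Notation oS := (dartS T).
Local Notation oW := (dartW T).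

(* Around each vertex the classes are cyclically sorted; [key] is the rank of
a class from [x0] on. *)
Lemma classes_sorted v : exists x0 (key : bool * bool -> nat), org x0 = v /\
  (forall y z, org y = v -> org z = v -> key (cls P y) = key (cls P z) -> cls P y = cls P z) /\
  (forall i j, i <= j -> j < order (@turn T) x0 ->
    key (cls P (iter i (@turn T) x0)) <= key (cls P (iter j (@turn T) x0))).
Proof.
case: (boolP (inner_vertex v)) => [iv|/not_inner_vertex o].
  have [x0 [a [b [c [d [ex e]]]]]] := inner_rule_cls P irr iv.
  exists x0, class_rank; split=> //; split.
    by move=> y z _ _; case: (cls P y) (cls P z) => [[] []] [[] []].
  move=> i j le lt.
  have nthc k : k < order (@turn T) x0 -> class_rank (cls P (iter k (@turn T) x0)) =
      nth 0 (map class_rank (full_turn a b c d)) k.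
    move=> lk; rewrite -e (nth_map (false, false)) ?size_map ?size_orbit //.
    by rewrite (nth_map x0) ?size_orbit // nth_traject.
  rewrite !nthc //; last exact: leq_ltn_trans lt.
  apply: (sorted_leq_nth leq_trans leqnn _ (sorted_full_turn a b c d)) => //;
    by rewrite inE size_map -e size_map size_orbit //; exact: leq_ltn_trans lt.
have outer x0 c0 c1 : org x0 = v -> cls P x0 = c0 -> cls P (tinv x0) = c1 -> c0 != c1 ->
    (forall y, org y = v -> [\/ y = x0, y = tinv x0 | inner_edge y /\ cls P y = c0]) ->
    exists x0 (key : bool * bool -> nat), org x0 = v /\
      (forall y z, org y = v -> org z = v -> key (cls P y) = key (cls P z) -> cls P y = cls P z) /\
      (forall i j, i <= j -> j < order (@turn T) x0 ->
        key (cls P (iter i (@turn T) x0)) <= key (cls P (iter j (@turn T) x0))).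
  move=> e0 k0 k1 ne at_v; exists x0, (fun c => nat_of_bool (c == c1)); split=> //.
  have cc y : org y = v -> y != tinv x0 -> cls P y = c0.
    by move=> ey /eqP n; case: (at_v y ey) => [->|//|[]].
  split.
    move=> y z ey ez; have [->|ny] := eqVneq y (tinv x0); have [->|nz] := eqVneq z (tinv x0) => //.
    - by rewrite (cc z) // k1 eqxx (negPf ne).
    - by rewrite (cc y) // k1 eqxx (negPf ne).
    by rewrite (cc y) // (cc z).
  move=> i j le lt; have [e|ni] := eqVneq (iter i (@turn T) x0) (tinv x0).
    suff -> : i = j by [].
    have ti : tinv x0 = iter (order (@turn T) x0).-1 (@turn T) x0 by [].
    have o0 := order_gt0 (@turn T) x0.
    have := congr1 (findex (@turn T) x0) e; rewrite ti !findex_iter; lia.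
  by rewrite (cc _ _ ni) ?(negPf ne) // org_iter_turn.
case: (cls_outer P irr) (turn_edge_outer irr) => -[a1 a2 a3 a4] [a5 a6 a7 a8] [t1 t2 t3 t4].
case: (ends irr) => _ [_ _ eE eS eW].
case: o => ev; rewrite ev in outer *.
- have e : tinv oN = edge oW by rewrite -t4 tinv_turn.
  by apply: (outer oN _ (false, false) erefl a1) => //; rewrite e // => y /(dart_at_N P irr).
- have e : tinv oE = edge oN by rewrite -t1 tinv_turn.
  by apply: (outer oE _ (true, true) eE a2) => //; rewrite e // => y /(dart_at_E P irr).
- have e : tinv oS = edge oE by rewrite -t2 tinv_turn.
  by apply: (outer oS _ (true, false) eS a3) => //; rewrite e // => y /(dart_at_S P irr).
have e : tinv oW = edge oS by rewrite -t3 tinv_turn.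
by apply: (outer oW _ (false, true) eW a4) => //; rewrite e // => y /(dart_at_W P irr).
Qed.

Definition follows x y := exists k, y = iter k.+1 (@turn T) x /\
  forall j, j <= k.+1 -> cls P (iter j (@turn T) x) = cls P x.

Lemma same_class_follows x y : org x = org y -> cls P x = cls P y -> x <> y ->
  follows x y \/ follows y x.
Proof.
move=> eo ec ne; have [x0 [key [e0 [kinj kle]]]] := classes_sorted (org x).
have : fconnect (@turn T) x0 x by rewrite -org_turn e0.
have : fconnect (@turn T) x0 y by rewrite -org_turn e0 eo.
case/iter_of_findex=> j lj ej /iter_of_findex [i li ei].
wlog lt : x y i j eo ec ne kinj kle e0 ei ej li lj / i < j.
  move=> h; case: (ltngtP i j) => [lt|lt|e].
  - exact: (h x y i j).
  - case: (h y x j i) => //; try by [left | right | move/esym].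
      by rewrite -eo.
      by rewrite -eo.
  by case: ne; rewrite ei ej e.
left; exists (j - i).-1; have -> : (j - i).-1.+1 = j - i by lia.
split; first by rewrite ei -iterD subnK // ltnW.
move=> l ll; apply: kinj => //; first by rewrite org_iter_turn.
have il : iter l (@turn T) x = iter (l + i) (@turn T) x0 by rewrite iterD -ei.
have k1 := kle i (l + i) (leq_addl _ _) ltac:(lia).
have k2 := kle (l + i) j ltac:(lia) lj.
by apply/eqP; rewrite eqn_leq il {1}ec ej k2 ei k1.
Qed.


(** * Directions of the edges and the clockwise order *)

Section Drawing.
Local Open Scope ring_scope.
Variable R : realFieldType.
Variables X Y : vertex T -> nat.
Hypothesis red_up : forall e, ot P e -> rd P e ->
  (X (org e) <= X (org (edge e)) /\ Y (org e) < Y (org (edge e)))%N.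
Hypothesis blue_right : forall e, ot P e -> ~~ rd P e ->
  (X (org e) < X (org (edge e)) /\ Y (org (edge e)) <= Y (org e))%N.
Hypothesis box : [/\ X (vS T) = 0, X (vW T) = 0, Y (vE T) = 0 & Y (vS T) = 0]%N /\
  forall v, [/\ X v <= X (vN T), X v <= X (vE T), Y v <= Y (vN T) & Y v <= Y (vW T)]%N.
Hypothesis XY_inj : forall u v, X u = X v -> Y u = Y v -> u = v.
Local Notation pos := (grid_position R X Y).
Local Notation dir := (direction pos).

(** The four half-open quadrants partition the nonzero vectors and follow each other clockwise like
    the classes; the vertical directions go with red and the horizontal ones with blue. *)
Definition quadrant (c : bool * bool) (d : R * R) :=
  if c.1 then if c.2 then (0 <= d.1) && (0 < d.2) else (0 < d.1) && (d.2 <= 0)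
  else if c.2 then (d.1 <= 0) && (d.2 < 0) else (d.1 < 0) && (0 <= d.2).

Lemma direction_edge x : dir (edge x) = - dir x.
Proof. by rewrite /direction edgeK opprB. Qed.

Lemma direction_quadrant x : quadrant (cls P x) (dir x).
Proof.
have out y : ot P y -> quadrant (cls P y) (dir y).
  rewrite /quadrant /= => oy; rewrite oy; case: ifP => ry.
    have [h1 h2] := red_up oy ry.
    by rewrite subr_ge0 subr_gt0 ler_nat ltr_nat h1 h2.
  have [h1 h2] := blue_right oy (negbT ry).
  by rewrite subr_gt0 subr_le0 ler_nat ltr_nat h1 h2.
case ox: (ot P x); first exact: out.
have oe : ot P (edge x) by rewrite ot_edge // ox.
have := out _ oe; rewrite direction_edge /quadrant /= oe ox rd_edge //.
by case: (rd P x); rewrite ?oppr_ge0 ?oppr_gt0 ?oppr_le0.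
Qed.

Lemma area_det (p q r : R * R) : area p q r = det (q - p) (r - p).
Proof. by []. Qed.

Lemma area_opp (p q r : R * R) : area (- p) (- q) (- r) = area p q r.
Proof. case: p q r => [p1 p2] [q1 q2] [r1 r2]; rewrite /area /=; ring. Qed.
Lemma det_sym (p q : R * R) : det q p = - det p q.
Proof. rewrite /det; ring. Qed.

Lemma det_cycle (u v w : R * R) : w = - (u + v) -> det v w = det u v /\ det w u = det u v.
Proof. by move=> ->; case: u v => [u1 u2] [v1 v2]; rewrite /det /=; split; ring. Qed.

(** Put [v' := - v], which lies in the quadrant of [u]. The condition on [w] compares the two
    coordinates of [u] and [v'] in opposite senses, which determines the orientation. *)
Lemma quadrant_det c (u v w : R * R) : w = - (u + v) ->
  quadrant c u -> quadrant (~~ c.1, c.2) v -> quadrant (next_class c) w ->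
  0 < det u v.
Proof.
move=> ->; case: c => c1 c2; case: u v => [u1 u2] [v1 v2].
rewrite /quadrant /det /=; case: c1; case: c2 => /= /andP[h1 h2] /andP[h3 h4] /andP[h5 h6]; nra.
Qed.

(** Each case of [triangle_classes] becomes the pattern of [quadrant_det] after a cyclic shift of
    the sides, which by [det_cycle] does not affect the determinant. *)
Lemma triangle_det x : x \notin outer_face T -> 0 < det (dir x) (dir (face x)).
Proof.
move=> ix; have q y := direction_quadrant y.
have s : dir x + dir (face x) + dir (face (face x)) = 0.
  rewrite /direction -(org_face x) -(org_face (face x)).
  have -> : org (edge (face (face x))) = org x by rewrite -org_face face3.
  by rewrite [z in z + _]addrC subrKA subrKA subrr.
have e1 : dir (face (face x)) = - (dir x + dir (face x)).
  by apply/eqP; rewrite -addr_eq0 addrC s.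
have e2 : dir x = - (dir (face x) + dir (face (face x))).
  by apply/eqP; rewrite -addr_eq0 addrA s.
have e3 : dir (face x) = - (dir (face (face x)) + dir x).
  by apply/eqP; rewrite -addr_eq0 addrA addrC addrA s.
have [d1 d2] := det_cycle e1.
have q1 := q x; have q2 := q (face x); have q3 := q (face (face x)).
have nn c : next_class (~~ c.1, c.2) = (~~ (next_class c).1, (next_class c).2) by case: c => [] [] [].
case: (triangle_classes P irr ix) => -[k1 k2]; rewrite k1 in q2; rewrite k2 in q3.
- exact: quadrant_det e1 q1 q2 q3.
- have q1' : quadrant (~~ ~~ ot P x, rd P x) (dir x) by rewrite negbK; exact: q1.
  rewrite -d2; exact: (@quadrant_det (~~ ot P x, rd P x) _ _ _ e3 q3 q1' q2).
rewrite -d1; apply: (quadrant_det (c := next_class (~~ ot P x, rd P x)) e2 q2 _ _).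
  by move: q3; rewrite /next_class /=; case: (ot P x) (rd P x) => [] [].
by move: q1; rewrite /next_class /cls /=; case: (ot P x) (rd P x) => [] [].
Qed.

Lemma corner_det x : turn x \notin outer_face T -> det (dir x) (dir (turn x)) < 0.
Proof.
move=> it; have ie : edge x \notin outer_face T by rewrite edge_outer_turn.
have := triangle_det ie; rewrite face_edge direction_edge.
move: (dir x) (dir (turn x)) => [u1 u2] [v1 v2]; rewrite /det /=; lra.
Qed.

Lemma class_eq_inner x : cls P (turn x) = cls P x -> turn x \notin outer_face T.
Proof.
move=> e; apply/negP; rewrite (outerE irr) !inE.
case: (cls_outer P irr) (turn_edge_outer irr) => -[a1 a2 a3 a4] [a5 a6 a7 a8] [t1 t2 t3 t4].
case/or4P=> /eqP e'; move: e; rewrite e'.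
- by have -> : x = edge oW; [apply: turn_inj; rewrite e'|rewrite a1 a8].
- by have -> : x = edge oN; [apply: turn_inj; rewrite e'|rewrite a2 a5].
- by have -> : x = edge oE; [apply: turn_inj; rewrite e'|rewrite a3 a6].
by have -> : x = edge oS; [apply: turn_inj; rewrite e'|rewrite a4 a7].
Qed.

Lemma quadrant_trans c (a b d : R * R) : quadrant c a -> quadrant c b -> quadrant c d ->
  det a b < 0 -> det b d < 0 -> det a d < 0.
Proof.
case: a b d => [a1 a2] [b1 b2] [d1 d2]; rewrite /det /=.
(* The coordinates of the plane identity [det a d * b = det a b * d + det b d * a]; the quadrant
   gives their signs. *)
have id : (a1 * d2 - a2 * d1) * b1 = (a1 * b2 - a2 * b1) * d1 + (b1 * d2 - b2 * d1) * a1 by ring.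
have id' : (a1 * d2 - a2 * d1) * b2 = (a1 * b2 - a2 * b1) * d2 + (b1 * d2 - b2 * d1) * a2 by ring.
case: c => -[] []; rewrite /quadrant /= => /andP[h1 h2] /andP[h3 h4] /andP[h5 h6] l1 l2; nra.
Qed.

Lemma follows_det x y : follows x y -> det (dir x) (dir y) < 0.
Proof.
case=> k [-> h]; elim: k h => [|k IH] h.
  by apply: corner_det; apply: class_eq_inner; exact: (h 1%N).
have ck : cls P (iter k.+1 (@turn T) x) = cls P x by apply: h; lia.
have ck' : cls P (iter k.+2 (@turn T) x) = cls P x by apply: h.
apply: (quadrant_trans (c := cls P x) (b := dir (iter k.+1 (@turn T) x))).
- exact: direction_quadrant.
- by rewrite -ck; exact: direction_quadrant.
- by rewrite -ck'; exact: direction_quadrant.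
- by apply: IH => j lj; apply: h; lia.
by apply: corner_det; apply: class_eq_inner; rewrite -iterS ck' ck.
Qed.

(** By Cramer's rule [e] is a combination of [a] and [b] with positive coefficients, and the union
    of two successive quadrants is convex enough to contain it. *)
Lemma quadrant_sector c d (a b e : R * R) : class_step c d ->
  quadrant c a -> quadrant d b -> det a b < 0 -> det a e < 0 -> det e b < 0 ->
  quadrant c e \/ quadrant d e.
Proof.
move=> cd qa qb ab ae eb; have D0 : det a b != 0 by rewrite lt_eqF.
pose s := det e b / det a b; pose t := det a e / det a b.
have s0 : 0 < s by rewrite /s nmulr_rgt0 // invr_lt0.
have t0 : 0 < t by rewrite /t nmulr_rgt0 // invr_lt0.
have Ds : det a b * s = det e b by rewrite mulrC divfK.
have Dt : det a b * t = det a e by rewrite mulrC divfK.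
clearbody s t.
have e1 : e.1 = s * a.1 + t * b.1.
  suff : det a b * e.1 = det a b * (s * a.1 + t * b.1) by move/(mulfI D0).
  by rewrite mulrDr !mulrA Ds Dt /det; ring.
have e2 : e.2 = s * a.2 + t * b.2.
  suff : det a b * e.2 = det a b * (s * a.2 + t * b.2) by move/(mulfI D0).
  by rewrite mulrDr !mulrA Ds Dt /det; ring.
move: cd qa qb; rewrite /quadrant e1 e2; clear -s0 t0.
move: s t s0 t0 a b => s t s0 t0 [a1 a2] [b1 b2] /=.
case: c d => [[] []] [[] []] //= _ /andP[h1 h2] /andP[h3 h4];
  try (by left; apply/andP; split; nra).
- case: (ltP 0 (s * a2 + t * b2)) => h; [left|right]; apply/andP; split=> //; nra.
- case: (ltP 0 (s * a1 + t * b1)) => h; [left|right]; apply/andP; split=> //; nra.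
- case: (ltP (s * a2 + t * b2) 0) => h; [left|right]; apply/andP; split=> //; nra.
- case: (ltP (s * a1 + t * b1) 0) => h; [left|right]; apply/andP; split=> //; nra.
Qed.

Lemma quadrant_class c d (e : R * R) : quadrant c e -> quadrant d e -> c = d.
Proof.
case: e => e1 e2; rewrite /quadrant; case: c d => [[] []] [[] []] //= /andP[h1 h2] /andP[h3 h4]; exfalso; lra.
Qed.

Lemma det_asym (u w : R * R) : det u w < 0 -> det w u < 0 -> False.
Proof. by rewrite [det w u]det_sym oppr_lt0 => h1 /(lt_trans h1); rewrite ltxx. Qed.

Lemma in_sector_acute (a b c : R * R) : det a b < 0 ->
  in_sector a b c = (det a c < 0) && (det c b < 0).
Proof. by rewrite /in_sector => ->. Qed.

Lemma not_in_sector (a b c : R * R) : 0 <= det a c -> 0 <= det c b -> ~~ in_sector a b c.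
Proof. by rewrite /in_sector !leNgt => /negPf -> /negPf ->; case: ifP. Qed.

(** By [quadrant_sector] the dart [y] would have the class of [x] or of [turn x]. Inside a class the
    directions turn clockwise in the order of the darts, and no dart comes between [x] and
    [turn x]. *)
Lemma inner_sector x y : turn x \notin outer_face T -> org y = org x -> y <> x -> y <> turn x ->
  ~~ in_sector (dir x) (dir (turn x)) (dir y).
Proof.
move=> it eo nx nt; have ab := corner_det it; rewrite (in_sector_acute _ ab).
apply/negP => /andP[ae eb].
have cs := class_step_turn P irr it.
have nf u w : follows u w -> det (dir w) (dir u) < 0 -> False.
  by move=> /follows_det; exact: det_asym.
have ct : cls P y = cls P (turn x) -> False.
  move=> e; have eo' : org (turn x) = org y by rewrite org_turn1.
  case: (same_class_follows eo' (esym e)) => [/esym //|f|[k [ek hk]]]; first exact: nf f eb.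
  have ex : x = iter k (@turn T) y by apply: turn_inj.
  case: k ek hk ex => [|k] ek hk ex; first by case: nx.
  have f : follows y x by exists k; split=> // j lj; apply: hk; lia.
  exact: nf f ae.
have cx : cls P y = cls P x -> False.
  move=> e; case: (same_class_follows eo e nx) => [f|[k [ek hk]]]; first exact: nf f ae.
  case: k ek hk => [|k] ek hk; first by case: nt.
  by apply: ct; rewrite e (hk 1%N).
have := quadrant_sector cs (direction_quadrant x) (direction_quadrant (turn x)) ab ae eb.
by case=> q; have := quadrant_class q (direction_quadrant y) => /esym.
Qed.


Lemma corner_arith (a b p q : R) : 0 <= p -> 0 <= q -> p <= a -> q <= b ->
  [/\ 0 <= (0 - a) * (q - b) - (b - b) * (p - a), 0 <= (p - a) * (0 - b) - (q - b) * (a - a),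
      0 <= (a - a) * (q - 0) - (b - 0) * (p - a) & 0 <= (p - a) * (0 - 0) - (q - 0) * (0 - a)] /\
  [/\ 0 <= (a - 0) * (q - 0) - (0 - 0) * (p - 0), 0 <= (p - 0) * (b - 0) - (q - 0) * (0 - 0),
      0 <= (0 - 0) * (q - b) - (0 - b) * (p - 0) & 0 <= (p - 0) * (b - b) - (q - b) * (a - 0)].
Proof. by move=> h1 h2 h3 h4; split; split; nra. Qed.

(** The outer cycle is drawn as the rectangle with corners S at the origin and N at the maxima. At
    each corner all directions lie in the closed quarter plane inside it, the complement of the
    sector; [corner_arith] lists the eight determinants. *)
Lemma outer_sector x y : turn x \in outer_face T -> org y = org x ->
  ~~ in_sector (dir x) (dir (turn x)) (dir y).
Proof.
move=> ot' eo; case: (box) => -[xS xW yE yS] mx.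
case: (turn_edge_outer irr) => t1 t2 t3 t4.
case: (ends irr) => -[n1 n2 n3] [n4 n5 n6 n7 n8].
have xEN : X (vE T) = X (vN T).
  by case: (mx (vN T)) => _ h1 _ _; case: (mx (vE T)) => h2 _ _ _; apply/eqP; rewrite eqn_leq h1 h2.
have yWN : Y (vW T) = Y (vN T).
  by case: (mx (vN T)) => _ _ _ h1; case: (mx (vW T)) => _ _ h2 _; apply/eqP; rewrite eqn_leq h1 h2.
case: (mx (org (edge y))) => bX _ bY _.
have ex k : turn x = turn k -> x = k by move/turn_inj.
have e2 : org (turn x) = org x by exact: org_turn1.
have bX' : (X (org (edge y)))%:R <= (X (vN T))%:R :> R by rewrite ler_nat.
have bY' : (Y (org (edge y)))%:R <= (Y (vN T))%:R :> R by rewrite ler_nat.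
have pX : 0 <= (X (org (edge y)))%:R :> R by exact: ler0n.
have pY : 0 <= (Y (org (edge y)))%:R :> R by exact: ler0n.
rewrite /direction e2 eo; move: (org (edge y)) bX' bY' pX pY => v bX' bY' pX pY.
have fin a b c : org (edge x) = a -> org x = b -> org (edge (turn x)) = c ->
    0 <= ((X a)%:R - (X b)%:R) * ((Y v)%:R - (Y b)%:R) - ((Y a)%:R - (Y b)%:R) * ((X v)%:R - (X b)%:R) :> R ->
    0 <= ((X v)%:R - (X b)%:R) * ((Y c)%:R - (Y b)%:R) - ((Y v)%:R - (Y b)%:R) * ((X c)%:R - (X b)%:R) :> R ->
    ~~ in_sector (pos (org (edge x)) - pos (org x)) (pos (org (edge (turn x))) - pos (org x)) (pos v - pos (org x)).
  have gd (u w z : vertex T) : det (pos u - pos z) (pos w - pos z) =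
      ((X u)%:R - (X z)%:R) * ((Y w)%:R - (Y z)%:R) - ((Y u)%:R - (Y z)%:R) * ((X w)%:R - (X z)%:R) by [].
  by move=> -> -> -> h1 h2; apply: not_in_sector; rewrite gd.
move: ot'; rewrite (outerE irr) !inE => /or4P[] /eqP e.
- have {}ex : x = edge oW by apply: ex; rewrite e.
  apply: (fin (vW T) (vN T) (vE T)); rewrite ?e ?ex ?edgeK //; rewrite ?yWN ?xEN ?xW ?yE ?xS ?yS ?mulr0n;
  by case: (corner_arith pX pY bX' bY') => -[? ? ? ?] [].
- have {}ex : x = edge oN by apply: ex; rewrite e.
  apply: (fin (vN T) (vE T) (vS T)); rewrite ?e ?ex ?edgeK //; rewrite ?yWN ?xEN ?xW ?yE ?xS ?yS ?mulr0n;
  by case: (corner_arith pX pY bX' bY') => -[? ? ? ?] [].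
- have {}ex : x = edge oE by apply: ex; rewrite e.
  apply: (fin (vE T) (vS T) (vW T)); rewrite ?e ?ex ?edgeK //; rewrite ?yWN ?xEN ?xW ?yE ?xS ?yS ?mulr0n;
  by case: (corner_arith pX pY bX' bY') => -[? ? ? ?] [].
have {}ex : x = edge oS by apply: ex; rewrite e.
apply: (fin (vS T) (vW T) (vN T)); rewrite ?e ?ex ?edgeK //; rewrite ?yWN ?xEN ?xW ?yE ?xS ?yS ?mulr0n;
  by case: (corner_arith pX pY bX' bY') => -[? ? ? ?] [].
Qed.

Lemma top_lt : (X (vS T) < X (vE T))%N /\ (Y (vS T) < Y (vW T))%N.
Proof.
case: (cls_outer P irr) => -[_ _ [os rs] _] [_ [oe re] _ _].
case: (ends irr) => -[n1 n2 n3] [n4 n5 n6 n7 n8]; split.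
  have oe' : ot P (edge oE) by rewrite oe.
  have := blue_right oe' (negbT re); rewrite edgeK n3 n6; by case.
have os' : ot P oS by rewrite os.
by have [_] := red_up os' rs; rewrite n4 n7.
Qed.

Lemma outer_area : \sum_(x in outer_face T) det (pos (org x)) (pos (org (edge x))) < 0.
Proof.
have u : uniq [:: oN; oE; oS; oW] by have := eight_uniq irr; rewrite -[eight T]/([:: oN; oE; oS; oW] ++ [:: edge oN; edge oE; edge oS; edge oW]) cat_uniq => /andP[].
have -> : \sum_(x in outer_face T) det (pos (org x)) (pos (org (edge x))) =
   \sum_(x <- [:: oN; oE; oS; oW]) det (pos (org x)) (pos (org (edge x))).
  rewrite (big_uniq _ u) /=; apply: eq_bigl => x; exact: (outerE irr).
case: (ends irr) => -[n1 n2 n3] [n4 n5 n6 n7 n8].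
rewrite !big_cons big_nil n1 n2 n3 n4 n5 n6 n7 n8 /det /grid_position /=.
case: (box) => -[-> -> -> ->] mx; have [h1 h2] := top_lt.
have xE : (0 < X (vE T))%N by apply: leq_ltn_trans h1.
have yW : (0 < Y (vW T))%N by apply: leq_ltn_trans h2.
have xN : (0 < X (vN T))%N by apply: leq_trans xE _; case: (mx (vE T)).
have yN : (0 < Y (vN T))%N by apply: leq_trans yW _; case: (mx (vW T)).
move: xE yW xN yN; rewrite -!(ltr0n R) => a b c d; nra.
Qed.

Lemma convex_grid : convex_drawing pos.
Proof.
case: (box) => -[xS xW yE yS] mx.
case: (ends irr) => -[n1 n2 n3] [n4 n5 n6 n7 n8].
split.
- move=> x ix; rewrite area_det -/(dir x).
  have -> : pos (org (edge (face x))) - pos (org x) = dir x + dir (face x).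
    by rewrite /direction org_face [RHS]addrC subrKA.
  have := triangle_det ix; move: (dir x) (dir (face x)) => [u1 u2] [v1 v2].
  by rewrite /det /=; lra.
(* The top side of the rectangle, from W to N. *)
- exists oW => d; rewrite (outerE irr) !inE => /or4P[] /eqP-> //=; rewrite ?n1 ?n2 ?n3 ?n4 ?n5 ?n6 ?n7 ?n8 ltr_nat ltnNge.
  + by case: (mx (vE T)) => ->.
  + by rewrite xS.
  + by rewrite xW.
move=> d; rewrite (outerE irr) !inE => /or4P[] /eqP-> /=; rewrite ?n1 ?n2 ?n3 ?n4 ?n5 ?n6 ?n7 ?n8 => e lt v; rewrite ler_nat.
- by case: (mx v).
- by case: (mx v).
- by move: lt; rewrite ltr_nat yS.
by move/eqP: e; rewrite eqr_nat => /eqP ->; case: (mx v).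
Qed.

Lemma convex_grid_opp : convex_drawing (fun v => - pos v).
Proof.
case: (box) => -[xS xW yE yS] mx.
case: (ends irr) => -[n1 n2 n3] [n4 n5 n6 n7 n8].
split.
- by move=> x ix; have := area_gt0 convex_grid ix; rewrite area_opp.
(* A half-turn makes the bottom side, from E to S, the top one. *)
- exists oE => d; rewrite (outerE irr) !inE => /or4P[] /eqP-> //=; rewrite ?n1 ?n2 ?n3 ?n4 ?n5 ?n6 ?n7 ?n8 ltrN2 ltr_nat ltnNge.
  + by case: (mx (vN T)) => _ ->.
  + by rewrite xS.
  + by rewrite xW.
move=> d; rewrite (outerE irr) !inE => /or4P[] /eqP-> /=; rewrite ?n1 ?n2 ?n3 ?n4 ?n5 ?n6 ?n7 ?n8 ltrN2 => e lt v; rewrite lerN2 ler_nat ?xS ?xW //.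
- by move: lt; rewrite ltr_nat yE.
by move: lt; rewrite ltr_nat yS.
Qed.

Lemma grid_inj : injective pos.
Proof.
move=> u v [/eqP e1 /eqP e2]; apply: XY_inj.
  by apply/eqP; rewrite -(eqr_nat R).
by apply/eqP; rewrite -(eqr_nat R).
Qed.

Lemma grid_drawing : straight_line_drawing pos.
Proof.
split.
- exact: grid_inj.
- move=> x y p n1 n2 sx sy.
  apply: (noncrossing irr convex_grid convex_grid_opp grid_inj _ n1 n2 sx sy).
  by exists (vS T), (vE T); rewrite /= ltr_nat; case: top_lt.
- move=> x y eo n1 n2; have [o|i] := boolP (turn x \in outer_face T).
    exact: outer_sector.
  exact: inner_sector.
exact: outer_area.
Qed.




End Drawing.

Lemma compact_drawing (R : realFieldType) :
  straight_line_drawing (grid_position R (compact_x P) (compact_y P)).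
Proof.
apply: grid_drawing.
- exact: red_direction.
- exact: blue_direction.
- exact: corners.
exact: (compact_inj irr).
Qed.
End VertexOrder.

(** * Program logic *)

Section Machine.
Variable w : nat.
Implicit Types (m : memory) (p q : cmd).

(** A functional semantics for loop-free programs. [safe] rejects loops, so their values here and in
    [duration] are dummies. *)
Fixpoint run p m : memory :=
  match p with
  | Skip | While _ _ => m
  | Put a i e => update m a (eval m i) (eval m e)
  | Seq p q => run q (run p m)
  | If e p q => if eval m e != 0 then run p m else run q m
  end.

Fixpoint duration p : nat :=
  match p with
  | Skip => 1
  | Put _ i e => (cost i + cost e).+1
  | Seq p q => (duration p + duration q).+1
  | If e p q => (cost e + maxn (duration p) (duration q)).+1
  | While _ _ => 0
  end.

Fixpoint safe p m : Prop :=
  match p with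
  | Skip => True
  | Put _ _ e => eval m e <= w
  | Seq p q => safe p m /\ safe q (run p m)
  | If e p q => if eval m e != 0 then safe p m else safe q m
  | While _ _ => False
  end.

Lemma exec_run p m : safe p m -> exists2 t, t <= duration p & exec w p m t (run p m).
Proof.
elim: p m => /= [m _|a i e m le|p IHp q IHq m [sp sq]|e p IHp q IHq m|] //.
- by exists 1 => //; constructor.
- by exists (cost i + cost e).+1 => //; constructor.
- have [t1 l1 x1] := IHp _ sp; have [t2 l2 x2] := IHq _ sq.
  by exists (t1 + t2).+1; [lia | apply: exec_seq x1 x2].
case: ifP => ev s.
  have [t l x] := IHp _ s; exists (cost e + t).+1; last by constructor; rewrite ev.
  by rewrite ltnS leq_add2l leq_max l.
have [t l x] := IHq _ s; exists (cost e + t).+1; last by constructor; rewrite ev.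
by rewrite ltnS leq_add2l leq_max l orbT.
Qed.

Definition triple (Q : memory -> Prop) p b (R : memory -> Prop) :=
  forall m, Q m -> exists t m', [/\ exec w p m t m', t <= b & R m'].

Lemma triple_run Q p R : (forall m, Q m -> safe p m /\ R (run p m)) ->
  triple Q p (duration p) R.
Proof.
move=> h m /h [s r]; have [t l x] := exec_run s.
by exists t, (run p m).
Qed.

Lemma triple_seq Q R S p q b1 b2 : triple Q p b1 R -> triple R q b2 S ->
  triple Q (Seq p q) (b1 + b2).+1 S.
Proof.
move=> h1 h2 m /h1 [t1 [m1 [x1 l1 /h2 [t2 [m2 [x2 l2 s]]]]]].
by exists (t1 + t2).+1, m2; split=> //; [apply: exec_seq x1 x2 | lia].
Qed.

Definition counter := Get 11 (Cst 0).
Definition for_loop (body : cmd) :=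
  While counter (Seq (Put 11 (Cst 0) (Defs.Sub counter (Cst 1))) body).

(** The counter is decremented before the body, which thus sees [k - 1] down to 0. Apart from the
    body, a round costs 10: 2 for the test, 6 for the decrement and 2 for the control; the final
    test costs 3. *)
Lemma triple_for (I : nat -> memory -> Prop) body k : k <= w ->
  (forall j m, I j m -> m 11 0 = j) ->
  (forall j m, j < k -> I j.+1 m -> safe body (update m 11 0 j) /\ I j (run body (update m 11 0 j))) ->
  triple (I k) (for_loop body) ((duration body + 10) * k + 3) (I 0).
Proof.
move=> kw Ic step; suff h j : j <= k ->
    triple (I j) (for_loop body) ((duration body + 10) * j + 3) (I 0) by exact: h.
elim: j => [_ m Im|j IH lt m Im].
  have e0 : eval m counter = 0 by rewrite /= (Ic _ _ Im).
  exists 3, m; split=> //.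
  - exact: (exec_stop w _ e0).
  by rewrite muln0.
have [s i] := step j m lt Im; have [t x l] := exec_run s.
have [t2 [m2 [x2 l2 i2]]] := IH (ltnW lt) _ i.
exists (cost counter + ((cost (Cst 0) + cost (Defs.Sub counter (Cst 1))).+1 + t).+1 + t2).+1, m2.
split=> //; last by rewrite /=; nia.
apply: exec_loop x2; first by rewrite /= (Ic _ _ Im).
apply: exec_seq l.
have -> : update m 11 0 j = update m 11 (eval m (Cst 0)) (eval m (Defs.Sub counter (Cst 1))).
  by rewrite /= (Ic _ _ Im) subn1.
by constructor; rewrite /= (Ic _ _ Im); lia.
Qed.

Lemma triple_conseq (Q Q' R R' : memory -> Prop) p b b' : triple Q p b R ->
  (forall m, Q' m -> Q m) -> (forall m, R m -> R' m) -> b <= b' -> triple Q' p b' R'.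
Proof.
move=> h hq hr le m /hq /h [t [m' [x l /hr r]]].
by exists t, m'; split=> //; lia.
Qed.

Fixpoint puts a (l : seq (exp * nat)) :=
  if l is (e, k) :: l' then Seq (Put a e (Cst k)) (puts a l') else Skip.

Fixpoint each A (Q : A -> Prop) (l : seq A) : Prop :=
  if l is x :: l' then Q x /\ each Q l' else True.

Definition same_but a m m' := forall b i, b != a -> m' b i = m b i.

(** The indices do not depend on array [a], and each stored value is a function [g] of its index, so
    neither the order of the stores nor repetitions matter. *)
Lemma run_puts a (l : seq (exp * nat)) (idx : exp * nat -> nat) (g : nat -> nat) m :
  each (fun ek => [/\ forall m', same_but a m m' -> eval m' ek.1 = idx ek,
                      g (idx ek) = ek.2 & ek.2 <= w]) l ->
  safe (puts a l) m /\ same_but a m (run (puts a l) m) /\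
  forall i, run (puts a l) m a i = if i \in map idx l then g i else m a i.
Proof.
elim: l m => [|[e k] l IH] m /=; first by [].
case=> -[he g1 g2] hl; have e1 : eval m e = idx (e, k) by apply: he.
have sb : same_but a m (update m a (eval m e) k).
  by move=> b i /negPf nb; rewrite /update nb.
have [|s [s' r]] := IH (update m a (eval m e) k).
  elim: l {IH} hl => //= ek l IH [[h1 h2 h3] /IH hl]; split=> //; split=> // m' sm.
  by apply: h1 => b i nb; rewrite sm // sb.
split=> //; split; first by move=> b i nb; rewrite s' // sb.
move=> i; rewrite r inE; case: ifP => h; first by rewrite orbT.
by rewrite orbF /update eqxx e1 /=; case: eqP => [->|].
Qed.

End Machine.

(** * Computing heights along the contour *)

Lemma compress_next (T : plane_graph) (h : vertex T -> nat) u v : h u < h v ->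
  (forall w, h w <= h u \/ h v <= h w) -> compress h v = (compress h u).+1.
Proof.
move=> lt gap; rewrite (compressD (ltnW lt)).
have -> : h v - h u = (h v - h u).-1.+1 by lia.
rewrite /= codom_f addnA addn1 -[RHS]addn0; congr (_ + _).
apply/eqP; rewrite -leqn0 leqNgt -has_count; apply/hasPn => k.
rewrite mem_iota => b; apply/codomP => -[w e]; have := gap w; lia.
Qed.

Section Walk.
Variables (U : plane_graph) (Q : transversal_pair U).
Hypothesis irr : irreducible_triangulation U.
Implicit Types (x y : dart U) (u v : vertex U).
Local Notation H := (leftmost Q).
Local Notation pos := (pos Q).
Local Notation entry := (entry Q).
Local Notation height := (height Q).
Local Notation psi := (psi Q).

Definition n_before k := #|[pred q | counted Q q && (pos q < k)]|.

Lemma n_before_le k l : k <= l -> n_before k <= n_before l.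
Proof.
move=> le; apply: subset_leq_card; apply/subsetP => q; rewrite !inE => /andP[-> lt] /=; lia.
Qed.

Lemma n_before_succ x : n_before (pos x).+1 = n_before (pos x) + counted Q x.
Proof.
rewrite /n_before (cardD1 x) inE ltnSn andbT addnC; congr (_ + _).
apply: eq_card => q; rewrite !inE ltnS leq_eqVlt.
have [->|ne] := eqVneq q x; first by rewrite ltnn andbF.
have /negPf -> // : pos q != pos x by apply: contraNneq ne => /(pos_inj irr) ->.
Qed.

(* State of the traversal after [k] steps: [c] is the compressed height of the
last vertex entered, [f] tells whether a counted edge was met since then, and
[Z] holds the compressed heights of all vertices entered so far. *)
Definition walk k c (f : nat) (Z : vertex U -> nat) := exists u,
  [/\ entry u <= k, forall v, entry v <= k -> height v <= height u,
      c = compress height u, (f != 0) = (height u < n_before k) &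
      forall v, entry v <= k -> Z v = compress height v].

Lemma walk_start Z : Z (vN U) = 0 -> walk 0 0 0 Z.
Proof.
have zN := height_N Q irr.
have cN : compress height (vN U) = 0 by rewrite /compress zN.
have eN v : entry v <= 0 -> v = vN U.
  by rewrite leqn0 => /eqP e; apply: (entry_inj irr (P := Q)); rewrite e entry_N.
move=> hZ; exists (vN U); split=> //.
- by rewrite entry_N.
- by move=> v /eN ->.
- by rewrite zN /n_before eq_card0 // => q; rewrite !inE andbF.
by move=> v /eN ->; rewrite hZ cN.
Qed.

(** The height of the new vertex is the number of counted darts met. Earlier vertices are at most as
    high as [u] and later ones at least as high as the new one, so a raised flag means the next used
    value and a lowered flag the same value. *)
Lemma walk_enter x c f Z Z' : H (edge x) -> walk (pos x) c f Z ->
  let c' := if f != 0 then c + 1 else c in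
  (forall v, Z' v = if v == org (edge x) then c' else Z v) -> walk (pos x).+1 c' 0 Z'.
Proof.
move=> hx [u [eu max ec ef eZ]] c' hZ.
have ew : entry (org (edge x)) = (pos x).+1 by rewrite entry_leftmost // edgeK.
have nc : counted Q x = false by rewrite /counted hx !andbF.
have hw : height (org (edge x)) = n_before (pos x).
  by rewrite -[LHS]/(n_before _) ew n_before_succ nc addn0.
have le : height u <= n_before (pos x) by apply: n_before_le.
have ec' : c' = compress height (org (edge x)).
  rewrite /c' ef -hw; case: ltnP => lt.
    rewrite ec addn1; symmetry; apply: compress_next => // v.
    have [l|l] := leqP (entry v) (pos x); first by left; exact: max.
    by right; rewrite hw; apply: n_before_le; exact: ltnW.
  by rewrite ec /compress; congr (count _ (iota 0 _)); lia.
have old v : entry v <= (pos x).+1 -> v = org (edge x) \/ entry v <= pos x.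
  rewrite leq_eqVlt -ew => /orP[/eqP /(entry_inj irr)|]; first by left.
  by rewrite ew; right.
exists (org (edge x)); split=> //.
- by rewrite ew.
- by move=> v /old [-> //|/max l]; rewrite hw; exact: leq_trans l le.
- by rewrite -ew ltnn.
move=> v /old [->|l]; first by rewrite hZ eqxx.
by rewrite hZ; case: eqP => [->//|_]; exact: eZ.
Qed.

Lemma walk_skip x c f f' Z : ~~ H (edge x) -> walk (pos x) c f Z ->
  (f' != 0) = counted Q x || (f != 0) -> walk (pos x).+1 c f' Z.
Proof.
move=> hx [u [eu max ec ef eZ]] hf; exists u.
have old v : entry v <= (pos x).+1 -> entry v <= pos x.
  by rewrite leq_eqVlt (negPf (entry_neq irr v hx)).
have le : height u <= n_before (pos x) by apply: n_before_le.
split=> //; first exact: leqW.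
- by move=> v /old /max.
- by rewrite hf n_before_succ ef; case: (counted Q x) => /=; lia.
by move=> v /old /eZ.
Qed.

Lemma order_psi : order psi (dartN U) = #|dart U|.
Proof. by apply: eq_card => x; rewrite -topredE /= psi_cover. Qed.

Lemma pos_iter k : k < #|dart U| -> pos (iter k psi (dartN U)) = k.
Proof. by rewrite -order_psi => lt; apply: findex_iter. Qed.

Lemma walk_end c f Z : walk #|dart U| c f Z -> exists u,
  [/\ forall v, height v <= height u, c = compress height u &
      forall v, Z v = compress height v].
Proof.
have lt v : entry v <= #|dart U| by apply: ltnW; exact: entry_lt_card.
by case=> u [_ max ec _ eZ]; exists u; split=> // v; [apply: max | apply: eZ].
Qed.

Definition out_flag x := in_red Q x && ot Q x.
Definition in_flag x := in_red Q x && ~~ ot Q x.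

(** Outgoing red darts precede outgoing blue ones, so except at S the outgoing range opens exactly
    where the flag of outgoing red darts turns on. Two table entries decide it. *)
Lemma leftmost_flag x : H x = (x == dartS U) || out_flag x && ~~ out_flag (tinv x).
Proof.
have [->|ne] := eqVneq x (dartS U); first by rewrite (leftmost_oS Q irr).
rewrite /out_flag /=; apply/idP/andP => [hx|[/andP[rx ox] nt]].
  rewrite (leftmost_in_red irr hx) (leftmost_ot hx); split=> //.
  by case/andP: hx; rewrite (negPf ne) /= => _ /negPf ->; rewrite andbF.
rewrite /H ox (negPf ne) /=; apply: contra nt => ot'; rewrite ot' andbT.
apply: contraT => /blue_inner [it rt]; exfalso.
have [o|ix] := boolP (x \in outer_face U).
  have e : x = dartW U.
    move: o ox; rewrite (outerE irr) !inE (negPf ne).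
    by case: (ot_outer Q irr) => -[n1 n2 _ _] _; case/or4P=> [/eqP->|/eqP->|//|/eqP->]; rewrite ?n1 ?n2.
  move: it; rewrite e; case: (turn_edge_outer irr) => _ _ <- _.
  by rewrite tinv_turn inner_edge_edge (inner_eight irr) !inE eqxx !orbT.
have := class_step_turn Q irr (x := tinv x); rewrite turn_tinv => /(_ ix).
rewrite /class_step /next_class /cls /= ot' ox (negPf rt) /=.
case rx': (rd Q x) => //= _; move: rx; rewrite in_redE rx' orbF => /(eight_cases irr) c.
move: ix ox rx' ne; case: (ot_outer Q irr) (rd_outer Q irr) =>
  [[a1 a2 a3 a4] [a5 a6 a7 a8]] [[b1 b2 b3 b4] [b5 b6 b7 b8]].
case: c => -[] e; rewrite e ?(outerE irr) ?inE ?eqxx ?orbT ?a7 ?a8 ?b5 // => _ _ _ _.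
have es : org (tinv x) = vS U by rewrite org_tinv e; case: (ends irr) => -[].
case: (dart_at_S Q irr es) => [q|q|[_ []]]; last by move=> _ rt'; rewrite rt' in rt.
  by rewrite q b3 in rt.
by move: it; rewrite q (inner_eight irr) !inE eqxx !orbT.
Qed.

Lemma counted_flag x : counted Q x = in_flag x && ~~ H (edge x).
Proof. by rewrite /counted /in_flag andbA. Qed.

End Walk.

Lemma count_trichotomy k (s : seq nat) :
  count (fun i => i < k) s + count (pred1 k) s + count (fun i => k < i) s = size s.
Proof. by elim: s => //= a s <-; case: (ltngtP a k) => /=; lia. Qed.

(** Compression counts the distinct smaller values, and reversal turns these into the larger ones.
    Counting all distinct values around [h v] and around the maximum [h u] relates the two
    numbers. *)
Lemma compress_opp (T : plane_graph) (h : vertex T -> nat) N u v :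
  (forall v, h v <= N) -> (forall v, h v <= h u) ->
  compress (fun v => N - h v) v = compress h u - compress h v.
Proof.
move=> hN max.
have count_values (z : vertex T -> nat) w : compress z w =
    count (fun k => k < z w) (undup (codom z)).
  rewrite /compress -!size_filter; apply/perm_size/uniq_perm; rewrite ?filter_uniq ?iota_uniq ?undup_uniq //.
  by move=> k; rewrite !mem_filter mem_iota add0n mem_undup andbC.
set V := undup (codom h).
have eV : perm_eq (undup (codom (fun v => N - h v))) (map (fun k => N - k) V).
  apply: uniq_perm; rewrite ?undup_uniq // ?map_inj_in_uniq ?undup_uniq //.
    move=> a b; rewrite !mem_undup => /codomP[a' ->] /codomP[b' ->].
    have := hN a'; have := hN b'; lia.
  move=> k; rewrite mem_undup; apply/codomP/mapP => [[a ->]|[a]].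
    by exists (h a) => //; rewrite mem_undup codom_f.
  by rewrite mem_undup => /codomP [b ->] ->; exists b.
rewrite !count_values (permP eV) count_map -/V.
have -> : count (preim (fun k => N - k) (fun k => k < N - h v)) V = count (fun k => h v < k) V.
  by apply: eq_in_count => k; rewrite mem_undup => /codomP [a ->] /=; have := hN a; have := hN v; lia.
have vV : h v \in V by rewrite mem_undup codom_f.
have uV : h u \in V by rewrite mem_undup codom_f.
have one k : k \in V -> count (pred1 k) V = 1.
  by move=> kV; rewrite count_uniq_mem ?undup_uniq // kV.
have e1 := count_trichotomy (h v) V; have e2 := count_trichotomy (h u) V.
have top : count (fun k => h u < k) V = 0.
  apply/eqP; rewrite -leqn0 leqNgt -has_count; apply/hasPn => k.
  by rewrite mem_undup => /codomP [a ->]; rewrite -leqNgt max.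
by move: e1 e2; rewrite !one // top; lia.
Qed.

(** * One pass of the program *)

Definition cell k := Get 11 (Cst k).
Definition edge_of e := Get 2 e.
Definition turn_of e := Get 3 e.
Definition face_of e := turn_of (edge_of e).
Definition n_darts := Get 0 (Cst 1).
Definition outer_cells (a b : nat) :=
  [:: (cell 4, a); (cell 5, a); (cell 6, b); (cell 7, b);
      (edge_of (cell 4), b); (edge_of (cell 5), b);
      (edge_of (cell 6), a); (edge_of (cell 7), a)].

(* Array 8 flags the outgoing red darts, array 9 the ingoing ones and array 10
the leftmost outgoing ones.  Cells 1, 2, 3 of array 11 hold the current dart,
the current compressed height and whether a counted edge was met since the last
vertex; cells 4 to 7 hold the outer darts. *)
Definition find_outer s :=
  Seq (Put 11 (Cst 4) s) (Seq (Put 11 (Cst 5) (face_of (cell 4)))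
  (Seq (Put 11 (Cst 6) (face_of (cell 5))) (Seq (Put 11 (Cst 7) (face_of (cell 6)))
  (Put 11 (Cst 0) n_darts)))).
Definition flag_body eA eI := Seq (Put 8 counter eA) (Put 9 counter eI).
(** On flags, the truncated difference [a - b] is [a && ~~ b]. *)
Definition leftmost_body :=
  Put 10 (turn_of counter) (Defs.Sub (Get 8 (turn_of counter)) (Get 8 counter)).
(** Cell 6 holds [oS], whose flag is forced: the dart before it around S is outgoing red too. *)
Definition start_walk z :=
  Seq (Put 10 (cell 6) (Cst 1)) (Seq (Put 11 (Cst 1) (cell 4))
  (Seq (Put 11 (Cst 2) (Cst 0)) (Seq (Put 11 (Cst 3) (Cst 0))
  (Seq (Put z (Get 1 (cell 4)) (Cst 0)) (Put 11 (Cst 0) n_darts))))).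
Definition walk_body z :=
  If (Get 10 (edge_of (cell 1)))
    (Seq (If (cell 3) (Seq (Put 11 (Cst 2) (Add (cell 2) (Cst 1))) (Put 11 (Cst 3) (Cst 0))) Skip)
    (Seq (Put z (Get 1 (edge_of (cell 1))) (cell 2))
         (Put 11 (Cst 1) (turn_of (edge_of (cell 1))))))
    (If (Get 10 (cell 1)) (Put 11 (Cst 1) (turn_of (edge_of (cell 1))))
      (Seq (If (Get 9 (cell 1)) (Put 11 (Cst 3) (Cst 1)) Skip)
           (Put 11 (Cst 1) (turn_of (cell 1))))).

Definition pass s eA eI z :=
  Seq (find_outer s) (Seq (for_loop (flag_body eA eI))
  (Seq (puts 8 (outer_cells 0 1)) (Seq (puts 9 (outer_cells 1 0))
  (Seq (Put 11 (Cst 0) n_darts) (Seq (for_loop leftmost_body)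
  (Seq (start_walk z) (for_loop (walk_body z)))))))).

Definition pass_time s eA eI z d :=
  (duration (find_outer s) + ((duration (flag_body eA eI) + 10) * d + 3 +
    (duration (puts 8 (outer_cells 0 1)) + (duration (puts 9 (outer_cells 1 0)) +
    (duration (Put 11 (Cst 0) n_darts) + ((duration leftmost_body + 10) * d + 3 +
    (duration (start_walk z) + ((duration (walk_body z) + 10) * d + 3)
    ).+1).+1).+1).+1).+1).+1).+1.

Lemma safe_seq w p q m : safe w (Seq p q) m = (safe w p m /\ safe w q (run p m)).
Proof. by []. Qed.
Lemma run_seq p q m : run (Seq p q) m = run q (run p m).
Proof. by []. Qed.
Lemma safe_if w e p q m : safe w (If e p q) m = if eval m e != 0 then safe w p m else safe w q m.
Proof. by []. Qed.
Lemma run_if e p q m : run (If e p q) m = if eval m e != 0 then run p m else run q m.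
Proof. by []. Qed.
Lemma safe_put w a i e m : safe w (Put a i e) m = (eval m e <= w).
Proof. by []. Qed.
Lemma run_put a i e m : run (Put a i e) m = update m a (eval m i) (eval m e).
Proof. by []. Qed.

Section Pass.
Variables (U : plane_graph) (Q : transversal_pair U).
Hypothesis irr : irreducible_triangulation U.
Implicit Types (x y : dart U) (u v : vertex U) (m : memory).
Local Notation H := (leftmost Q).
Local Notation psi := (psi Q).
Local Notation D := #|dart U|.
Local Notation oN := (dartN U).
Local Notation oE := (dartE U).
Local Notation oS := (dartS U).
Local Notation oW := (dartW U).

Definition did x : nat := enum_rank x.
Definition vid v : nat := enum_rank v.

Lemma did_lt x : did x < D. Proof. exact: ltn_ord. Qed.
Lemma did_inj : injective did. Proof. by move=> x y /val_inj /enum_rank_inj. Qed.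
Lemma vid_inj : injective vid. Proof. by move=> x y /val_inj /enum_rank_inj. Qed.
Lemma did_eq x y : (did x == did y) = (x == y). Proof. exact: inj_eq did_inj _ _. Qed.
Lemma vid_eq u v : (vid u == vid v) = (u == v). Proof. exact: inj_eq vid_inj _ _. Qed.
Lemma dart_of j : j < D -> exists x, did x = j.
Proof. by move=> lt; exists (enum_val (Ordinal lt)); rewrite /did enum_valK. Qed.
Lemma vertex_of j : j < #|vertex U| -> exists v, vid v = j.
Proof. by move=> lt; exists (enum_val (Ordinal lt)); rewrite /vid enum_valK. Qed.

Variables (w z : nat) (s eA eI : exp) (m0 : memory).
(** Nothing is required of the scratch arrays, since the second pass inherits those left by the
    first. *)
Definition keeps m := forall a i, a \notin [:: z; 8; 9; 10; 11] -> m a i = m0 a i.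

Hypothesis hz : (z == 6) || (z == 7).
Hypothesis m0_D : m0 0 1 = D.
Hypothesis m0_org : forall x, m0 1 (did x) = vid (org x).
Hypothesis m0_edge : forall x, m0 2 (did x) = did (edge x).
Hypothesis m0_turn : forall x, m0 3 (did x) = did (turn x).
Hypothesis eval_s : forall m, keeps m -> eval m s = did oN.
Hypothesis eval_A : forall m x, keeps m -> m 11 0 = did x -> inner_edge x -> eval m eA = out_flag Q x.
Hypothesis eval_I : forall m x, keeps m -> m 11 0 = did x -> inner_edge x -> eval m eI = in_flag Q x.
Hypothesis eval_A1 : forall m x, keeps m -> m 11 0 = did x -> eval m eA <= 1.
Hypothesis eval_I1 : forall m x, keeps m -> m 11 0 = did x -> eval m eI <= 1.
Hypothesis w_D : D <= w.

Lemma w1 : 1 <= w. Proof. by apply: leq_trans w_D; apply: leq_ltn_trans (did_lt oN). Qed.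

Lemma keeps_update m a i k : keeps m -> a \in [:: z; 8; 9; 10; 11] -> keeps (update m a i k).
Proof.
move=> km ha b j hb; rewrite /update; case: eqP => [e|_] /=; last exact: km.
by rewrite e ha in hb.
Qed.

Lemma keeps_cells m : keeps m -> [/\ m 0 1 = D, forall x, m 1 (did x) = vid (org x),
  forall x, m 2 (did x) = did (edge x) & forall x, m 3 (did x) = did (turn x)].
Proof.
by move=> km; split=> [|x|x|x]; rewrite km ?inE //; case/orP: hz => /eqP ->.
Qed.

Definition outer_known m := [/\ m 11 4 = did oN, m 11 5 = did oE, m 11 6 = did oS & m 11 7 = did oW].

(** Outer edges are left aside: the input is arbitrary there, and their flags are overwritten
    afterwards by means of [outer_cells]. *)
Definition flag_inv j m := [/\ keeps m, outer_known m, m 11 0 = j &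
  forall x, inner_edge x -> j <= did x -> m 8 (did x) = out_flag Q x /\ m 9 (did x) = in_flag Q x].

Ltac ks := repeat apply: keeps_update; rewrite ?inE ?eqxx ?orbT //.

Lemma find_outer_correct : triple w keeps (find_outer s) (duration (find_outer s)) (flag_inv D).
Proof.
apply: triple_run => m km; have [e0 e1 e2 e3] := keeps_cells km.
have l x : did x <= w by apply: leq_trans w_D; apply: ltnW; exact: did_lt.
have es := eval_s km; rewrite /= es /update /= !(e2, e3) e0; split; first by rewrite !l.
have k : keeps (update (update (update (update (update m 11 4 (did oN)) 11 5 (did oE))
   11 6 (did oS)) 11 7 (did oW)) 11 0 D) by ks.
by split=> // x _; rewrite leqNgt did_lt.
Qed.

Lemma flag_step j m : j < D -> flag_inv j.+1 m ->
  safe w (flag_body eA eI) (update m 11 0 j) /\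
  flag_inv j (run (flag_body eA eI) (update m 11 0 j)).
Proof.
move=> lt [km ok e0 tab]; have [x ex] := dart_of lt.
set m1 := update m 11 0 j.
have k1 : keeps m1 by ks.
have c1 : m1 11 0 = did x by rewrite ex /m1 /update eqxx.
have k2 k : keeps (update m1 8 j k) by ks.
have c2 k : (update m1 8 j k) 11 0 = did x by rewrite ex /m1 /update eqxx.
have lA := eval_A1 k1 c1; have lI k := eval_I1 (k2 k) (c2 k).
have e1 : eval m1 counter = j by rewrite /= c1 ex.
have e2 k : eval (update m1 8 j k) counter = j by rewrite /= c2 ex.
rewrite /flag_body; cbn [safe run]; rewrite e1 e2; split.
  by split; [apply: leq_trans lA w1 | apply: leq_trans (lI _) w1].
split.
- ks.
- by case: ok => h1 h2 h3 h4; rewrite /outer_known /m1 /update.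
- by rewrite /m1 /update.
move=> y iy; rewrite leq_eqVlt => /orP[/eqP e|lty].
  have exy : y = x by apply: did_inj; rewrite ex.
  rewrite exy in iy *; rewrite /update -!ex !eqxx /=; split; first exact: eval_A.
  have := eval_I (k2 (eval m1 eA)) (c2 _) iy.
  by rewrite -ex.
have [t1 t2] := tab y iy lty; rewrite /m1 /update /=.
have -> : (did y == j) = false by lia.
by [].
Qed.

Definition flags_known m := [/\ keeps m, outer_known m,
  forall x, m 8 (did x) = out_flag Q x & forall x, m 9 (did x) = in_flag Q x].

Definition outer_ids := [:: did oN; did oE; did oS; did oW;
  did (edge oN); did (edge oE); did (edge oS); did (edge oW)].

Lemma mem_outer_ids x : (did x \in outer_ids) = ~~ inner_edge x.
Proof. by rewrite (inner_eight irr) negbK !inE !did_eq. Qed.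

Lemma puts_outer a p q (F : dart U -> nat) m : (a == 8) || (a == 9) -> p <= 1 -> q <= 1 ->
  [/\ F oN = p, F oE = p, F oS = q & F oW = q] ->
  [/\ F (edge oN) = q, F (edge oE) = q, F (edge oS) = p & F (edge oW) = p] ->
  keeps m -> outer_known m ->
  let m' := run (puts a (outer_cells p q)) m in
  [/\ safe w (puts a (outer_cells p q)) m, keeps m', outer_known m', same_but a m m' &
    forall x, m' a (did x) = if inner_edge x then m a (did x) else F x].
Proof.
move=> ha p1 q1 [f1 f2 f3 f4] [f5 f6 f7 f8] km ok m'.
have [_ _ e2 _] := keeps_cells km; have [k4 k5 k6 k7] := ok.
pose g i := if [pick x | did x == i] is Some x then F x else 0.
have gE x : g (did x) = F x.
  rewrite /g; case: pickP => [y|/(_ x)]; last by rewrite eqxx.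
  by rewrite did_eq => /eqP ->.
have [na2 na11] : (2 != a) /\ (11 != a) by case/orP: ha => /eqP ->.
have pw := leq_trans p1 w1; have qw := leq_trans q1 w1.
have ids : map (fun ek : exp * nat => eval m ek.1) (outer_cells p q) = outer_ids.
  by rewrite /= k4 k5 k6 k7 !e2.
have [|sf [sb r]] := @run_puts w a (outer_cells p q) (fun ek => eval m ek.1) g m.
  have sm m2 : same_but a m m2 -> (forall i, m2 11 i = m 11 i) /\ (forall i, m2 2 i = m 2 i).
    by move=> h; split=> i; apply: h.
  rewrite /outer_cells; cbn [each fst snd]; rewrite /=.
  rewrite !k4 !k5 !k6 !k7 !e2 !gE.
  by do !split=> //; move=> m2 /sm [h1 h2]; rewrite ?h1 ?h2 ?k4 ?k5 ?k6 ?k7 ?e2.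
split=> //.
- move=> b i hb; rewrite -km // /m' sb //.
  by apply: contraNneq hb => ->; rewrite !inE; case/orP: ha => /eqP ->; rewrite eqxx ?orbT.
- by rewrite /outer_known /m' !sb.
move=> x; rewrite /m' r ids mem_outer_ids gE; by case: (inner_edge x).
Qed.

Lemma outer_flags :
  [/\ out_flag Q oN = false, out_flag Q oE = false, out_flag Q oS = true & out_flag Q oW = true] /\
  [/\ out_flag Q (edge oN) = true, out_flag Q (edge oE) = true, out_flag Q (edge oS) = false &
      out_flag Q (edge oW) = false].
Proof.
have r i : i < 8 -> in_red Q (nth oN (eight U) i).
  by move=> l; rewrite in_redE (inner_eight irr) mem_nth.
rewrite /out_flag; case: (ot_outer Q irr) => -[-> -> -> ->] [-> -> -> ->].
have := r 0 isT; have := r 1 isT; have := r 2 isT; have := r 3 isT.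
have := r 4 isT; have := r 5 isT; have := r 6 isT; have := r 7 isT => /=.
by do 8! move=> ->.
Qed.

Lemma in_out_flag x : ~~ inner_edge x -> in_flag Q x = ~~ out_flag Q x.
Proof. by move=> o; rewrite /in_flag /out_flag in_redE o. Qed.

Lemma outer_not_inner i : i < 8 -> ~~ inner_edge (nth oN (eight U) i).
Proof. by move=> l; rewrite (inner_eight irr) negbK mem_nth. Qed.

Definition out_known m := [/\ keeps m, outer_known m,
  forall x, m 8 (did x) = out_flag Q x & forall x, inner_edge x -> m 9 (did x) = in_flag Q x].

Lemma out_known_correct m : flag_inv 0 m ->
  safe w (puts 8 (outer_cells 0 1)) m /\ out_known (run (puts 8 (outer_cells 0 1)) m).
Proof.
case=> km ok _ tab; case: outer_flags => -[o1 o2 o3 o4] [o5 o6 o7 o8].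
have F1 : [/\ nat_of_bool (out_flag Q oN) = 0, nat_of_bool (out_flag Q oE) = 0,
    nat_of_bool (out_flag Q oS) = 1 & nat_of_bool (out_flag Q oW) = 1].
  by rewrite o1 o2 o3 o4.
have F2 : [/\ nat_of_bool (out_flag Q (edge oN)) = 1, nat_of_bool (out_flag Q (edge oE)) = 1,
    nat_of_bool (out_flag Q (edge oS)) = 0 & nat_of_bool (out_flag Q (edge oW)) = 0].
  by rewrite o5 o6 o7 o8.
have := @puts_outer 8 0 1 (fun x => out_flag Q x) m isT isT isT F1 F2 km ok.
move: (run _ m) (safe _ _ m) => m' sf [s1 k1 ok1 sb1 t1]; split; first exact: s1.
split; [exact: k1 | exact: ok1 | move=> x | move=> x ix].
  by rewrite t1; case: ifP => // ix; case: (tab x ix isT).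
by rewrite sb1 //; case: (tab x ix isT).
Qed.

Lemma flags_known_correct m : out_known m ->
  safe w (puts 9 (outer_cells 1 0)) m /\ flags_known (run (puts 9 (outer_cells 1 0)) m).
Proof.
case=> km ok t8 t9; case: outer_flags => -[o1 o2 o3 o4] [o5 o6 o7 o8].
have n := outer_not_inner.
have G1 : [/\ nat_of_bool (in_flag Q oN) = 1, nat_of_bool (in_flag Q oE) = 1,
    nat_of_bool (in_flag Q oS) = 0 & nat_of_bool (in_flag Q oW) = 0].
  rewrite (in_out_flag (n 0 isT)) (in_out_flag (n 1 isT)) (in_out_flag (n 2 isT)).
  by rewrite (in_out_flag (n 3 isT)) /= o1 o2 o3 o4.
have G2 : [/\ nat_of_bool (in_flag Q (edge oN)) = 0, nat_of_bool (in_flag Q (edge oE)) = 0,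
    nat_of_bool (in_flag Q (edge oS)) = 1 & nat_of_bool (in_flag Q (edge oW)) = 1].
  rewrite (in_out_flag (n 4 isT)) (in_out_flag (n 5 isT)) (in_out_flag (n 6 isT)).
  by rewrite (in_out_flag (n 7 isT)) /= o5 o6 o7 o8.
have := @puts_outer 9 1 0 (fun x => in_flag Q x) m isT isT isT G1 G2 km ok.
move: (run _ m) (safe _ _ m) => m' sf [s1 k1 ok1 sb1 t1]; split; first exact: s1.
split; [exact: k1 | exact: ok1 | move=> x | move=> x].
  by rewrite sb1.
by rewrite t1; case: ifP => // ix; exact: t9.
Qed.

Definition leftmost_inv j m := [/\ flags_known m, m 11 0 = j &
  forall y, j <= did y -> m 10 (did (turn y)) = out_flag Q (turn y) && ~~ out_flag Q y].

Lemma flags_known_update m a i k : flags_known m -> (a == 10) || (a == 11) && (i < 4) ->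
  flags_known (update m a i k).
Proof.
case=> km [k4 k5 k6 k7] t8 t9 ha; split.
- by apply: keeps_update => //; rewrite !inE; case/orP: ha => [->|/andP[-> _]]; rewrite ?orbT.
- rewrite /outer_known /update; case/orP: ha => [/eqP -> //|/andP[/eqP -> lt]] /=.
  by do 4 (case: eqP => [e|_]; first by move: lt; rewrite -e).
- by move=> x; rewrite /update -t8; case/orP: ha => [/eqP -> //|/andP[/eqP -> _]].
by move=> x; rewrite /update -t9; case/orP: ha => [/eqP -> //|/andP[/eqP -> _]].
Qed.

Lemma leftmost_step j m : j < D -> leftmost_inv j.+1 m ->
  safe w leftmost_body (update m 11 0 j) /\ leftmost_inv j (run leftmost_body (update m 11 0 j)).
Proof.
move=> lt [fk e0 tab]; have [x ex] := dart_of lt.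
have [km ok t8 t9] := fk; have [_ _ e2 e3] := keeps_cells km.
rewrite /leftmost_body /= /update /= -ex e3 !t8.
have b : out_flag Q (turn x) - out_flag Q x = out_flag Q (turn x) && ~~ out_flag Q x.
  by case: (out_flag Q (turn x)) (out_flag Q x) => [] [].
rewrite b; split; first by apply: leq_trans w1; case: (_ && _).
have fk' : flags_known (update (update m 11 0 (did x)) 10 (did (turn x))
    (out_flag Q (turn x) && ~~ out_flag Q x)).
  by apply: flags_known_update => //; apply: flags_known_update.
split=> // y ly /=; rewrite did_eq (inj_eq (@turn_inj U)).
case: eqP => [->//|ne]; apply: tab; rewrite -ex ltn_neqAle ly andbT did_eq.
by apply/eqP => e; apply: ne.
Qed.

Definition walk_inv j m := [/\ keeps m, m 11 0 = j,
  (forall x, m 9 (did x) = in_flag Q x) /\ (forall x, m 10 (did x) = H x),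
  m 11 1 = did (iter (D - j) psi oN) &
  walk Q (D - j) (m 11 2) (m 11 3) (fun v => m z (vid v))].

Lemma z_neq : [/\ (z == 8) = false, (z == 9) = false, (z == 10) = false & (z == 11) = false] /\
  [/\ (8 == z) = false, (9 == z) = false, (10 == z) = false & (11 == z) = false] /\
  [/\ (1 == z) = false, (2 == z) = false, (3 == z) = false & (0 == z) = false].
Proof. by case/orP: hz => /eqP ->. Qed.

Lemma start_walk_correct m : leftmost_inv 0 m ->
  safe w (start_walk z) m /\ walk_inv D (run (start_walk z) m).
Proof.
case=> [[km ok t8 t9] e0 tab]; have [k4 k5 k6 k7] := ok.
have [d0 e1 e2 e3] := keeps_cells km.
case: z_neq => -[z1 z2 z3 z4] [[y1 y2 y3 y4] [x1 x2 x3 x4]].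
have kf : keeps (run (start_walk z) m) by rewrite /start_walk /=; ks.
split; first by rewrite /= /update /= x4 d0 w1; do !split=> //; apply: leq_trans w_D; rewrite k4 ltnW ?did_lt.
rewrite /start_walk /= in kf *; split=> //; rewrite /update /=.
- by rewrite x4 d0.
- split=> x; first by rewrite y2 t9.
  rewrite y3 k6 did_eq (leftmost_flag Q irr) /=; case: (x =P oS) => //= _.
  by have := tab (tinv x) isT; rewrite turn_tinv.
- by rewrite y4 subnn /= k4.
rewrite subnn y4 z4 z3 k4 e1; apply: walk_start => //.
by rewrite eqxx /= -[vN U]/(org oN) eqxx.
Qed.

(** The bound is strict because [c + 1] may still have to be stored. It holds as [oS] is not
    counted, so there are fewer counted darts than darts. *)
Lemma walk_height_le k c f Z : walk Q k c f Z -> c < w.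
Proof.
case=> u [_ _ -> _ _]; apply: leq_ltn_trans (compress_bound _ _) _.
apply: leq_ltn_trans (height_le_counted Q u) _; apply: leq_trans w_D.
rewrite /n_counted -(cardC (counted Q)) -[X in X < _]addn0 ltn_add2l.
by apply/card_gt0P; exists oS; rewrite inE /= -[oS \in _]/(counted Q oS) /counted (ot_at_S Q irr) // andbF.
Qed.

Lemma walk_step j m : j < D -> walk_inv j.+1 m ->
  safe w (walk_body z) (update m 11 0 j) /\ walk_inv j (run (walk_body z) (update m 11 0 j)).
Proof.
move=> lt [km e0 [t9 t10] ex wk]; set k := D - j.+1 in ex wk.
have ek : D - j = k.+1 by rewrite /k; lia.
have kD : k < D by rewrite /k; lia.
move: ex; set x := iter k psi oN => ex; have px : pos Q x = k by apply: pos_iter.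
have [d0 e1 e2 e3] := keeps_cells km; have cw := walk_height_le wk.
set m1 := update m 11 0 j.
have k1 : keeps m1 by ks.
have E1 : eval m1 (Get 10 (edge_of (cell 1))) = H (edge x) by rewrite /= /m1 /update /= ex e2 t10.
have E2 : eval m1 (cell 3) = m 11 3 by [].
have E3 : eval m1 (Get 10 (cell 1)) = H x by rewrite /= /m1 /update /= ex t10.
have E4 : eval m1 (Get 9 (cell 1)) = in_flag Q x by rewrite /= /m1 /update /= ex t9.
have E5 : eval m1 (turn_of (edge_of (cell 1))) = did (turn (edge x)).
  by rewrite /= /m1 /update /= ex e2 e3.
have E6 : eval m1 (turn_of (cell 1)) = did (turn x) by rewrite /= /m1 /update /= ex e3.
have l y : did y <= w by apply: leq_trans w_D; apply: ltnW; exact: did_lt.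
have c0 : m1 11 0 = j by rewrite /m1 /update.
have cx : m1 11 1 = did x by rewrite /m1 /update.
have c9 y : m1 9 (did y) = in_flag Q y by rewrite /m1 /update /= t9.
have c10 y : m1 10 (did y) = H y by rewrite /m1 /update /= t10.
have cz i : m1 z i = m z i by rewrite /m1 /update; case/orP: hz => /eqP ->.
have cc : m1 11 2 = m 11 2 by [].
have cf : m1 11 3 = m 11 3 by [].
clearbody m1; case: z_neq => -[z1 z2 z3 z4] [[y1 y2 y3 y4] _].
rewrite -px in wk; rewrite /walk_inv ek iterS -/x.
(* First case: [x] leads to a child, which is entered now. *)
rewrite /walk_body safe_if run_if E1; have [he|nhe] := boolP (H (edge x)).
  have ps : psi x = turn (edge x) by have := psi_edge he; rewrite edgeK.
  rewrite !safe_seq !run_seq; set p1 := If _ _ _; set m2 := run p1 m1.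
  set c' := if m 11 3 != 0 then m 11 2 + 1 else m 11 2.
  have s1 : safe w p1 m1.
    by rewrite /p1 safe_if E2; case: (m 11 3 != 0) => //=; rewrite cc addn1.
  have [q1 q2 q3 q4] : [/\ m2 11 0 = j, m2 11 2 = c', m2 11 3 = 0 &
     forall a i, (a != 11) || (i == 1) -> m2 a i = m1 a i].
    rewrite /m2 /p1 run_if E2 /c'; case: eqP => [f0|_] /=.
      by rewrite c0 cc cf.
    rewrite /update /= c0 cc; split=> // a i; case: (a =P 11) => [->|] //= /eqP ->.
    by [].
  have k2 : keeps m2 by move=> a i h; rewrite q4 ?k1 //; apply: contraNT h; rewrite negb_or negbK => /andP[/eqP -> _]; rewrite !inE !orbT.
  clearbody m2; have [f0 f1 f2 f3] := keeps_cells k2.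
  have ex2 : m2 11 1 = did x by rewrite q4.
  have lc : c' <= w by rewrite /c'; case: ifP => _; [rewrite addn1 | exact: ltnW].
  have V1 : eval m2 (Get 1 (edge_of (cell 1))) = vid (org (edge x)) by rewrite /= ex2 f2 f1.
  have V2 : eval m2 (cell 2) = c' by [].
  rewrite !safe_put !run_put V1 V2; set m3 := update m2 z _ _.
  have k3 : keeps m3 by rewrite /m3; ks.
  have [g0 g1 g2 g3] := keeps_cells k3.
  have r11 i : m3 11 i = m2 11 i by rewrite /m3 /update y4.
  have V3 : eval m3 (turn_of (edge_of (cell 1))) = did (turn (edge x)).
    by rewrite /= r11 ex2 g2 g3.
  rewrite V3; split; first by do !split.
  split.
  - by ks.
  - by rewrite /update /= r11.
  - by split=> y; rewrite /update /= /m3 /update ?y2 ?y3 /= q4 // ?c9 ?c10.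
  - by rewrite /update /= ps.
  rewrite {1 2}/update /= !r11 q2 q3 -px; apply: (walk_enter irr he wk) => v.
  by rewrite /update z4 /= /m3 /update eqxx /= vid_eq; case: eqP => // _; rewrite q4 ?z4 // cz.
have ff : (nat_of_bool false != 0) = false by [].
(* Second case: [x] leads back to the parent; it is outgoing, hence not counted. *)
rewrite !ff run_if safe_if E3; have [hx|nhx] := boolP (H x).
  rewrite safe_put run_put E5; split; first exact: l.
  split.
  - by ks.
  - by rewrite /update.
  - by split=> y; rewrite /update /= ?c9 ?c10.
  - by rewrite /update /= (psi_tree hx).
  rewrite /update /= cc cf -px; apply: (walk_skip (f := m 11 3) irr nhe).
    by case: wk => u [w1' w2 w3 w4 w5]; exists u; split=> // v lv; rewrite z4 /= cz; exact: w5.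
  by rewrite counted_flag nhe andbT /in_flag (leftmost_ot hx) andbF.
(* Third case: off the tree the contour only turns, and [x] is counted iff it is ingoing red. *)
rewrite !ff safe_seq run_seq; set p1 := If _ _ _; set m2 := run p1 m1.
have s1 : safe w p1 m1 by rewrite /p1 safe_if E4; case: (in_flag Q x) => //=; exact: w1.
have [q1 q3 q4] : [/\ m2 11 0 = j, m2 11 3 = (if in_flag Q x then 1 else m 11 3) &
   forall a i, (a != 11) || (i != 3) -> m2 a i = m1 a i].
  rewrite /m2 /p1 run_if E4; case: (in_flag Q x) => /=; last by rewrite c0 cf.
  by rewrite /update /= c0; split=> // a i; case: (a =P 11) => //= _ /negPf ->.
have k2 : keeps m2 by move=> a i h; rewrite q4 ?k1 //; apply: contraNT h; rewrite negb_or negbK => /andP[/eqP -> _]; rewrite !inE !orbT.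
clearbody m2; have [f0 f1 f2 f3] := keeps_cells k2.
have ex2 : m2 11 1 = did x by rewrite q4.
have V6 : eval m2 (turn_of (cell 1)) = did (turn x) by rewrite /= ex2 f3.
rewrite safe_put run_put V6; split; first by split.
split.
- by ks.
- by rewrite /update /=.
- by split=> y; rewrite /update /= q4 // ?c9 ?c10.
- by rewrite /update /= (not_on_tree nhx nhe).
rewrite /update /= q3 q4 // cc -px; apply: (walk_skip (f := m 11 3) irr nhe).
  by case: wk => u [w1' w2 w3 w4 w5]; exists u; split=> // v lv; rewrite z4 /= q4 ?z4 // cz; exact: w5.
by rewrite counted_flag nhe andbT; case: (in_flag Q x).
Qed.

Lemma pass_correct : triple w keeps (pass s eA eI z) (pass_time s eA eI z D)
  (fun m => keeps m /\ exists u, [/\ forall v, height Q v <= height Q u,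
      m 11 2 = compress (height Q) u & forall v, m z (vid v) = compress (height Q) v]).
Proof.
apply: triple_seq find_outer_correct _.
apply: triple_seq (triple_for (I := flag_inv) w_D _ flag_step) _.
  by move=> j m [].
apply: triple_seq (triple_run out_known_correct) _.
apply: triple_seq (triple_run flags_known_correct) _.
apply: (triple_seq (R := leftmost_inv D)).
  apply: triple_run => m fk; have [km _ _ _] := fk; have [d0 _ _ _] := keeps_cells km.
  rewrite safe_put run_put [eval m n_darts]/= d0; split=> //; split.
  - exact: flags_known_update.
  - by rewrite /update.
  by move=> y; rewrite leqNgt did_lt.
apply: triple_seq (triple_for (I := leftmost_inv) w_D _ leftmost_step) _.
  by move=> j m [].
apply: triple_seq (triple_run start_walk_correct) _.
apply: triple_conseq (triple_for (I := walk_inv) w_D _ walk_step) _ _ _ => //.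
  by move=> j m [].
move=> m [km _ _ _ wk]; split=> //; rewrite subn0 in wk.
by have [u [h1 h2 h3]] := walk_end irr wk; exists u.
Qed.

End Pass.

(** * The whole program *)

Definition red_of := Get 4 counter.
Definition out_of := Get 5 counter.
(** Truncated differences of flags again: [out - (1 - red)] selects outgoing red and [red - out]
    ingoing red. The blue pass exchanges the colours and starts from [dartE], as the quarter turn
    prescribes. *)
Definition red_pass := pass (Get 0 (Cst 2)) (Defs.Sub out_of (Defs.Sub (Cst 1) red_of))
  (Defs.Sub red_of out_of) 6.
Definition blue_pass := pass (face_of (Get 0 (Cst 2))) (Defs.Sub out_of red_of)
  (Defs.Sub (Defs.Sub (Cst 1) red_of) out_of) 7.
(** After the red pass cell 2 still holds the greatest compressed height, from which each height is
    subtracted to give the abscissa, by [compress_opp]. *)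
Definition flip_body := Put 6 counter (Defs.Sub (cell 2) (Get 6 counter)).
Definition flip := Seq (Put 11 (Cst 0) (Get 0 (Cst 0))) (for_loop flip_body).
Definition compact_program := Seq red_pass (Seq flip blue_pass).

Lemma eq_compress (T : plane_graph) (h1 h2 : vertex T -> nat) v : h1 =1 h2 ->
  compress h1 v = compress h2 v.
Proof. by move=> e; rewrite /compress e; apply: eq_count => k; rewrite /= (eq_codom e). Qed.

Section Program.
Variables (T : plane_graph) (P : transversal_pair T).
Hypothesis irr : irreducible_triangulation T.
Local Notation D := #|dart T|.
Local Notation V := #|vertex T|.

Lemma nth_table A (a : A) (f : dart T -> A) x : nth a [seq f y | y <- enum (dart T)] (did x) = f x.
Proof. by rewrite /did (nth_map x) ?nth_enum_rank // -cardE. Qed.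

Record input_kept (m : memory) : Prop := InputKept {
  kept_V : m 0 0 = V;
  kept_D : m 0 1 = D;
  kept_outer : m 0 2 = did (dartN T);
  kept_org : forall x : dart T, m 1 (did x) = vid (org x);
  kept_edge : forall x : dart T, m 2 (did x) = did (edge x);
  kept_turn : forall x : dart T, m 3 (did x) = did (turn x);
  kept_red : forall x : dart T, m 4 (did x) = red P x;
  kept_out : forall x : dart T, m 5 (did x) = out P x }.

Lemma input_keptP : input_kept (input P).
Proof. by split=> // x; rewrite /input /= nth_table. Qed.

Lemma input_kept_eq m m' : input_kept m -> (forall a i, a < 6 -> m' a i = m a i) -> input_kept m'.
Proof. by move=> [h1 h2 h3 h4 h5 h6 h7 h8] e; split=> *; rewrite e. Qed.

Lemma keeps_small z m m' a i : (z == 6) || (z == 7) -> keeps z m m' -> a < 6 -> m' a i = m a i.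
Proof.
move=> hz k lt; apply: k; rewrite !inE.
by case/orP: hz => /eqP ->; do 6 (case: a lt => // a lt).
Qed.

Variable w : nat.
Lemma compress_le_D v : compress (height P) v <= D.
Proof.
apply: leq_trans (compress_bound _ _) (leq_trans (height_le_counted P v) _).
exact: max_card.
Qed.

Definition flip_inv (m0 : memory) c (Z : vertex T -> nat) j m :=
  [/\ forall a i, a < 6 -> m a i = m0 a i, m 11 0 = j, m 11 2 = c &
      forall v, m 6 (vid v) = if vid v < j then Z v else c - Z v].

Lemma flip_correct m0 c (Z : vertex T -> nat) : V <= w -> m0 0 0 = V -> m0 11 2 = c -> c <= w ->
  (forall v, m0 6 (vid v) = Z v) ->
  triple w (eq m0) flip ((duration (Put 11 (Cst 0) (Get 0 (Cst 0))) +
    ((duration flip_body + 10) * V + 3)).+1) (flip_inv m0 c Z 0).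
Proof.
move=> w_V eV ec cw eZ; apply: (triple_seq (R := flip_inv m0 c Z V)).
  apply: triple_run => _ <-; rewrite safe_put run_put /= eV; split=> //.
  split=> // [a i|v]; first by rewrite /update; case: (a =P 11) => // ->.
  by rewrite /update /= eZ [vid v < _]ltn_ord.
apply: triple_for => // [j m []//|j m lt [old e0 e2 tab]].
have [x ex] := vertex_of lt; have tx := tab x.
rewrite ex ltnSn in tx.
rewrite /flip_body safe_put run_put /= /update /= e2 tx; split; first by lia.
split=> //= [a i la|v].
  by case: (a =P 6) la => [->//|_ la] /=; case: (a =P 11) la => [->//|_ la]; exact: old.
rewrite -ex vid_eq; case: eqP => [->|ne]; first by rewrite ltnn.
rewrite tab; congr (if _ then _ else _); rewrite -ex.
have : vid v != vid x by rewrite vid_eq; apply/eqP.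
lia.
Qed.

Hypothesis w_D : D <= w.

Lemma red_pass_correct m0 : input_kept m0 ->
  triple w (keeps 6 m0) red_pass (pass_time (Get 0 (Cst 2))
    (Defs.Sub out_of (Defs.Sub (Cst 1) red_of)) (Defs.Sub red_of out_of) 6 D)
  (fun m => keeps 6 m0 m /\ exists u, [/\ forall v, height P v <= height P u,
      m 11 2 = compress (height P) u & forall v, m 6 (vid v) = compress (height P) v]).
Proof.
move=> k0; have kI m : keeps 6 m0 m -> input_kept m.
  by move=> k; apply: input_kept_eq k0 _ => a i; apply: keeps_small k.
have b1 (b c : bool) : b - c <= 1 by case: b c => [] [].
apply: pass_correct => //; try by case: k0.
- by move=> m /kI [].
- move=> m x /kI k e ix; rewrite /= e kept_out // kept_red //.
  by rewrite /out_flag /in_red ix /= ot_inner //; case: (red P x) (out P x) => [] [].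
- move=> m x /kI k e ix; rewrite /= e kept_out // kept_red //.
  by rewrite /in_flag /in_red ix /= ot_inner //; case: (red P x) (out P x) => [] [].
- by move=> m x /kI k e; rewrite /= e kept_out // kept_red //; case: (red P x) (out P x) => [] [].
by move=> m x /kI k e; rewrite /= e kept_out // kept_red.
Qed.

Lemma blue_pass_correct m0 : input_kept m0 ->
  let Q := rotate_pair irr P in
  triple w (keeps 7 m0) blue_pass (pass_time (face_of (Get 0 (Cst 2))) (Defs.Sub out_of red_of)
    (Defs.Sub (Defs.Sub (Cst 1) red_of) out_of) 7 D)
  (fun m => keeps 7 m0 m /\ exists u, [/\ forall v, height Q v <= height Q u,
      m 11 2 = compress (height Q) u & forall v, m 7 (vid v) = compress (height Q) v]).
Proof.
move=> k0 Q; have kI m : keeps 7 m0 m -> input_kept m.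
  by move=> k; apply: input_kept_eq k0 _ => a i; apply: keeps_small k.
have iQ (x : dart T) : inner_edge (T := rotate T) x -> inner_edge x by rewrite inner_edge_rotate.
have rQ x : inner_edge (T := T) x -> in_red Q x = ~~ red P x.
  by move=> ix; rewrite in_red_rotate /in_blue ix.
apply: (pass_correct (U := rotate T) (Q := Q)) => //; try by case: k0.
- exact: irreducible_rotate.
- by move=> m /kI k; rewrite /= kept_outer // kept_edge // kept_turn.
- move=> m x /kI k e ix; rewrite /= e kept_out // kept_red //.
  rewrite /out_flag ot_inner // rQ ?iQ //= /rotate_out; case: (red P x) (out P x) => [] [] //.
- move=> m x /kI k e ix; rewrite /= e kept_out // kept_red //.
  rewrite /in_flag ot_inner // rQ ?iQ //= /rotate_out; case: (red P x) (out P x) => [] [] //.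
- by move=> m x /kI k e; rewrite /= e kept_out // kept_red //; case: (red P x) (out P x) => [] [].
by move=> m x /kI k e; rewrite /= e kept_out // kept_red //; case: (red P x) (out P x) => [] [].
Qed.

End Program.

Lemma pass_time_mono s eA eI z d d' : d <= d' -> pass_time s eA eI z d <= pass_time s eA eI z d'.
Proof. by move=> le; rewrite /pass_time; nia. Qed.

(** The time is affine in the number of darts; for positive [n] its constant term is absorbed by the
    factor [n]. The factor 6 comes from [card_darts]. *)
Lemma pass_time_linear s eA eI z n : 0 < n ->
  pass_time s eA eI z (6 * n) <= pass_time s eA eI z 6 * n.
Proof. by move=> n0; rewrite /pass_time; nia. Qed.

Lemma linear_time : linear_time_algorithm (@compact_x) (@compact_y).
Proof.
(* The constants are kept abstract, so that the arithmetic never unfolds the programs. *)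
have [K1 eK1] : exists K, K = pass_time (Get 0 (Cst 2))
    (Defs.Sub out_of (Defs.Sub (Cst 1) red_of)) (Defs.Sub red_of out_of) 6 6 by eexists.
have [K2 eK2] : exists K, K = pass_time (face_of (Get 0 (Cst 2))) (Defs.Sub out_of red_of)
    (Defs.Sub (Defs.Sub (Cst 1) red_of) out_of) 7 6 by eexists.
have [K3 eK3] : exists K, K = duration (Put 11 (Cst 0) (Get 0 (Cst 0))) by eexists.
have [K4 eK4] : exists K, K = duration flip_body by eexists.
(* The term 24 more than covers the 10 steps per round of the flip loop and the fixed overheads, and
   it makes the word bound at least [6 * n], hence at least the number of darts. *)
exists compact_program, (K1 + K2 + K3 + K4 + 24) => T P irr.
set n := #|vertex T|; set w := _ * n.
have n0 : 0 < n by apply/card_gt0P; exists (vN T).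
have Dn : #|dart T| <= 6 * n by have := card_darts irr; lia.
have wD : #|dart T| <= w by apply: leq_trans Dn _; rewrite leq_mul2r; lia.
have wV : n <= w by rewrite -{1}[n]mul1n leq_mul2r; lia.
have [t1 [m1 [x1 l1 [k1 [u [max e1 tab1]]]]]] :=
  red_pass_correct irr wD (input_keptP P) (fun a i _ => erefl).
have i1 : input_kept P m1.
  by apply: input_kept_eq (input_keptP P) _ => a i; apply: keeps_small k1.
have cw : compress (height P) u <= w by apply: leq_trans wD; exact: compress_le_D.
have [t2 [m2 [x2 l2 [k2 _ _ tab2]]]] := flip_correct wV (kept_V i1) e1 cw tab1 erefl.
have i2 : input_kept P m2 by apply: input_kept_eq i1 k2.
have [t3 [m3 [x3 l3 [k3 [u' [_ _ tab3]]]]]] := blue_pass_correct irr wD i2 (fun a i _ => erefl).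
exists (t1 + (t2 + t3).+1).+1, m3; split.
- by apply: exec_seq x1 _; apply: exec_seq x2 x3.
- rewrite -eK3 -eK4 -/n in l2.
  have := leq_trans l1 (leq_trans (pass_time_mono _ _ _ _ Dn) (pass_time_linear _ _ _ _ n0)).
  have := leq_trans l3 (leq_trans (pass_time_mono _ _ _ _ Dn) (pass_time_linear _ _ _ _ n0)).
  rewrite -eK1 -eK2 => h3 h1; rewrite mulnDl in l2; rewrite /w !mulnDl.
  by move: (leq_pmulr K3 n0) h1 h3 l2; move: n0; clear; lia.
move=> v; split.
  have -> : m3 6 (enum_rank v) = m2 6 (vid v) by apply: k3.
  rewrite tab2 ltn0 -(compress_opp _ (height_le_counted P) max).
  by apply: eq_compress => a; rewrite transversal_xE.
rewrite -[LHS]/(m3 7 (vid v)) (tab3 v).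
by apply: eq_compress => a; rewrite (transversal_yE irr).
Qed.

Theorem theorem23 :
  (forall (T : plane_graph) (P : transversal_pair T),
     irreducible_triangulation T ->
     let x := compact_x P in
     let y := compact_y P in
     [/\ forall R : realFieldType,
           straight_line_drawing (grid_position R x y),
         half_perimeter x y <= #|vertex T| - 1,
         forall d : dart T, inner_edge d -> red P d -> out P d ->
           y (org d) < y (org (edge d)) /\ x (org d) <= x (org (edge d)) &
         forall d : dart T, inner_edge d -> ~~ red P d -> out P d ->
           x (org d) < x (org (edge d)) /\ y (org (edge d)) <= y (org d)])
  /\ linear_time_algorithm compact_x compact_y.
Proof.
split; last exact: linear_time.
move=> T P irr x y; split=> [R||d ix rd od|d ix rd od].
- exact: compact_drawing.
- exact: compact_half_perimeter.
- rewrite -(rd_inner P ix) in rd; rewrite -(ot_inner P ix) in od.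
  have [le lt] := red_direction irr od rd.
  exact: (conj lt le).
rewrite -(rd_inner P ix) in rd; rewrite -(ot_inner P ix) in od.
exact: (blue_direction irr od rd).
Qed.
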